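(* The problem $1|nr=1, a_j=\bar a, q=const, hme, h=const|\sum w_jC_j$ admits an FPTAS. That is, for all fixed positive integers $q$ and $h$, consider the problem of minimizing the total weighted completion time $\sum_j w_jC_j$ over the feasible schedules of an instance of single machine scheduling with one non-renewable resource having $q$ supplies, in which all jobs have the same resource requirement $a_j=\bar a$, and the instance is given in high-multiplicity encoding with $h$ job classes. Then there is a family of algorithms $\{A_\varepsilon\}_{\varepsilon>0}$ such that for each $\varepsilon>0$ and each such instance, $A_\varepsilon$ outputs (in compact representation) a feasible schedule with $\sum_j w_jC_j\le(1+\varepsilon)\,OPT$, where $OPT$ is the minimum objective value over all feasible schedules, and the running time of $A_\varepsilon$ is bounded by a polynomial in the size of the high-multiplicity encoded input and $1/\varepsilon$.
   Context: Scheduling model. A finite set $\mathcal{J}$ of jobs is to be processed without preemption on a single machine that processes at most one job at a time. Job $j$ has processing time $p_j>0$, weight $w_j>0$, and resource requirement $a_j\ge 0$ from a single non-renewable resource. The resource is supplied at $q\ge1$ known time points $0=u_1<u_2<\dots<u_q$, in quantities $\tilde b_1,\dots,\tilde b_q>0$. A schedule assigns a start time $S_j\ge 0$ to each job; job $j$ occupies the machine during $[S_j,S_j+p_j)$, and its completion time is $C_j=S_j+p_j$. A schedule is feasible if the jobs do not overlap on the machine and, for every time $t\ge0$, $\sum_{j: S_j\le t} a_j\le\sum_{\ell: u_\ell\le t}\tilde b_\ell$. It is assumed that the total requirement equals the total supply, $\sum_{j}a_j=\sum_{\ell=1}^q\tilde b_\ell$. High-multiplicity encoding (''hme''). The job set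 is partitioned into $h$ classes $\mathcal{J}_1,\dots,\mathcal{J}_h$ such that all jobs in class $\mathcal{J}_i$ have the same processing time $p_i$, weight $w_i$ and resource requirement $a_i$. The input consists of $h$; for each class the number $s_i$ of jobs in the class and the common parameters $p_i,a_i,w_i$; and $q$, the time points $u_\ell$ and quantities $\tilde b_\ell$. All numbers are rational (the $s_i$ being positive integers) and encoded in binary, so the number of jobs $\sum_i s_i$ may be exponential in the input size. Compact representation of a schedule: $h\cdot q$ tuples $(\ell,i,t_{i\ell},g_{i\ell})$, where $\ell$ is the index of a supply period $[u_\ell,u_{\ell+1})$ (with $u_{q+1}=\infty$), $i$ is the index of a job class, $t_{i\ell}$ is the start time of the first job of class $\mathcal{J}_i$ scheduled from $u_\ell$ on in that period, and $g_{i\ell}$ is the number of jobs of this class scheduled consecutively (without idle time) from $t_{i\ell}$ on. *)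

(* Defs.v *)
From mathcomp Require Import all_boot all_order all_algebra.
From mathcomp Require Import reals.
Set Implicit Arguments.
Unset Strict Implicit.
Unset Printing Implicit Defensive.
Import Order.TTheory GRing.Theory Num.Theory.
Local Open Scope ring_scope.

(** * Algorithms and their running time *)

(* Algorithms are programs over finitely many registers that hold natural
   numbers of unbounded size.  Time is charged by bit length, as in the
   logarithmic-cost RAM, with the schoolbook price for each operation, so that
   polynomial time means the same as on a Turing machine. *)

Inductive binop := Add | Sub | Mul | Div | Leq.

(* [Sub] is truncated, division by zero gives zero, [Leq] returns 0 or 1. *)
Definition binop_sem (o : binop) (m n : nat) : nat :=
  match o with
  | Add => (m + n)%N
  | Sub => (m - n)%N
  | Mul => (m * n)%N
  | Div => (m %/ n)%N
  | Leq => (m <= n)%N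
  end.

Inductive expr :=
  | Const of nat
  | Reg of nat
  | Op of binop & expr & expr.

Inductive cmd :=
  | Skip
  | Assign of nat & expr
  | Seq of cmd & cmd
  | If of expr & cmd & cmd
  | While of expr & cmd.

Definition store := nat -> nat.

Definition update (s : store) (r v : nat) : store :=
  fun r' => if r' == r then v else s r'.

(* Number of binary digits; zero has one digit. *)
Definition bitlen (n : nat) : nat := (trunc_log 2 n).+1.

Fixpoint eval (s : store) (e : expr) : nat :=
  match e with
  | Const n => n
  | Reg r => s r
  | Op o e1 e2 => binop_sem o (eval s e1) (eval s e2)
  end.

Fixpoint eval_time (s : store) (e : expr) : nat :=
  match e with
  | Const n => bitlen n
  | Reg r => bitlen (s r)
  | Op o e1 e2 => (eval_time s e1 + eval_time s e2
                   + (bitlen (eval s e1)).+1 * (bitlen (eval s e2)).+1)%N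
  end.

(* [exec c s n s'] : started in [s], the program [c] halts in [s'] after time
   [n].  A guard counts as true when its value is nonzero. *)
Inductive exec : cmd -> store -> nat -> store -> Prop :=
  | ExecSkip s : exec Skip s 1 s
  | ExecAssign s r e :
      exec (Assign r e) s (eval_time s e).+1 (update s r (eval s e))
  | ExecSeq c1 c2 s1 s2 s3 n1 n2 :
      exec c1 s1 n1 s2 -> exec c2 s2 n2 s3 ->
      exec (Seq c1 c2) s1 (n1 + n2) s3
  | ExecIfTrue e c1 c2 s s' n :
      eval s e != 0%N -> exec c1 s n s' ->
      exec (If e c1 c2) s (eval_time s e + n).+1 s'
  | ExecIfFalse e c1 c2 s s' n :
      eval s e = 0%N -> exec c2 s n s' ->
      exec (If e c1 c2) s (eval_time s e + n).+1 s'
  | ExecWhileTrue e c s1 s2 s3 n1 n2 :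
      eval s1 e != 0%N -> exec c s1 n1 s2 -> exec (While e c) s2 n2 s3 ->
      exec (While e c) s1 (eval_time s1 e + n1 + n2).+1 s3
  | ExecWhileFalse e c s :
      eval s e = 0%N -> exec (While e c) s (eval_time s e).+1 s.

(* The input words occupy the first registers; all others start at zero. *)
Definition load (x : seq nat) : store := fun r => nth 0%N x r.

(* The members of a family differ only in one hard-wired constant.  As registers
   cannot hold reals, the accuracy enters through the integer ceil(1/eps). *)
Definition uniform_family (R : realType) (A : R -> cmd) : Prop :=
  exists (c : cmd) (r : nat), forall eps : R, 0 < eps ->
    A eps = Seq (Assign r (Const `|Num.ceil eps^-1|%N)) c.

(** * Instances in high-multiplicity encoding *)

Record instance (q h : nat) := Instance {
  mult : 'I_h -> nat;
  ptime : 'I_h -> rat;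
  weight : 'I_h -> rat;
  req : 'I_h -> rat;
  stime : 'I_q -> rat;
  supply : 'I_q -> rat }.

(* Jobs are pairs of a class and a rank inside this class. *)
Definition job (q h : nat) (I : instance q h) : finType :=
  {i : 'I_h & 'I_(mult I i)}.

Definition cls (q h : nat) (I : instance q h) (j : job I) : 'I_h := tag j.

Record valid (q h : nat) (I : instance q h) : Prop := Valid {
  mult_gt0 : forall i, (0 < mult I i)%N;
  ptime_gt0 : forall i, 0 < ptime I i;
  weight_gt0 : forall i, 0 < weight I i;
  req_ge0 : forall i, 0 <= req I i;
  stime_first : forall l : 'I_q, l = 0%N :> nat -> stime I l = 0;
  stime_incr : forall l l' : 'I_q, (l < l')%N -> stime I l < stime I l';
  supply_gt0 : forall l, 0 < supply I l;
  req_supply : \sum_(j : job I) req I (cls j) = \sum_(l < q) supply I l }.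

Definition equal_requirements (q h : nat) (I : instance q h) : Prop :=
  exists abar : rat, forall j : job I, req I (cls j) = abar.

(* All rationals of a valid instance are nonnegative, so no sign is stored. *)
Definition encode_rat (x : rat) : seq nat := [:: `|numq x|%N; `|denq x|%N].

Definition encode (q h : nat) (I : instance q h) : seq nat :=
  h :: flatten [seq mult I i :: encode_rat (ptime I i) ++ encode_rat (req I i)
                              ++ encode_rat (weight I i) | i <- enum 'I_h]
  ++ q :: flatten [seq encode_rat (stime I l) ++ encode_rat (supply I l)
                  | l <- enum 'I_q].

Definition input_size (q h : nat) (I : instance q h) : nat :=
  \sum_(x <- encode I) bitlen x.

(** * Schedules *)

Section Schedules.
Variables (R : realType) (q h : nat) (I : instance q h).
Implicit Type S : job I -> R.

Definition completion S (j : job I) : R := S j + ratr (ptime I (cls j)).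

Record feasible S : Prop := Feasible {
  start_ge0 : forall j, 0 <= S j;
  no_overlap : forall j k, j != k ->
    completion S j <= S k \/ completion S k <= S j;
  resource_ok : forall t : R, 0 <= t ->
    \sum_(j : job I | S j <= t) ratr (req I (cls j))
      <= \sum_(l < q | ratr (stime I l) <= t) (ratr (supply I l) : R) }.

Definition cost S : R :=
  \sum_(j : job I) ratr (weight I (cls j)) * completion S j.

Definition is_minimum (opt : R) : Prop :=
  (exists2 S, feasible S & cost S = opt) /\
  (forall S, feasible S -> opt <= cost S).

(* The last supply period is unbounded: no [l'] satisfies the guard then. *)
Definition in_period (l : 'I_q) (x : R) : bool :=
  (ratr (stime I l) <= x) &&
  [forall l' : 'I_q, (l' == l.+1 :> nat) ==> (x < ratr (stime I l'))].

End Schedules.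

(** * Compact schedules *)

Record compact (q h : nat) := Compact {
  bstart : 'I_q -> 'I_h -> rat;
  bsize : 'I_q -> 'I_h -> nat }.

(* The jobs of class [i] that start in period [l] form one block of [g]
   consecutive jobs beginning at [t]; if [g = 0] the value of [t] is
   irrelevant.  This determines the schedule up to exchanging identical jobs. *)
Definition represents (R : realType) (q h : nat) (I : instance q h)
    (C : compact q h) (S : job I -> R) : Prop :=
  forall (l : 'I_q) (i : 'I_h),
    perm_eq [seq S j | j <- enum (job I) & (cls j == i) && in_period I l (S j)]
            [seq ratr (bstart C l i + ptime I i *+ k)
            | k <- iota 0 (bsize C l i)].

(* The tuple (l, i, t, g) is found in five consecutive registers, the rational
   [t] being given by a numerator and a nonzero, not necessarily coprime,
   denominator.  Periods and classes are numbered from zero. *)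
Definition outputs (q h : nat) (s : store) (C : compact q h) : Prop :=
  forall (l : 'I_q) (i : 'I_h), let r := (5 * (l * h + i))%N in
    [/\ s r = l,
        s r.+1 = i,
        (0 < s r.+3)%N,
        bstart C l i = (s r.+2)%:R / (s r.+3)%:R
      & s r.+4 = bsize C l i].

(* Main.v *)
(* Let [g l i] be the number of jobs of class [i] assigned to supply period [l].
   For a given assignment it is best to start each period as early as possible and
   to follow Smith's order inside it; since the cost of a sequence is a sum over
   pairs of jobs of a delay that is at least [min (p_i w_j, p_j w_i)], the resulting
   cost [total_cost g] bounds the cost of every schedule with these numbers from
   below.  It is quadratic and monotone in [g].

   As all jobs need the same amount of the resource, feasibility of [g] only bounds
   the number of jobs in the first periods from above.  Hence one may go through
   the periods from the last to the first and round up each number to the next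
   point of a grid of ratio [1 + 1 / N] as long as jobs of the class are left.  This
   multiplies each number by at most [1 + 1 / N], and so the cost by at most
   [(1 + 1 / N) ^ 2].  For constant [q] and [h] there are polynomially many points
   to enumerate, and all orders of the classes can be tried instead of sorting.

   Jobs assigned to a period that ends before they start are carried over to the
   next period, where Smith's order is applied again.  This does not increase the
   cost and gives at most one block of each class in each period. *)

Require Import Defs.
From mathcomp Require Import all_boot all_order all_algebra.
From mathcomp Require Import reals boolp zify ring lra.
Set Implicit Arguments.
Unset Strict Implicit.
Unset Printing Implicit Defensive.
Import Order.TTheory GRing.Theory Num.Theory.

(** * Costs of assignments of jobs to supply periods *)

(** Two obstacles shape the proof. Carrying jobs over changes the numbers of jobs per period, so the
    schedule that is output does not have the numbers [g] it started from. Its cost is compared with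
    [total_cost g] one period at a time, using that the machine stays busy until the next supply
    whenever jobs are carried over. Moreover, the search repeats arithmetic on registers of
    unbounded size, and each evaluation may multiply bit lengths by a constant. Hence the schedule
    of a candidate is computed without reading the best one found so far, and the scratch registers
    are erased afterwards, so that the lengths do not compound.

    All data are scaled to natural numbers, and [2 * D * E] times the cost of a schedule made of
    blocks is a natural number; an optimum therefore exists by well-ordering, with no compactness
    argument. Real start times occur only in the lower bound for arbitrary feasible schedules. The
    grid has [N = 3 * K] with [K] the ceiling of [1 / eps], which makes [(1 + 1 / N) ^ 2] at most
    [1 + eps]. *)

Section Costs.
Local Open Scope nat_scope.
Variables (P W : nat -> nat).

Definition pair_cost i j := minn (P i * W j) (P j * W i).

Definition work (cs : seq nat) (x : nat -> nat) := \sum_(i <- cs) x i * P i.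

Definition load_weight (cs : seq nat) (x : nat -> nat) :=
  \sum_(i <- cs) x i * W i.

Definition cross (cs : seq nat) (x y : nat -> nat) :=
  \sum_(i <- cs) \sum_(j <- cs) x i * y j * pair_cost i j.

(* Twice the least total weighted completion time of [x i] jobs of each class
   [i] processed from time [t] on: two jobs of classes [i] and [j] delay each
   other by [pair_cost i j] in Smith's order, and by no less in any order. *)
Definition period_cost (cs : seq nat) (t : nat) (x : nat -> nat) :=
  2 * t * load_weight cs x + (cross cs x x + \sum_(i <- cs) x i * (P i * W i)).

Lemma pair_costC i j : pair_cost i j = pair_cost j i.
Proof. by rewrite /pair_cost minnC. Qed.

Lemma crossC cs x y : cross cs x y = cross cs y x.
Proof.
rewrite /cross exchange_big /=; apply: eq_bigr => i _; apply: eq_bigr => j _.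
by rewrite pair_costC (mulnC (x j)).
Qed.

Lemma crossDl cs x y z : cross cs (fun i => x i + y i) z = cross cs x z + cross cs y z.
Proof.
rewrite /cross -big_split; apply: eq_bigr => i _ /=; rewrite -big_split.
by apply: eq_bigr => j _ /=; rewrite !mulnDl.
Qed.

Lemma crossDr cs x y z : cross cs z (fun i => x i + y i) = cross cs z x + cross cs z y.
Proof. by rewrite crossC crossDl !(crossC _ z). Qed.

Lemma workD cs x y : work cs (fun i => x i + y i) = work cs x + work cs y.
Proof. by rewrite /work -big_split; apply: eq_bigr => i _ /=; rewrite mulnDl. Qed.

Lemma load_weightD cs x y :
  load_weight cs (fun i => x i + y i) = load_weight cs x + load_weight cs y.
Proof.
by rewrite /load_weight -big_split; apply: eq_bigr => i _ /=; rewrite mulnDl.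
Qed.

Lemma work_load_weight cs x y :
  work cs x * load_weight cs y =
  \sum_(i <- cs) \sum_(j <- cs) x i * y j * (P i * W j).
Proof.
rewrite /work big_distrl; apply: eq_bigr => i _ /=.
by rewrite /load_weight big_distrr; apply: eq_bigr => j _ /=; ring.
Qed.

(** The product is the delay that the jobs [y] suffer when all jobs [x] run before them. *)
Lemma cross_le cs x y : cross cs x y <= work cs x * load_weight cs y.
Proof.
rewrite work_load_weight; apply: leq_sum => i _; apply: leq_sum => j _.
by rewrite leq_mul2l geq_minl orbT.
Qed.

(** When [x] precedes [y] in Smith's order, every minimum is attained by [P i * W j], so running [x]
    first is optimal; absent classes contribute zero. *)
Lemma cross_ge cs x y :
  (forall i j, i \in cs -> j \in cs -> 0 < x i -> 0 < y j ->
     P i * W j <= P j * W i) ->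
  work cs x * load_weight cs y <= cross cs x y.
Proof.
move=> smith; rewrite work_load_weight /cross !big_seq; apply: leq_sum => i ics.
rewrite !big_seq; apply: leq_sum => j jcs.
have [->|x0] := posnP (x i); first by rewrite mul0n.
have [->|y0] := posnP (y j); first by rewrite muln0.
by rewrite leq_mul2l leq_min leqnn smith ?orbT.
Qed.

Lemma period_costD cs t x y :
  period_cost cs t (fun i => x i + y i) =
  period_cost cs t x + period_cost cs t y + 2 * cross cs x y.
Proof.
rewrite /period_cost load_weightD crossDl !crossDr (crossC _ y x).
have -> : \sum_(i <- cs) (x i + y i) * (P i * W i) =
   \sum_(i <- cs) x i * (P i * W i) + \sum_(i <- cs) y i * (P i * W i).
  by rewrite -big_split; apply: eq_bigr => i _ /=; rewrite mulnDl.
by ring.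
Qed.

Lemma period_costDt cs t u y :
  period_cost cs (t + u) y = period_cost cs t y + 2 * (u * load_weight cs y).
Proof. by rewrite /period_cost; ring. Qed.

Lemma eq_work cs x y : {in cs, x =1 y} -> work cs x = work cs y.
Proof.
by move=> e; rewrite /work !big_seq; apply: eq_bigr => i ics; rewrite e.
Qed.

Lemma eq_period_cost cs t x y :
  {in cs, x =1 y} -> period_cost cs t x = period_cost cs t y.
Proof.
move=> e; rewrite /period_cost /load_weight /cross !big_seq; congr (_ * _ + (_ + _)).
- by apply: eq_bigr => i ics; rewrite e.
- apply: eq_bigr => i ics; rewrite !big_seq.
  by apply: eq_bigr => j jcs; rewrite !e.
- by apply: eq_bigr => i ics; rewrite e.
Qed.

Lemma perm_work cs cs' x : perm_eq cs cs' -> work cs x = work cs' x.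
Proof. by move=> pcs; apply: perm_big. Qed.

Lemma perm_period_cost cs cs' t x :
  perm_eq cs cs' -> period_cost cs t x = period_cost cs' t x.
Proof.
move=> pcs; rewrite /period_cost /load_weight /cross !(perm_big _ pcs) /=.
congr (_ + (_ + _)); apply: eq_bigr => i _; exact: perm_big.
Qed.

(** * Costs over all periods, and the effect of rounding and of carrying jobs over *)

Section Periods.
Variables (cs : seq nat) (q : nat) (U : nat -> nat).
Implicit Type g : nat -> nat -> nat.

(* When the machine is free of the jobs assigned to the periods before [l]. *)
Fixpoint avail g l :=
  if l is l'.+1 then maxn (U l') (avail g l') + work cs (g l') else 0.

Definition begin g l := maxn (U l) (avail g l).

Definition total_cost g := \sum_(0 <= l < q) period_cost cs (begin g l) (g l).

(** Every term has degree at most two in [t] and [x]; the factor missing in the linear term is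
    supplied by [N <= N.+1]. *)
Lemma period_cost_scale N t t' x x' :
  N * t' <= N.+1 * t -> (forall i, i \in cs -> N * x' i <= N.+1 * x i) ->
  N ^ 2 * period_cost cs t' x' <= N.+1 ^ 2 * period_cost cs t x.
Proof.
move=> ht hx; rewrite /period_cost !mulnDr; apply: leq_add; last apply: leq_add.
- have hW : N * load_weight cs x' <= N.+1 * load_weight cs x.
    rewrite /load_weight !big_distrr /= !big_seq; apply: leq_sum => i ics.
    by rewrite !mulnA leq_mul2r hx ?orbT.
  have -> : N ^ 2 * (2 * t' * load_weight cs x') =
            2 * ((N * t') * (N * load_weight cs x')) by ring.
  have -> : N.+1 ^ 2 * (2 * t * load_weight cs x) =
            2 * ((N.+1 * t) * (N.+1 * load_weight cs x)) by ring.
  by rewrite leq_mul2l leq_mul.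
- rewrite /cross !big_distrr /= !big_seq; apply: leq_sum => i ics.
  rewrite !big_distrr /= !big_seq; apply: leq_sum => j jcs.
  have -> : N ^ 2 * (x' i * x' j * pair_cost i j) =
    (N * x' i) * (N * x' j) * pair_cost i j by ring.
  have -> : N.+1 ^ 2 * (x i * x j * pair_cost i j) =
    (N.+1 * x i) * (N.+1 * x j) * pair_cost i j by ring.
  by apply: leq_mul => //; apply: leq_mul; apply: hx.
- rewrite !big_distrr /= !big_seq; apply: leq_sum => i ics.
  have -> : N ^ 2 * (x' i * (P i * W i)) = N * (N * x' i) * (P i * W i) by ring.
  have -> : N.+1 ^ 2 * (x i * (P i * W i)) =
    N.+1 * (N.+1 * x i) * (P i * W i) by ring.
  by apply: leq_mul => //; apply: leq_mul => //; apply: hx.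
Qed.

(** The supply times do not change, but [N * U l <= N.+1 * U l]; maxima and sums preserve such
    inequalities, so the times [begin] scale by the same factor as the numbers of jobs. *)
Lemma total_cost_scale N g g' :
  (forall l i, l < q -> i \in cs -> N * g' l i <= N.+1 * g l i) ->
  N ^ 2 * total_cost g' <= N.+1 ^ 2 * total_cost g.
Proof.
move=> hg.
have hb l : l < q -> N * begin g' l <= N.+1 * begin g l.
  rewrite /begin => lq.
  have {lq} : N * avail g' l <= N.+1 * avail g l; last first.
    by rewrite !maxnMr geq_max !leq_max leq_mul2r leqnSn orbT => ->; rewrite orbT.
  elim: l lq => [|l IH] lq /=; first by rewrite muln0.
  have {}IH := IH (ltnW lq).
  have : N * work cs (g' l) <= N.+1 * work cs (g l).
    rewrite /work !big_distrr /= !big_seq; apply: leq_sum => i ics.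
    by rewrite !mulnA leq_mul2r hg ?orbT // ltnW.
  rewrite !mulnDr; apply: leq_add.
  by rewrite !maxnMr geq_max !leq_max leq_mul2r leqnSn orbT IH orbT.
rewrite /total_cost !big_distrr /= !big_nat; apply: leq_sum => l lq.
by apply: period_cost_scale => [|i ics]; [exact: hb|exact: hg].
Qed.

(* The machine is free from time [t] on, and the jobs [z] are carried over to
   period [l]. *)
Fixpoint cost_to_go n l t z g :=
  if n is n'.+1 then
    let t' := maxn (U l) t in let y i := z i + g l i in
    period_cost cs t' y + cost_to_go n' l.+1 (t' + work cs y) (fun=> 0) g
  else 0.

Lemma cost_to_goE n l g :
  cost_to_go n l (avail g l) (fun=> 0) g =
  \sum_(l <= m < l + n) period_cost cs (begin g m) (g m).
Proof.
elim: n l => [|n IH] l /=; first by rewrite addn0 big_geq.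
by rewrite big_ltn ?addnS ?ltnS ?leq_addr // IH addSn.
Qed.

Lemma eq_cost_to_go n l t z z' g :
  {in cs, z =1 z'} -> cost_to_go n l t z g = cost_to_go n l t z' g.
Proof.
case: n => //= n e; rewrite (@eq_period_cost _ _ _ (fun i => z' i + g l i)).
  by rewrite (@eq_work _ _ (fun i => z' i + g l i)) // => i ics; rewrite e.
by move=> i ics; rewrite e.
Qed.

(** If [b] is not empty, the machine is busy until [U l], so on both sides [k], [b] and [g l] run
    without idle time. Cutting [b] off costs nothing because [k] precedes [b] in Smith's order
    ([cross_ge]), and merging [b] with [g l] can only help ([cross_le]). *)
Lemma cost_to_go_carry n l t k b g :
  (forall i j, i \in cs -> j \in cs -> 0 < k i -> 0 < b j ->
     P i * W j <= P j * W i) ->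
  (forall i, i \in cs -> 0 < b i -> U l <= t + work cs k) ->
  period_cost cs t k + cost_to_go n.+1 l (t + work cs k) b g <=
  period_cost cs t (fun i => k i + b i) +
  cost_to_go n.+1 l (t + work cs (fun i => k i + b i)) (fun=> 0) g.
Proof.
move=> smith late.
have [/hasP[j jcs bj]|/hasPn b0] := boolP (has (fun j => 0 < b j) cs); last first.
  have {}b0 : {in cs, b =1 fun=> 0}.
    by move=> i /b0; rewrite lt0n negbK => /eqP.
  rewrite (eq_cost_to_go _ _ _ _ b0).
  have e : {in cs, (fun i => k i + b i) =1 k}.
    by move=> i ics /=; rewrite b0 // addn0.
  by rewrite (eq_period_cost _ e) (eq_work e).
have hU := late _ jcs bj.
rewrite /= (workD cs k b) (addnA t); set s := t + work cs k.
have -> : maxn (U l) s = s by apply/maxn_idPr.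
have -> : maxn (U l) (s + work cs b) = s + work cs b.
  by apply/maxn_idPr; rewrite (leq_trans hU) ?leq_addr.
rewrite (workD cs b) (addnA s) (addnA (period_cost cs t k)).
rewrite (addnA (period_cost cs t _)) leq_add2r.
rewrite -[period_cost cs _ (fun i => 0 + g l i)]/(period_cost cs _ (g l)).
rewrite !period_costD (period_costDt _ s).
have := period_costDt cs t (work cs k) b; rewrite -/s.
have := cross_ge smith; have := cross_le cs b (g l); lia.
Qed.

(* [k l i] jobs of class [i] start in period [l], the other available ones being
   carried over; a carried job could not have started before the next period. *)
Lemma carry_cost k g n l z :
  l + n = q ->
  (forall i, i \in cs ->
     z i + \sum_(0 <= m < l) k m i = \sum_(0 <= m < l) g m i) ->
  (forall m i, m < q -> i \in cs ->
     \sum_(0 <= a < m.+1) k a i <= \sum_(0 <= a < m.+1) g a i) ->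
  (forall m i j, m < q -> i \in cs -> j \in cs -> 0 < k m i ->
     \sum_(0 <= a < m.+1) k a j < \sum_(0 <= a < m.+1) g a j ->
     P i * W j <= P j * W i) ->
  (forall m i, m.+1 < q -> i \in cs ->
     \sum_(0 <= a < m.+1) k a i < \sum_(0 <= a < m.+1) g a i ->
     U m.+1 <= avail k m.+1) ->
  (forall i, i \in cs ->
     \sum_(0 <= a < q) k a i = \sum_(0 <= a < q) g a i) ->
  \sum_(l <= m < q) period_cost cs (begin k m) (k m) <=
  cost_to_go n l (avail k l) z g.
Proof.
move=> + + hle smith late fin; elim: n l z => [|n IH] l z hq hz.
  by rewrite -hq addn0 big_geq.
have lq : l < q by rewrite -hq addnS ltnS leq_addr.
rewrite big_ltn // -/(begin k l).
(* The jobs left over by period [l]; the prefix inequality [hle] makes the truncated subtraction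
   exact. *)
pose b i := z i + g l i - k l i.
have hb i : i \in cs -> k l i + b i = z i + g l i.
  move=> ics; have := hle l i lq ics; have := hz i ics.
  by rewrite /b !big_nat_recr //=; lia.
have hbs i : i \in cs ->
  b i + \sum_(0 <= m < l.+1) k m i = \sum_(0 <= m < l.+1) g m i.
  move=> ics; have := hz i ics; have := hb i ics.
  by rewrite !big_nat_recr //=; lia.
have hpos i : i \in cs -> 0 < b i ->
    \sum_(0 <= a < l.+1) k a i < \sum_(0 <= a < l.+1) g a i.
  by move=> ics; have := hbs i ics; lia.
rewrite /= -/(begin k l).
rewrite -(eq_period_cost _ hb) -(eq_work hb).
(* The last period leaves nothing over; in the other case there is a next period to carry into. *)
case: n IH hq => [|n] IH hq.
  have lq1 : l.+1 = q by rewrite -hq addn1.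
  have b0 : {in cs, (fun i => k l i + b i) =1 k l}.
    by move=> i ics; have := hbs i ics; rewrite lq1 fin //=; lia.
  by rewrite (eq_period_cost _ b0) big_geq ?lq1 ?addn0.
apply: leq_trans (cost_to_go_carry _ _ _ _); last 2 first.
- by move=> i j ics jcs ki bj; apply: (smith l) => //; apply: hpos.
- move=> i ics bi; apply: (late l i) => //; last exact: hpos.
  by rewrite -hq; lia.
rewrite leq_add2l; apply: IH => //.
by rewrite -hq; lia.
Qed.

End Periods.

(** Twice the total weighted completion time: [k] consecutive jobs from time [t] on have completion
    times of sum [k * t + P * k * (k + 1) / 2], and doubling avoids the division. *)
Definition blocks_cost (cs : seq nat) (q : nat) (k t : nat -> nat -> nat) :=
  \sum_(0 <= l < q) \sum_(i <- cs)
    W i * (2 * k l i * t l i + P i * k l i * (k l i).+1).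

(* In period [l], the [k l i] jobs of class [i] run consecutively from time
   [t l i] on; [cap l] is the number of jobs that the first [l.+1] supplies can
   serve. *)
Record good_blocks (cs : seq nat) (q : nat) (U mult cap : nat -> nat)
    (k t : nat -> nat -> nat) : Prop := GoodBlocks {
  blocks_mult : forall i, i \in cs -> \sum_(0 <= l < q) k l i = mult i;
  blocks_start : forall l i, l < q -> i \in cs -> U l <= t l i;
  blocks_end : forall l i m, l.+1 < q -> i \in cs -> m < k l i ->
    t l i + m * P i < U l.+1;
  blocks_sep : forall l i l' i', l < q -> l' < q -> i \in cs -> i' \in cs ->
    (l, i) != (l', i') ->
    t l i + k l i * P i <= t l' i' \/ t l' i' + k l' i' * P i' <= t l i;
  blocks_cap : forall l, l < q ->
    \sum_(0 <= a < l.+1) \sum_(i <- cs) k a i <= cap l }.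

Lemma eq_good_blocks cs cs' q U mult cap k k' t t' : perm_eq cs cs' ->
  (forall l, l < q -> {in cs, k l =1 k' l}) -> (forall l, l < q -> {in cs, t l =1 t' l}) ->
  good_blocks cs q U mult cap k t -> good_blocks cs' q U mult cap k' t'.
Proof.
move=> pcs hk ht; have mcs i : i \in cs' -> i \in cs by rewrite (perm_mem pcs).
case=> hmult hstart hend hsep hcap; split.
- move=> i /mcs ics; rewrite -hmult // !big_nat; apply: eq_bigr => l /= lq.
  by rewrite hk.
- by move=> l i lq /mcs ics; rewrite -ht // hstart.
- by move=> l i a lq /mcs ics; rewrite -hk ?(ltnW lq) // -ht ?(ltnW lq) //; exact: hend.
- move=> l i l' i' lq lq' /mcs ics /mcs ics' ne.
  by rewrite -!ht // -!hk //; exact: hsep.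
- move=> l lq; apply: leq_trans (hcap l lq); apply: eq_leq; rewrite !big_nat.
  apply: eq_bigr => a /= al; rewrite -(perm_big _ pcs) /= !big_seq.
  by apply: eq_bigr => i ics; rewrite hk // (leq_ltn_trans _ lq).
Qed.

Lemma eq_blocks_cost cs cs' q k k' t t' : perm_eq cs cs' ->
  (forall l, l < q -> {in cs, k l =1 k' l}) -> (forall l, l < q -> {in cs, t l =1 t' l}) ->
  blocks_cost cs q k t = blocks_cost cs' q k' t'.
Proof.
move=> pcs hk ht; rewrite /blocks_cost !big_nat; apply: eq_bigr => l /= lq.
rewrite -(perm_big _ pcs) /= !big_seq; apply: eq_bigr => i ics.
by rewrite hk // ht.
Qed.

(** * List scheduling inside the supply periods *)

Section Dispatch.
Variables (q : nat) (U mult : nat -> nat) (A k t : nat -> nat -> nat).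

Definition pending l i := A l i - \sum_(0 <= a < l) k a i.

(* How many of [y] jobs of length [p], run from time [s] on, start before [u]. *)
Definition fitting (u s p y : nat) := minn y ((u - s + (p - 1)) %/ p).

(** A property of given tables and not a function computing them, because it is established for the
    contents of the registers that the program fills. *)
Fixpoint alloc l (pi : seq nat) s : Prop :=
  if pi is i :: pi' then
    [/\ t l i = s,
        k l i = (if l.+1 < q then fitting (U l.+1) s (P i) (pending l i)
                 else pending l i)
      & alloc l pi' (s + k l i * P i)]
  else True.

(* [A l i] jobs of class [i] are released by period [l]; list scheduling in the
   order [pi], where a period takes jobs only as long as it lasts. *)
Definition dispatch pi := forall l, l < q -> alloc l pi (begin pi U k l).

Hypothesis P_gt0 : forall i, 0 < P i.

Lemma fitting_le u s p y : fitting u s p y <= y.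
Proof. exact: geq_minl. Qed.

Lemma fitting_lt u s p y m : 0 < p -> m < fitting u s p y -> s + m * p < u.
Proof.
move=> p0; rewrite leq_min => /andP[_]; rewrite leq_divRL // => hm.
by move: hm; rewrite mulSn; lia.
Qed.

(** If jobs remain, the rounded-up quotient was the smaller value, so those that fit last at least
    until [u]. *)
Lemma fitting_late u s p y : 0 < p -> fitting u s p y < y -> u <= s + fitting u s p y * p.
Proof.
move=> p0; rewrite gtn_min ltnn /= => hlt.
have -> : fitting u s p y = (u - s + (p - 1)) %/ p by apply/minn_idPr/ltnW.
have := divn_eq (u - s + (p - 1)) p; have := ltn_pmod (u - s + (p - 1)) p0.
by lia.
Qed.

Lemma fitting_late0 u s p y : 0 < p -> u <= s -> fitting u s p y = 0.
Proof.
move=> p0; rewrite /fitting -subn_eq0 => /eqP->; rewrite add0n divn_small ?minn0 //.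
by rewrite subn1 prednK.
Qed.

Lemma alloc_le l pi s i : alloc l pi s -> i \in pi -> k l i <= pending l i.
Proof.
elim: pi s => //= j pi IH s [_ kj al]; rewrite in_cons => /predU1P[->|]; last exact: IH al.
by rewrite kj; case: ifP => // _; exact: fitting_le.
Qed.

Lemma alloc_last l pi s i :
  l.+1 = q -> alloc l pi s -> i \in pi -> k l i = pending l i.
Proof.
move=> lq; elim: pi s => //= j pi IH s [_ kj al].
by rewrite in_cons => /predU1P[->|]; [rewrite kj lq ltnn|exact: IH al].
Qed.

Lemma alloc_lt l pi s i m :
  l.+1 < q -> alloc l pi s -> i \in pi -> m < k l i -> t l i + m * P i < U l.+1.
Proof.
move=> lq; elim: pi s => //= j pi IH s [tj kj al].
rewrite in_cons => /predU1P[->|]; last exact: IH al.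
by rewrite kj lq tj; exact: fitting_lt.
Qed.

Lemma alloc_ge l pi s i : alloc l pi s -> i \in pi -> s <= t l i.
Proof.
elim: pi s => //= j pi IH s [tj kj al]; rewrite in_cons => /predU1P[->|]; first by rewrite tj.
by move=> /(IH _ al); apply: leq_trans; rewrite leq_addr.
Qed.

Lemma alloc_end l pi s i :
  alloc l pi s -> i \in pi -> t l i + k l i * P i <= s + work pi (k l).
Proof.
elim: pi s => //= j pi IH s [tj kj al].
rewrite /work big_cons -/(work pi (k l)) in_cons => /predU1P[->|].
  by rewrite tj addnA leq_addr.
by move=> /(IH _ al); rewrite addnA.
Qed.

Lemma alloc_sep l pi s i j : uniq pi -> alloc l pi s -> i \in pi -> j \in pi ->
  i != j -> t l i + k l i * P i <= t l j \/ t l j + k l j * P j <= t l i.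
Proof.
elim: pi s => //= a pi IH s /andP[api upi] [ta ka al].
rewrite !in_cons => /predU1P[->|ipi] /predU1P[->|jpi].
- by rewrite eqxx.
- by move=> _; left; rewrite ta; apply: alloc_ge al _.
- by move=> _; right; rewrite ta; apply: alloc_ge al _.
- exact: (IH _ upi al).
Qed.

Lemma alloc_late l pi s i :
  l.+1 < q -> alloc l pi s -> U l.+1 <= s -> i \in pi -> k l i = 0.
Proof.
move=> lq; elim: pi s => //= j pi IH s [tj kj al] us.
rewrite in_cons => /predU1P[->|]; first by rewrite kj lq fitting_late0.
by apply: (IH _ al); rewrite (leq_trans us) ?leq_addr.
Qed.

Lemma alloc_cut l pi s j :
  l.+1 < q -> alloc l pi s -> j \in pi -> k l j < pending l j ->
  U l.+1 <= s + work pi (k l).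
Proof.
move=> lq; elim: pi s => //= a pi IH s [ta ka al].
rewrite /work big_cons -/(work pi (k l)) addnA in_cons => /predU1P[->|jpi]; last exact: IH.
rewrite ka lq => /fitting_late => /(_ (P_gt0 a)) h.
by rewrite (leq_trans h) ?leq_addr.
Qed.

Definition smith i j := P i * W j <= P j * W i.

(** Once a class is cut, the machine is busy beyond the end of the period and no later class of [pi]
    starts a job. A class that starts jobs is therefore not behind one that is cut. *)
Lemma alloc_smith l pi s i j :
  l.+1 < q -> pairwise smith pi -> alloc l pi s -> i \in pi -> j \in pi ->
  0 < k l i -> k l j < pending l j -> smith i j.
Proof.
move=> lq; elim: pi s => //= a pi IH s /andP[/allP ha hpi] [ta ka al].
rewrite !in_cons => /predU1P[->|ipi] /predU1P[->|jpi].
- by rewrite /smith.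
- by move=> _ _; apply: ha.
- move=> ki; rewrite ka lq => /fitting_late => /(_ (P_gt0 a)) h.
  by move: ki; rewrite (alloc_late lq al) // ka lq.
- exact: (IH _ hpi al).
Qed.

(** The first class delays each later one by [P i * W a] per pair of jobs, and this is their
    [pair_cost] because [pi] follows Smith's order; the rest is the same situation started later. *)
Lemma alloc_cost l pi s : pairwise smith pi -> alloc l pi s ->
  \sum_(i <- pi) W i * (2 * k l i * t l i + P i * k l i * (k l i).+1)
    <= period_cost pi s (k l).
Proof.
elim: pi s => [|i pi IH] s /=; first by rewrite big_nil.
move=> /andP[/allP hi hpi] [ti ki al]; rewrite big_cons.
have {IH} := IH _ hpi al; rewrite period_costDt.
set X := \sum_(j <- pi) _ => hX.
rewrite /period_cost /load_weight /cross !big_cons ti.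
have -> : \sum_(a <- pi) \sum_(j <- i :: pi) k l a * k l j * pair_cost a j =
  \sum_(a <- pi) k l i * k l a * pair_cost i a +
  \sum_(a <- pi) \sum_(j <- pi) k l a * k l j * pair_cost a j.
  rewrite -big_split; apply: eq_bigr => a _; rewrite big_cons.
  by rewrite pair_costC (mulnC (k l a)).
have hw : k l i * P i * load_weight pi (k l) <= \sum_(a <- pi) k l i * k l a * pair_cost i a.
  rewrite /load_weight big_distrr /= !big_seq; apply: leq_sum => a api.
  rewrite /pair_cost (minn_idPl (hi _ api)).
  by apply: eq_leq; ring.
have hii : pair_cost i i = P i * W i by rewrite /pair_cost minnn.
move: hX hw; rewrite hii /period_cost /load_weight /cross.
set Y := \sum_(a <- pi) k l i * _ * _; set Z := \sum_(a <- pi) \sum_(j <- pi) _.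
set V := \sum_(a <- pi) _ * (_ * _); set L := \sum_(a <- pi) _ * W a => hX hw.
have -> : W i * (2 * k l i * s + P i * k l i * (k l i).+1) =
  2 * s * (k l i * W i) + k l i * k l i * (P i * W i) + k l i * (P i * W i) by ring.
rewrite mulnDr; lia.
Qed.

Section Laws.
Variable pi : seq nat.
Hypotheses (upi : uniq pi) (disp : dispatch pi) (q_gt0 : 0 < q).
Hypothesis A_homo : forall l i, l.+1 < q -> i \in pi -> A l i <= A l.+1 i.
Hypothesis A_last : forall i, i \in pi -> A q.-1 i = mult i.

(** Since releases only grow, the jobs started before [l] never exceed [A l i], so the truncated
    subtraction in [pending] is exact. *)
Lemma dispatch_le l i :
  l < q -> i \in pi -> \sum_(0 <= a < l.+1) k a i <= A l i.
Proof.
move=> lq ipi; rewrite big_nat_recr //=.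
have := alloc_le (disp lq) ipi; rewrite /pending.
suff : \sum_(0 <= a < l) k a i <= A l i by lia.
case: l lq => [|l] lq; first by rewrite big_geq.
elim: l lq => [|l IH] lq; rewrite big_nat_recr //=.
  have := alloc_le (disp (ltnW lq)) ipi; have := A_homo lq ipi.
  by rewrite /pending big_geq //=; lia.
have := alloc_le (disp (ltnW lq)) ipi; have := A_homo lq ipi.
by have := IH (ltnW lq); rewrite /pending; lia.
Qed.

Lemma dispatch_total i : i \in pi -> \sum_(0 <= l < q) k l i = mult i.
Proof.
move=> ipi; have q1 : q.-1 < q by rewrite prednK.
have := dispatch_le q1 ipi; rewrite -[in RHS](A_last ipi).
have -> : \sum_(0 <= l < q) k l i = \sum_(0 <= l < q.-1.+1) k l i.
  by rewrite prednK.
rewrite big_nat_recr //= (alloc_last _ (disp q1) ipi) ?prednK // /pending; lia.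
Qed.

Lemma avail_le l l' : l < l' -> avail pi U k l.+1 <= avail pi U k l'.
Proof.
elim: l' => // l' IH; rewrite ltnS leq_eqVlt => /predU1P[->//|/IH h].
apply: (leq_trans h) => /=.
by rewrite (leq_trans (leq_maxr (U l') _)) ?leq_addr.
Qed.

Lemma dispatch_good cap :
  (forall l, l < q -> \sum_(0 <= a < l.+1) \sum_(i <- pi) k a i <= cap l) ->
  good_blocks pi q U mult cap k t.
Proof.
move=> hcap; split => //.
- exact: dispatch_total.
- move=> l i lq ipi; apply: leq_trans (alloc_ge (disp lq) ipi).
  exact: leq_maxl.
- by move=> l i m lq ipi; exact: (alloc_lt lq (disp (ltnW lq)) ipi).
- have sep l i l' i' : l < l' -> l' < q -> i \in pi -> i' \in pi ->
      t l i + k l i * P i <= t l' i'.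
    move=> ll' lq ipi ipi'; have lq0 := ltn_trans ll' lq.
    apply: leq_trans (alloc_end (disp lq0) ipi) _.
    apply: leq_trans (alloc_ge (disp lq) ipi').
    by rewrite (leq_trans (avail_le ll')) ?leq_maxr.
  move=> l i l' i' lq lq' ipi ipi'; case: (ltngtP l l') => [ll' _|ll' _|<- ii'].
  + by left; apply: sep.
  + by right; apply: sep.
  + apply: alloc_sep (disp lq) _ _ _ => //.
    by apply: contraNneq ii' => ->.
Qed.

(** [alloc_cost] bounds each period and [carry_cost] compares the periods with [g]: a class left
    over by a period has been cut there, which gives both the Smith condition and the lateness
    condition. *)
Lemma dispatch_cost g :
  pairwise smith pi ->
  (forall l i, l < q -> i \in pi -> \sum_(0 <= a < l.+1) g a i = A l i) ->
  blocks_cost pi q k t <= total_cost pi q U g.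
Proof.
move=> hs hg.
have pend l i : l < q -> i \in pi ->
    \sum_(0 <= a < l.+1) k a i < \sum_(0 <= a < l.+1) g a i -> k l i < pending l i.
  by move=> lq ipi; rewrite hg // big_nat_recr //= /pending; lia.
rewrite /total_cost -[q in \sum_(0 <= l < q) period_cost _ _ _]add0n -cost_to_goE.
apply: leq_trans (carry_cost (k := k) _ _ _ _ _ _) => //.
- rewrite /blocks_cost !big_nat; apply: leq_sum => l lq.
  exact: alloc_cost (disp lq).
- by move=> i _; rewrite !big_geq.
- by move=> m i mq ipi; rewrite hg ?dispatch_le.
- move=> m i j mq ipi jpi ki /(pend _ _ mq jpi) kj.
  (* The last period takes everything pending, so it cuts no class. *)
  have mq1 : m.+1 < q.
    rewrite ltn_neqAle mq andbT; apply/eqP => e.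
    by move: kj; rewrite (alloc_last e (disp mq) jpi) ltnn.
  exact: (alloc_smith mq1 hs (disp mq) ipi jpi).
- move=> m i mq ipi /(pend _ _ (ltnW mq) ipi).
  exact: (alloc_cut mq (disp (ltnW mq)) ipi).
- move=> i ipi; rewrite dispatch_total // -A_last //.
  by rewrite -hg ?prednK // big_nat_recr // -big_nat_recr //= prednK.
Qed.

End Laws.
End Dispatch.
End Costs.

(** * Lower bound on the cost of a feasible schedule *)

Section LowerBound.
Local Open Scope ring_scope.
Variables (R : realFieldType) (J : finType) (sigma p : J -> R).
Hypothesis p_gt0 : forall j, 0 < p j.
Hypothesis apart :
  forall j k, j != k -> sigma j + p j <= sigma k \/ sigma k + p k <= sigma j.

Lemma apart_lt j k : sigma j < sigma k -> sigma j + p j <= sigma k.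
Proof.
move=> jk; have /apart[//|] : j != k by apply: contraTneq jk => ->; rewrite ltxx.
by have := p_gt0 k; lra.
Qed.

Lemma sigma_inj : injective sigma.
Proof.
move=> j k e; apply/eqP/negPn/negP => /apart; rewrite e.
by have := p_gt0 j; have := p_gt0 k; lra.
Qed.

(** Induction by removing the job of [X] that starts last: the others end before its start, which
    becomes the new [b]. *)
Lemma total_length_le (X : {set J}) (a b : R) : a <= b ->
  (forall j, j \in X -> a <= sigma j /\ sigma j + p j <= b) ->
  a + \sum_(j in X) p j <= b.
Proof.
have [n] := ubnP #|X|; elim: n X b => // n IH X b cX ab hX.
have [->|[j0 j0X]] := set_0Vmem X; first by rewrite big_set0 addr0.
have [j /= jX jmax] := @arg_maxP _ _ _ j0 [pred j in X] sigma j0X.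
have [aj jb] := hX j jX.
rewrite (big_setD1 j jX) /= addrCA addrC; apply: le_trans _ jb.
rewrite lerD2r; apply: IH => //.
  by move: cX; rewrite (cardsD1 j) (jX : j \in X).
move=> k; rewrite !inE => /andP[kj kX]; have [ak kb] := hX k kX; split => //.
apply: apart_lt; rewrite lt_neqAle (inj_eq sigma_inj) kj /=; exact: jmax.
Qed.

Section Counts.
Variables (P W : nat -> nat) (cs : seq nat) (q : nat) (U : nat -> nat).
Variables (c lam : J -> nat).
Hypothesis p_cls : forall j, p j = (P (c j))%:R.
Hypothesis ucs : uniq cs.
Hypothesis c_cs : forall j, c j \in cs.
Hypothesis lam_lt : forall j, (lam j < q)%N.
Hypothesis U_homo : forall l, (l.+1 < q)%N -> (U l <= U l.+1)%N.
Hypothesis U_le : forall j, (U (lam j))%:R <= sigma j.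
Hypothesis lam_homo : forall j k, (lam j < lam k)%N -> sigma j < sigma k.

Definition counts l i := #|[pred j | (lam j == l) && (c j == i)]|.

Lemma sum_counts l (f : nat -> nat) :
  (\sum_(i <- cs) counts l i * f i = \sum_(j | lam j == l) f (c j))%N.
Proof.
rewrite (eq_bigr (fun i => \sum_(j | (lam j == l) && (c j == i)) f i)%N); last first.
  by move=> i _; rewrite sum_nat_const.
rewrite (exchange_big_dep (fun j => lam j == l)) /=; last by move=> i j _ /andP[].
apply: eq_bigr => j /eqP lj; under eq_bigl do rewrite lj eqxx /= eq_sym.
by rewrite -big_filter filter_pred1_uniq // big_seq1.
Qed.

(** The bound [b] is arbitrary because the induction uses it twice: for [b] itself and for the start
    of each job of period [l]. *)
Lemma begin_counts_le l b : (l < q)%N -> (U l)%:R <= b ->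
  (forall j, (lam j < l)%N -> sigma j + p j <= b) ->
  (begin P cs U counts l)%:R <= b.
Proof.
elim: l b => [|l IH] b lq ub jb; first by rewrite /begin /= maxn0.
have Ub : (U l)%:R <= b by apply: le_trans _ ub; rewrite ler_nat U_homo.
rewrite /begin /= -/(begin P cs U counts l) /maxn; case: ifP => // _.
rewrite natrD.
have -> : (work P cs (counts l))%:R = \sum_(j in [set j | lam j == l]) p j :> R.
  rewrite /work sum_counts natr_sum; apply: eq_big => [j|j _]; first by rewrite inE.
  by rewrite p_cls.
apply: total_length_le.
  by apply: IH => //; [exact: ltnW|move=> j jl; apply/jb/ltnW].
move=> j; rewrite inE => /eqP lj; split; last by apply: jb; rewrite lj.
apply: IH; [exact: ltnW|by rewrite -lj U_le|].
by move=> k kl; apply/apart_lt/lam_homo; rewrite lj.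
Qed.

Lemma sigma_ge j : (begin P cs U counts (lam j))%:R +
  \sum_(k in [set k | (lam k == lam j) && (sigma k < sigma j)]) p k <= sigma j.
Proof.
have hb k : lam k = lam j -> (begin P cs U counts (lam j))%:R <= sigma k.
  move=> kj; apply: begin_counts_le => //; first by rewrite -kj U_le.
  by move=> a; rewrite -kj => /lam_homo /apart_lt.
apply: total_length_le; first exact: hb.
move=> k; rewrite inE => /andP[/eqP kj skj]; split; first exact: hb.
exact: apart_lt.
Qed.

(** By [sigma_ge] a job waits for all jobs of its period that start earlier. In each pair of jobs of
    one period one waits for the other, at a weighted delay of at least their [pair_cost]; delays
    between periods are contained in [begin]. *)
Lemma total_cost_le : (total_cost P W cs q U counts)%:R <=
  2 * \sum_j (W (c j))%:R * (sigma j + p j).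
Proof.
pose w j : R := (W (c j))%:R.
pose same (j k : J) := lam k == lam j.
have w0 j : 0 <= w j by exact: ler0n.
pose B j : R := (begin P cs U counts (lam j))%:R.
have h1 : 2 * \sum_j w j * (B j + p j) +
    2 * \sum_j \sum_(k | same j k && (sigma k < sigma j)) w j * p k
    <= 2 * \sum_j w j * (sigma j + p j).
  rewrite -mulrDr -big_split /=; apply: ler_wpM2l => //.
  apply: ler_sum => j _; rewrite -mulr_sumr -mulrDr; apply: ler_wpM2l => //.
  rewrite addrAC lerD2r; apply: le_trans (sigma_ge j); rewrite lerD2l.
  by rewrite le_eqVlt; apply/orP; left; apply/eqP/eq_bigl => k; rewrite inE.
apply: le_trans h1.
pose M j k : R := (pair_cost P W (c j) (c k))%:R.
(* The left side counts ordered pairs, including each job with itself; these diagonal terms are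
   subtracted. *)
have h2 : \sum_j \sum_(k | same j k) M j k - \sum_j w j * p j <=
    2 * \sum_j \sum_(k | same j k && (sigma k < sigma j)) w j * p k.
  (* One of the two copies is reindexed by swapping the jobs, so that each [j] meets the earlier and
     the later jobs of its period. *)
  have -> : 2 * \sum_j \sum_(k | same j k && (sigma k < sigma j)) w j * p k =
    \sum_j \sum_(k | same j k && (sigma k < sigma j)) w j * p k +
    \sum_j \sum_(k | same j k && (sigma j < sigma k)) w k * p j.
    rewrite mulrDl mul1r; congr (_ + _).
    rewrite (exchange_big_dep xpredT) //=; apply: eq_bigr => k _.
    by apply: eq_bigl => j; rewrite /same eq_sym.
  rewrite lerBlDr -!big_split /=; apply: ler_sum => j _.
  rewrite (bigD1 j) /=; last exact: eqxx.
  rewrite addrC; apply: lerD; last first.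
    by rewrite /M /pair_cost minnn natrM /w p_cls mulrC.
  rewrite (bigID (fun k => sigma k < sigma j)) /=; apply: lerD.
    rewrite [leLHS](eq_bigl (fun k => same j k && (sigma k < sigma j))); last first.
      move=> k; rewrite -andbA; congr (_ && _); apply: andb_idl => kj.
      by apply: contraTneq kj => ->; rewrite ltxx.
    apply: ler_sum => k _.
    by rewrite /M /w p_cls -natrM ler_nat /pair_cost (mulnC (W _)) geq_minr.
  rewrite [leLHS](eq_bigl (fun k => same j k && (sigma j < sigma k))); last first.
    move=> k; rewrite -andbA -leNgt; congr (_ && _).
    by rewrite lt_neqAle (inj_eq sigma_inj) eq_sym.
  apply: ler_sum => k _.
  by rewrite /M /w p_cls -natrM ler_nat /pair_cost (mulnC (W _)) geq_minl.
rewrite -lerBlDl in h2 *; apply: le_trans h2.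
rewrite lerBlDl.
(* Sums over periods and classes become sums over single jobs. *)
have -> : (total_cost P W cs q U counts)%:R =
   2 * \sum_j w j * B j + \sum_j \sum_(k | same j k) M j k + \sum_j w j * p j.
  rewrite /total_cost /period_cost natr_sum big_mkord.
  have part (F : J -> R) : \sum_j F j = \sum_(l < q) \sum_(j | lam j == l) F j.
    by rewrite (partition_big (fun j => Ordinal (lam_lt j)) xpredT) //=.
  rewrite mulr_sumr !part -!big_split /=; apply: eq_bigr => l _.
  rewrite !natrD -addrA; congr (_ + (_ + _)).
  - rewrite /load_weight sum_counts natrM natr_sum mulr_sumr.
    apply: eq_bigr => j /eqP lj; rewrite /B lj natrM /w; ring.
  - rewrite /cross.
    rewrite (eq_bigr (fun i =>
      counts l i * \sum_(k | lam k == l) pair_cost P W i (c k))%N); last first.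
      move=> i _; rewrite -sum_counts big_distrr.
      by apply: eq_bigr => j _; rewrite /= mulnA.
    rewrite sum_counts natr_sum; apply: eq_bigr => j /eqP lj.
    by rewrite natr_sum; apply: eq_bigl => k; rewrite /same lj.
  - rewrite sum_counts natr_sum; apply: eq_bigr => j _.
    by rewrite /w p_cls natrM mulrC.
rewrite [\sum_j w j * (B j + p j)](eq_bigr (fun j => w j * B j + w j * p j)); last first.
  by move=> j _; rewrite mulrDr.
rewrite big_split /=; lra.
Qed.

End Counts.
End LowerBound.

(** * Instances and schedules in integers *)

Lemma big_iota_ord (V : Type) (x : V) (op : V -> V -> V) n (F : nat -> V) :
  \big[op/x]_(i <- iota 0 n) F i = \big[op/x]_(i < n) F i.
Proof. by rewrite -(big_mkord xpredT) /index_iota subn0. Qed.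

Section Scaled.
Local Open Scope ring_scope.
Variables (q h : nat) (I : instance q h).

(* The data of [I] as integers: [P] and [U] in units of [1 / D], [W] in units
   of [1 / E], and the number [cap l] of jobs that the first [l.+1] supplies can
   serve. *)
Record scaled (D E : nat) (m P W U cap : nat -> nat) : Prop := Scaled {
  scale_gt0 : (0 < D)%N;
  wscale_gt0 : (0 < E)%N;
  scaled_mult : forall i : 'I_h, mult I i = m i;
  scaled_ptime : forall i : 'I_h, ptime I i = (P i)%:R / D%:R;
  scaled_weight : forall i : 'I_h, weight I i = (W i)%:R / E%:R;
  scaled_stime : forall l : 'I_q, stime I l = (U l)%:R / D%:R;
  scaled_cap : forall (l : 'I_q) (n : nat) (a : rat),
    (forall j : job I, req I (cls j) = a) ->
    (n%:R * a <= \sum_(l' < q | (l' <= l)%N) supply I l') = (n <= cap l)%N }.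

Variables (D E : nat) (m P W U cap : nat -> nat).
Hypothesis sc : scaled D E m P W U cap.
Hypothesis vI : valid I.
Hypothesis eqI : equal_requirements I.
Hypotheses (q_gt0 : (0 < q)%N) (h_gt0 : (0 < h)%N).
Variable R : realType.

Let cs := iota 0 h.

Let D0 : 0 < D%:R :> R. Proof. by rewrite ltr0n (scale_gt0 sc). Qed.
Let E0 : 0 < E%:R :> R. Proof. by rewrite ltr0n (wscale_gt0 sc). Qed.

Lemma mem_classes (i : 'I_h) : val i \in cs.
Proof. by rewrite mem_iota add0n ltn_ord. Qed.

Lemma ptimeR i : ratr (ptime I i) = (P i)%:R / D%:R :> R.
Proof. by rewrite (scaled_ptime sc) fmorph_div /= !ratr_nat. Qed.

Lemma weightR i : ratr (weight I i) = (W i)%:R / E%:R :> R.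
Proof. by rewrite (scaled_weight sc) fmorph_div /= !ratr_nat. Qed.

Lemma stimeR l : ratr (stime I l) = (U l)%:R / D%:R :> R.
Proof. by rewrite (scaled_stime sc) fmorph_div /= !ratr_nat. Qed.

Lemma scaled_P_gt0 (i : 'I_h) : (0 < P i)%N.
Proof.
have := ptime_gt0 vI i; rewrite (scaled_ptime sc).
by rewrite lt0n; case: (P i) => //; rewrite mul0r ltxx.
Qed.

Lemma scaled_U_lt (l l' : 'I_q) : (l < l')%N -> (U l < U l')%N.
Proof.
move=> /(stime_incr vI); rewrite !(scaled_stime sc).
by rewrite ltr_pM2r ?ltr_nat // invr_gt0 ltr0n (scale_gt0 sc).
Qed.

Lemma scaled_U_leS l : (l.+1 < q)%N -> (U l <= U l.+1)%N.
Proof.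
move=> lq; apply/ltnW.
exact: (@scaled_U_lt (Ordinal (ltnW lq)) (Ordinal lq)).
Qed.

Lemma in_periodE (l : 'I_q) (x : R) : in_period I l x <->
  (U l)%:R <= x * D%:R /\ ((l.+1 < q)%N -> x * D%:R < (U l.+1)%:R).
Proof.
rewrite /in_period stimeR ler_pdivrMr //; split=> [/andP[h1 /forallP h2]|[h1 h2]].
  split => // lq; have := h2 (Ordinal lq).
  by rewrite eqxx /= stimeR ltr_pdivlMr.
apply/andP; split => //; apply/forallP => l'; apply/implyP => /eqP l'l.
by rewrite stimeR ltr_pdivlMr // l'l h2 // -l'l.
Qed.

Lemma in_period_ex (x : R) : 0 <= x -> exists l, in_period I l x.
Proof.
move=> x0; pose p (l : 'I_q) := ratr (stime I l) <= x.
have p0 : p (Ordinal q_gt0) by rewrite /p (stime_first vI) // rmorph0.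
have [l pl lmax] := @arg_maxnP _ (Ordinal q_gt0) p val p0.
exists l; rewrite /in_period [_ <= x]pl /=; apply/forallP => l'.
apply/implyP => /eqP l'l; rewrite ltNge; apply/negP => /lmax /=.
by rewrite l'l ltnn.
Qed.

Lemma in_period_lt (l l' : 'I_q) (x y : R) :
  in_period I l x -> in_period I l' y -> (l < l')%N -> x < y.
Proof.
move=> /in_periodE[_ hx] /in_periodE[hy _] ll'.
have lq : (l.+1 < q)%N by apply: leq_ltn_trans (ltn_ord l').
rewrite -(ltr_pM2r D0); apply: lt_le_trans (hx lq) _; apply: le_trans hy.
rewrite ler_nat; have := ll'; rewrite leq_eqVlt => /predU1P[->//|h1].
by apply/ltnW; exact: (@scaled_U_lt (Ordinal lq)).
Qed.

Lemma in_period_uniq (l l' : 'I_q) (x : R) :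
  in_period I l x -> in_period I l' x -> l = l'.
Proof.
move=> hl hl'; apply/val_inj; case: (ltngtP l l') => // ll'.
- by have := in_period_lt hl hl' ll'; rewrite ltxx.
- by have := in_period_lt hl' hl ll'; rewrite ltxx.
Qed.

Lemma sum_jobs (V : nmodType) (F : forall i : 'I_h, 'I_(mult I i) -> V) :
  \sum_(j : job I) F (tag j) (tagged j) = \sum_i \sum_r F i r.
Proof.
by rewrite (@sig_big_dep _ _ _ _ _ xpredT (fun=> xpredT) F).
Qed.

(** The numbers [g] count the jobs of each class by the period in which they start in [S]. *)
Lemma feasible_counts (S : job I -> R) : feasible S ->
  exists g : nat -> nat -> nat,
  [/\ forall i, i \in cs -> (\sum_(0 <= l < q) g l i = m i)%N,
      forall l, (l < q)%N -> (\sum_(0 <= a < l.+1) \sum_(i <- cs) g a i <= cap l)%N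
    & (total_cost P W cs q U g)%:R <= 2 * D%:R * E%:R * cost S].
Proof.
move=> [S0 Sov Sres].
have [lam hlam] := fin_all_exists (fun j => in_period_ex (S0 j)).
pose c (j : job I) : nat := cls j.
have c_cs j : c j \in cs by exact: mem_classes.
have ucs : uniq cs by exact: iota_uniq.
pose lam' j : nat := lam j.
have lam_lt j : (lam' j < q)%N by exact: ltn_ord.
exists (counts c lam'); split.
- move=> i; rewrite mem_iota add0n => /andP[_ ih].
  rewrite -(scaled_mult sc (Ordinal ih)) big_mkord.
  have <- : (\sum_(j : job I | c j == i) 1 = mult I (Ordinal ih))%N.
    rewrite big_mkcond /=.
    rewrite (@sum_jobs nat (fun a r => if val a == i then 1 else 0)%N).
    rewrite (bigD1 (Ordinal ih)) //= eqxx sum1_card card_ord.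
    rewrite big1; first exact: addn0.
    move=> a ai; rewrite big1 // => r _.
    by case: eqP => // e; case/eqP: ai; apply/val_inj.
  rewrite (partition_big lam xpredT) //=; apply: eq_bigr => l _.
  by rewrite /counts -sum1_card; apply: eq_bigl => j; rewrite !inE andbC.
- move=> l lq; set n := (\sum_(_ <= a < _) _)%N.
  have [a ha] := eqI.
  rewrite -[cap l]/(cap (Ordinal lq)) -(scaled_cap sc (Ordinal lq) n ha).
  have hn : n = #|[pred j : job I | (lam' j <= l)%N]|.
    rewrite /n -sum1_card /=.
    rewrite (eq_bigr (fun a => \sum_(j | lam' j == a) 1)%N); last first.
      move=> b _; rewrite -(sum_counts lam' ucs c_cs b (fun=> 1%N)).
      by apply: eq_bigr => i _; rewrite muln1.
    rewrite big_mkord.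
    rewrite [RHS](partition_big (fun j => inord (lam' j) : 'I_l.+1) xpredT) //=.
    apply: eq_bigr => b _; apply: eq_bigl => j; rewrite inE.
    apply/idP/andP => [/eqP e|[jl /eqP <-]]; last by rewrite inordK.
    have jl : (lam' j <= l)%N by rewrite e -ltnS ltn_ord.
    by split => //; apply/eqP/val_inj; rewrite /= inordK.
  rewrite {}hn {n}.
  have [j0 j0l|none] := pickP [pred j : job I | (lam' j <= l)%N]; last first.
    rewrite eq_card0 // mul0r; apply: sumr_ge0 => b _.
    exact/ltW/(supply_gt0 vI).
  (* The resource condition is used at the latest start among these jobs: all of them have drawn on
     the resource by then, while only the first [l.+1] supplies can have arrived. *)
  have [j /= jl jmax] := @arg_maxP _ _ _ j0 _ S j0l.
  have := Sres (S j) (S0 j).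
  rewrite (eq_bigr (fun=> ratr a)); last by move=> b _; rewrite ha.
  rewrite sumr_const -(ler_rat R) rmorphM /= ratr_nat -[ratr a *+ _]mulr_natl => hle.
  apply: le_trans (le_trans hle _).
    apply: ler_wpM2r; first by rewrite -(ha j) ler0q (req_ge0 vI).
    rewrite ler_nat; apply: subset_leq_card; apply/fintype.subsetP => b.
    by rewrite !inE => /jmax.
  rewrite rmorph_sum /= big_mkcond [leRHS]big_mkcond; apply: ler_sum => b _.
  have sb : 0 <= ratr (supply I b) :> R by rewrite ler0q ltW // (supply_gt0 vI).
  case: ifP => [bj|_]; last by case: ifP.
  suff -> : (b <= l)%N by [].
  apply: leq_trans jl; rewrite leqNgt; apply/negP => jb.
  have [_ hj] := (in_periodE _ _).1 (hlam j).
  have jq : ((lam' j).+1 < q)%N by apply: leq_ltn_trans (ltn_ord b).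
  have := hj jq; rewrite ltNge => /negP; apply.
  rewrite -ler_pdivrMr //; apply: le_trans bj; rewrite stimeR.
  rewrite ler_pM2r ?invr_gt0 // ler_nat.
  have := jb; rewrite leq_eqVlt => /predU1P[<-//|h1].
  by apply/ltnW; exact: (@scaled_U_lt (Ordinal jq)).
- have p_gt0 (j : job I) : 0 < (P (c j))%:R :> R by rewrite ltr0n scaled_P_gt0.
  pose s j := S j * D%:R.
  have pD j : ratr (ptime I (cls j)) * D%:R = (P (c j))%:R :> R.
    by rewrite ptimeR divfK // gt_eqF.
  have sov j k : j != k -> s j + (P (c j))%:R <= s k \/ s k + (P (c k))%:R <= s j.
    move=> /Sov; rewrite /completion /s -!pD -!mulrDl !(ler_pM2r D0).
    by case; [left|right].
  have sU j : (U (lam' j))%:R <= s j by have [] := (in_periodE _ _).1 (hlam j).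
  have slt j k : (lam' j < lam' k)%N -> s j < s k.
    by rewrite ltr_pM2r //; exact: in_period_lt.
  apply: (le_trans (total_cost_le p_gt0 sov W (fun=> erefl) ucs c_cs lam_lt
    scaled_U_leS sU slt)).
  rewrite -!mulrA ler_pM2l // mulrA mulr_sumr le_eqVlt; apply/orP; left.
  apply/eqP/eq_bigr => j _; rewrite /completion weightR -pD /s.
  by field; rewrite gt_eqF.
Qed.

(** * From blocks of jobs to a feasible schedule *)

Section Realize.
Variables k t : nat -> nat -> nat.
Hypothesis good : good_blocks P cs q U m cap k t.

Definition before l i := (\sum_(0 <= a < l) k a i)%N.

Lemma beforeS l i : before l.+1 i = (before l i + k l i)%N.
Proof. by rewrite /before big_nat_recr. Qed.

Lemma before_homo i : {homo before^~ i : a b / (a <= b)%N}.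
Proof.
by apply: homo_leq => // [|a]; [exact: leq_trans|rewrite beforeS leq_addr].
Qed.

(** The blocks of a class are filled in order of rank, and [slot] is the period whose block contains
    rank [r]. The default value [q] of [find] does not arise for the rank of a job, by [slot_ex]. *)
Definition slot r i := find (fun l => r < before l.+1 i)%N (iota 0 q).

Definition start_of i r : nat :=
  (t (slot r i) i + (r - before (slot r i) i) * P i)%N.

Lemma slotE l i a : (l < q)%N -> (a < k l i)%N -> slot (before l i + a) i = l.
Proof.
move=> lq ak; rewrite /slot; set f := (fun b => _).
have fl : f l by rewrite /f beforeS ltn_add2l.
have hf : has f (iota 0 q) by apply/hasP; exists l => //; rewrite mem_iota.
have fq : (find f (iota 0 q) < q)%N by rewrite -[X in (_ < X)%N](size_iota 0) -has_find.
case: (ltngtP (find f (iota 0 q)) l) => // hl.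
- have := nth_find 0%N hf; rewrite nth_iota // add0n /f /= => hlt.
  have /= := before_homo i hl; rewrite leqNgt => /negP; case.
  exact: leq_ltn_trans (leq_addr _ _) hlt.
- have := before_find 0%N hl; rewrite nth_iota // add0n.
  by rewrite fl.
Qed.

Lemma start_ofE l i a : (l < q)%N -> (a < k l i)%N ->
  start_of i (before l i + a) = (t l i + a * P i)%N.
Proof. by move=> lq ak; rewrite /start_of slotE // addKn. Qed.

Lemma slot_ex i r : i \in cs -> (r < m i)%N ->
  exists l a, [/\ (l < q)%N, (a < k l i)%N & r = (before l i + a)%N].
Proof.
move=> ics; rewrite -(blocks_mult good ics) -/(before q i).
elim: (q) => [|n IH]; first by rewrite /before big_geq.
rewrite beforeS; case: (ltnP r (before n i)) => [/IH[l [a [ln ak ->]]] _|hr hlt].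
  by exists l, a; split => //; apply: ltnW.
by exists n, (r - before n i)%N; split => //; lia.
Qed.

Lemma sum_before (V : nmodType) (F : nat -> V) n i :
  \sum_(0 <= r < before n i) F r =
  \sum_(0 <= l < n) \sum_(0 <= a < k l i) F (before l i + a)%N.
Proof.
elim: n => [|n IH]; first by rewrite /before !big_geq.
rewrite beforeS big_nat_recr //= -IH (big_cat_nat _ (n := before n i)) ?leq_addr //=.
congr (_ + _); rewrite -{1}[before n i]add0n big_addn addKn.
by apply: eq_bigr => a _; rewrite addnC.
Qed.

Lemma sum_slots (V : nmodType) (F : nat -> nat -> nat -> V) i : i \in cs ->
  \sum_(0 <= r < m i) F r (start_of i r) (slot r i) =
  \sum_(0 <= l < q) \sum_(0 <= a < k l i) F (before l i + a)%N (t l i + a * P i)%N l.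
Proof.
move=> ics; rewrite -(blocks_mult good ics) -/(before q i).
rewrite (sum_before (fun r => F r (start_of i r) (slot r i))).
rewrite !big_nat; apply: eq_bigr => l /= lq.
rewrite !big_nat; apply: eq_bigr => a /= ak.
by rewrite start_ofE // slotE.
Qed.

Definition realize (j : job I) : R := (start_of (tag j) (tagged j))%:R / D%:R.

Lemma realizeP (j : job I) : exists (l : 'I_q) (a : nat),
  [/\ (a < k l (tag j))%N, val (tagged j) = (before l (tag j) + a)%N,
      slot (tagged j) (tag j) = l
    & realize j = (t l (tag j) + a * P (tag j))%:R / D%:R].
Proof.
have [||l [a [lq ak e]]] := @slot_ex (tag j) (tagged j).
- exact: mem_classes.
- by rewrite -(scaled_mult sc) ltn_ord.
exists (Ordinal lq), a; split => //=; first by rewrite e slotE.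
by rewrite /realize e start_ofE.
Qed.

Lemma start_in_period (l : 'I_q) (i : 'I_h) a : (a < k l i)%N ->
  in_period I l ((t l i + a * P i)%:R / D%:R : R).
Proof.
move=> ak; apply/in_periodE; rewrite divfK ?gt_eqF // ler_nat; split.
  by rewrite (leq_trans (blocks_start good _ (mem_classes i))) ?leq_addr.
by move=> lq; rewrite ltr_nat; apply: (blocks_end good lq _ ak); exact: mem_classes.
Qed.

Lemma realize_period (j : job I) (l : 'I_q) :
  in_period I l (realize j) = (slot (tagged j) (tag j) == l).
Proof.
have [l0 [a [ak e -> ->]]] := realizeP j.
have h0 := start_in_period ak.
apply/idP/eqP => [hl|e0]; first by rewrite (in_period_uniq h0 hl).
by rewrite -(val_inj e0).
Qed.

(** Two jobs lie either in different blocks, which are separated, or at different places of one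
    block. *)
Lemma realize_apart (j j' : job I) : j != j' ->
  completion realize j <= realize j' \/ completion realize j' <= realize j.
Proof.
move=> jj'; have [l [a [ak e _ Ej]]] := realizeP j.
have [l' [a' [ak' e' _ Ej']]] := realizeP j'.
rewrite /completion Ej Ej' !ptimeR -!mulrDl -!natrD.
rewrite !ler_pM2r ?invr_gt0 // !ler_nat /cls.
have Pj := scaled_P_gt0 (tag j).
have [[el ei]|ne] := eqVneq (val l, val (tag j)) (val l', val (tag j')); last first.
  have := blocks_sep good (ltn_ord l) (ltn_ord l') (mem_classes _) (mem_classes _) ne.
  have h1 : (a * P (tag j) + P (tag j) <= k l (tag j) * P (tag j))%N.
    by rewrite -mulSnr leq_mul2r ak orbT.
  have h2 : (a' * P (tag j') + P (tag j') <= k l' (tag j') * P (tag j'))%N.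
    by rewrite -mulSnr leq_mul2r ak' orbT.
  case=> hs; [left|right]; apply: leq_trans _ (leq_trans hs (leq_addr _ _)).
    by rewrite -addnA leq_add2l.
  by rewrite -addnA leq_add2l.
have aa' : a != a'.
  apply: contra jj' => /eqP e1; move: e e' ei el; rewrite e1.
  case: (j) (j') => [i r] [i' r'] /= e e' ei el.
  have ei' := val_inj ei; subst i'; apply/eqP; congr existT; apply/val_inj.
  by rewrite /= e e' el.
rewrite -el -ei; case: (ltngtP a a') aa' => // lt _; [left|right].
- rewrite -addnA leq_add2l -mulSnr leq_mul2r lt orbT //.
- rewrite -addnA leq_add2l -mulSnr leq_mul2r lt orbT //.
Qed.

(** Jobs started by a time in period [l] belong to the periods up to [l]; they number at most
    [cap l], so the supplies up to [l] suffice for them. *)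
Lemma realize_feasible : feasible realize.
Proof.
split.
- by move=> j; rewrite divr_ge0 ?ler0n.
- exact: realize_apart.
- move=> x x0; have [l hl] := in_period_ex x0.
  have [a ha] := eqI.
  rewrite (eq_bigr (fun=> ratr a)); last by move=> b _; rewrite ha.
  rewrite sumr_const.
  pose X := [pred j : job I | (slot (tagged j) (tag j) <= l)%N].
  have sl : (#|X| <= cap l)%N.
    apply: leq_trans (blocks_cap good (ltn_ord l)).
    rewrite -sum1_card big_mkcond /= /X /=.
    rewrite (@sum_jobs nat (fun i r => if (slot r i <= l)%N then 1 else 0)%N).
    rewrite [leqRHS]exchange_big /= big_iota_ord.
    apply: leq_sum => i _.
    rewrite -(big_mkord xpredT (fun r => if (slot r i <= l)%N then 1 else 0)%N).
    rewrite (scaled_mult sc).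
    rewrite (sum_slots (fun _ _ b => if (b <= l)%N then 1 else 0)%N (mem_classes i)).
    rewrite (big_cat_nat _ (n := l.+1)) //=.
    rewrite [X in (_ + X)%R]big1_seq ?addr0; last first.
      move=> b /andP[_]; rewrite mem_index_iota => /andP[lb _].
      by rewrite leqNgt lb /= big1.
    rewrite !big_nat; apply: leq_sum => b /=; rewrite ltnS => bl.
    by rewrite bl sum_nat_const_nat subn0 muln1.
  apply: (@le_trans _ _ (ratr a *+ #|X|)).
    rewrite -![ratr a *+ _]mulr_natl ler_wpM2r //.
      (* The common requirement is nonnegative because it is that of an existing job. *)
      pose i0 := Ordinal h_gt0.
      pose j0 : job I := existT _ i0 (Ordinal (mult_gt0 vI i0)).
      by rewrite -(ha j0) ler0q (req_ge0 vI).
    rewrite ler_nat; apply: subset_leq_card; apply/fintype.subsetP => j.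
    rewrite !inE /in_mem /= => jx.
    have [l0 [b [bk e hs Ej]]] := realizeP j; rewrite hs leqNgt; apply/negP => ll0.
    have := start_in_period bk; rewrite -Ej => h0.
    by have := lt_le_trans (in_period_lt hl h0 ll0) jx; rewrite ltxx.
  have := sl; rewrite -(scaled_cap sc l _ ha) -(ler_rat R) rmorphM /= ratr_nat.
  rewrite mulr_natl => /le_trans; apply.
  rewrite rmorph_sum /= big_mkcond [leRHS]big_mkcond; apply: ler_sum => b _.
  have sb : 0 <= ratr (supply I b) :> R by rewrite ler0q ltW // (supply_gt0 vI).
  case: ifP => [bl|_]; last by case: ifP.
  suff -> : ratr (stime I b) <= x by [].
  rewrite stimeR ler_pdivrMr //; have [hU _] := (in_periodE _ _).1 hl.
  apply: le_trans hU; rewrite ler_nat.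
  by move: bl; rewrite leq_eqVlt => /predU1P[->//|/scaled_U_lt/ltnW].
Qed.

Lemma realize_inj : injective realize.
Proof.
move=> j j' e; apply/eqP/negPn/negP => /realize_apart; rewrite /completion e.
have := ptime_gt0 vI (cls j); have := ptime_gt0 vI (cls j').
rewrite -2!(ltr0q R); lra.
Qed.

Lemma realize_represents (C : compact q h) :
  (forall l i, bsize C l i = k l i) ->
  (forall l i, bstart C l i = (t l i)%:R / D%:R) ->
  represents C realize.
Proof.
move=> hk ht l i.
have ratrE a : ratr (bstart C l i + ptime I i *+ a) = (t l i + a * P i)%:R / D%:R :> R.
  rewrite ht rmorphD rmorphMn /= fmorph_div /= !ratr_nat ptimeR.
  by rewrite natrD natrM mulrDl -[_ / _ *+ a]mulr_natl mulrA.
apply: uniq_perm.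
- rewrite map_inj_in_uniq; last by move=> x y _ _; exact: realize_inj.
  by rewrite filter_uniq // enum_uniq.
- rewrite map_inj_in_uniq ?iota_uniq // => a b _ _; rewrite !ratrE.
  move=> /(mulIf (invr_neq0 (lt0r_neq0 D0)))/eqP; rewrite eqr_nat eqn_add2l.
  by rewrite eqn_pmul2r ?scaled_P_gt0 // => /eqP.
move=> x; apply/mapP/mapP => [[j]|[a]].
  rewrite mem_filter => /andP[/andP[/eqP ji]]; rewrite realize_period => hs _ ->.
  have [l' [a [ak e hs' Ej]]] := realizeP j.
  have ll' : l' = l by apply/val_inj; rewrite /= -hs'; apply/eqP.
  subst l'; move: ak {e} Ej; rewrite -/(cls j) ji => ak Ej.
  by exists a; rewrite ?mem_iota ?add0n ?hk // Ej ratrE.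
rewrite mem_iota add0n hk => ak ->.
have lt : (before l i + a < mult I i)%N.
  rewrite (scaled_mult sc) -(blocks_mult good (mem_classes i)) -/(before q i).
  apply: leq_trans (before_homo i (ltn_ord l)).
  by rewrite /= beforeS ltn_add2l.
exists (existT (fun i : 'I_h => 'I_(mult I i)) i (Ordinal lt)); last first.
  by rewrite ratrE /realize /= start_ofE.
by rewrite mem_filter mem_enum realize_period /= slotE // !eqxx.
Qed.

Lemma realize_cost : 2 * D%:R * E%:R * cost realize = (blocks_cost P W cs q k t)%:R.
Proof.
rewrite /cost mulr_sumr.
rewrite (eq_bigr (fun j : job I => (2 * W (tag j) * (start_of (tag j) (tagged j) + P (tag j)))%:R)); last first.
  move=> j _; rewrite /completion /realize weightR ptimeR /cls !natrM natrD.
  by field; rewrite !gt_eqF.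
rewrite -natr_sum; congr (_%:R).
rewrite (@sum_jobs nat (fun i r => (2 * W i * (start_of i r + P i))%N)).
rewrite /blocks_cost exchange_big /= big_iota_ord; apply: eq_bigr => i _.
rewrite -(big_mkord xpredT (fun r => (2 * W i * (start_of i r + P i))%N)).
rewrite (scaled_mult sc).
rewrite (sum_slots (fun _ s _ => (2 * W i * (s + P i))%N) (mem_classes i)).
apply: eq_bigr => l _; elim: (k l i) => [|n IH].
  by rewrite big_geq // !(muln0, mul0n).
rewrite big_nat_recr //= IH; ring.
Qed.

End Realize.
End Scaled.

(** * Running times and counting loops *)

Section Machine.
Local Open Scope nat_scope.

Lemma ltn_bitlen n : n < 2 ^ bitlen n.
Proof. exact: trunc_log_ltn. Qed.

Lemma bitlen_leq n b : 0 < b -> n < 2 ^ b -> bitlen n <= b.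
Proof.
move=> b0 nb; rewrite /bitlen; have [->|n0] := posnP n; first by rewrite trunc_log0.
by rewrite -(ltn_exp2l _ _ (isT : 1 < 2)) (leq_ltn_trans _ nb) // trunc_logP.
Qed.

Fixpoint expr_regs e : seq nat :=
  match e with
  | Const _ => [::]
  | Reg r => [:: r]
  | Op _ e1 e2 => expr_regs e1 ++ expr_regs e2
  end.

Fixpoint cmd_regs c : seq nat :=
  match c with
  | Skip => [::]
  | Assign r e => r :: expr_regs e
  | Seq c1 c2 => cmd_regs c1 ++ cmd_regs c2
  | If e c1 c2 => expr_regs e ++ cmd_regs c1 ++ cmd_regs c2
  | While e c => expr_regs e ++ cmd_regs c
  end.

Lemma eq_eval_regs s s' e : {in expr_regs e, s =1 s'} -> eval s e = eval s' e.
Proof.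
elim: e => [n|r|o e1 IH1 e2 IH2] //= h; first by apply: h; rewrite inE.
by rewrite IH1 ?IH2 // => r hr; apply: h; rewrite mem_cat hr ?orbT.
Qed.

Fixpoint loopfree c : bool :=
  match c with
  | Skip | Assign _ _ => true
  | Seq c1 c2 | If _ c1 c2 => loopfree c1 && loopfree c2
  | While _ _ => false
  end.

(** Functional semantics of loop-free commands; the value for [While] is a placeholder. *)
Fixpoint step c s : store :=
  match c with
  | Skip | While _ _ => s
  | Assign r e => update s r (eval s e)
  | Seq c1 c2 => step c2 (step c1 s)
  | If e c1 c2 => if eval s e != 0 then step c1 s else step c2 s
  end.

Definition avoids (V : pred nat) (rs : seq nat) := {in rs, forall r, ~~ V r}.

Lemma avoids_cat V rs1 rs2 : avoids V (rs1 ++ rs2) -> avoids V rs1 /\ avoids V rs2.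
Proof. by move=> h; split=> r hr; apply: h; rewrite mem_cat hr ?orbT. Qed.

Definition narrow (V : pred nat) b (s : store) := forall r, ~~ V r -> s r < 2 ^ b.

Lemma narrow_le V b b' s : b <= b' -> narrow V b s -> narrow V b' s.
Proof. by move=> bb h r /h /leq_trans; apply; rewrite leq_exp2l. Qed.

(** For a fixed expression, the length of the value is linear and the time quadratic in the length
    of the registers read. The registers in [V] may be arbitrarily long, as the expression does not
    mention them. *)
Lemma eval_bound e : exists2 C, 0 < C & forall V s b, 0 < b ->
  avoids V (expr_regs e) -> narrow V b s ->
  eval s e < 2 ^ (C * b) /\ eval_time s e <= C * b ^ 2.
Proof.
elim: e => [n|r|o e1 [C1 C10 H1] e2 [C2 C20 H2]] /=.
- exists (bitlen n) => // V s b b0 _ _; split; last by rewrite leq_pmulr ?expn_gt0 ?b0.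
  by rewrite (leq_trans (ltn_bitlen n)) // leq_exp2l // leq_pmulr.
- exists 1 => // V s b b0 hV hs; have hr : s r < 2 ^ b by apply: hs; apply: hV; rewrite inE.
  rewrite !mul1n; split => //; apply: leq_trans (bitlen_leq b0 hr) _.
  by rewrite -mulnn leq_pmulr.
(* The product pays for the operation: its price is at most [(C1 * b).+1 * (C2 * b).+1]. *)
exists (C1 + C2 + C1.+1 * C2.+1); first by rewrite !addn_gt0 C10.
move=> V s b b0 /avoids_cat[a1 a2] hs.
have [h1 t1] := H1 V s b b0 a1 hs; have [h2 t2] := H2 V s b b0 a2 hs.
have p1 : 2 ^ 1 <= 2 ^ (C1 * b) by rewrite leq_exp2l // muln_gt0 C10.
have p2 : 2 ^ 1 <= 2 ^ (C2 * b) by rewrite leq_exp2l // muln_gt0 C20.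
have hle : 2 ^ (C1 * b) * 2 ^ (C2 * b) <= 2 ^ ((C1 + C2 + C1.+1 * C2.+1) * b).
  by rewrite -expnD -mulnDl leq_exp2l // leq_mul2r leq_addr orbT.
split.
  apply: leq_trans hle; case: o => /=.
  - nia.
  - by apply: leq_ltn_trans (leq_subr _ _) _; nia.
  - exact: ltn_mul.
  - by apply: leq_ltn_trans (leq_div _ _) _; nia.
  - by have := leq_b1 (eval s e1 <= eval s e2); nia.
have l1 : bitlen (eval s e1) <= C1 * b by rewrite bitlen_leq // muln_gt0 C10.
have l2 : bitlen (eval s e2) <= C2 * b by rewrite bitlen_leq // muln_gt0 C20.
rewrite !mulnDl; apply: leq_add; first exact: leq_add.
apply: leq_trans (_ : (C1 * b).+1 * (C2 * b).+1 <= _); first exact: leq_mul.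
rewrite -mulnn mulnACA; apply: leq_mul; rewrite mulSn; lia.
Qed.

(** Each command multiplies the length bound by a constant. This is harmless for a fixed loop-free
    program but could not be iterated, whence the care taken with the registers in the search. *)
Lemma step_bound c : loopfree c -> exists2 C, 0 < C & forall V s b, 0 < b ->
  avoids V (cmd_regs c) -> narrow V b s ->
  (exists2 n, exec c s n (step c s) & n <= C * b ^ 2) /\ narrow V (C * b) (step c s).
Proof.
elim: c => //=.
- move=> _; exists 1 => // V s b b0 _ hs; rewrite !mul1n; split => //.
  by exists 1; [exact: ExecSkip|rewrite expn_gt0 b0].
- move=> r e _; have [C C0 H] := eval_bound e; exists C.+1 => // V s b b0 hV hs.
  have [|hv ht] := H V s b b0 _ hs; first by move=> a ha; apply: hV; rewrite inE ha orbT.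
  split; first (exists (eval_time s e).+1; first exact: ExecAssign).
    by rewrite mulSn -addn1 addnC leq_add // expn_gt0 b0.
  move=> a Va; rewrite /update; case: eqP => _.
    by apply: leq_trans hv _; rewrite leq_exp2l // leq_mul2r leqnSn orbT.
  by apply: leq_trans (hs a Va) _; rewrite leq_exp2l // leq_pmull.
- move=> c1 IH1 c2 IH2 /andP[/IH1[C1 C10 {}IH1] /IH2[C2 C20 {}IH2]].
  (* The second command starts from registers of length [C1 * b]. *)
  exists (C1 + C2 * C1 ^ 2); first by rewrite addn_gt0 C10.
  move=> V s b b0 /avoids_cat[a1 a2] hs.
  have [[n1 e1 l1] w1] := IH1 V s b b0 a1 hs.
  have b1 : 0 < C1 * b by rewrite muln_gt0 C10.
  have [[n2 e2 l2] w2] := IH2 V _ _ b1 a2 w1.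
  split; first (exists (n1 + n2); first exact: ExecSeq e1 e2).
    by rewrite mulnDl leq_add // -mulnA -expnMn.
  apply: narrow_le w2; rewrite mulnA leq_mul2r; apply/orP; right.
  by apply: leq_trans (leq_addl _ _); rewrite leq_mul2l -mulnn leq_pmulr ?orbT.
- move=> e c1 IH1 c2 IH2 /andP[/IH1[C1 C10 {}IH1] /IH2[C2 C20 {}IH2]].
  have [C C0 H] := eval_bound e; exists (C + C1 + C2).+1 => //.
  move=> V s b b0 /avoids_cat[ae /avoids_cat[a1 a2]] hs.
  have [_ ht] := H V s b b0 ae hs.
  have [[n1 e1 l1] w1] := IH1 V s b b0 a1 hs.
  have [[n2 e2 l2] w2] := IH2 V s b b0 a2 hs.
  have bb : 0 < b ^ 2 by rewrite expn_gt0 b0.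
  have [ez|ez] := eqVneq (eval s e) 0; split.
  + exists (eval_time s e + n2).+1; first exact: ExecIfFalse.
    by rewrite mulSn !mulnDl; lia.
  + by apply: narrow_le w2; rewrite leq_mul2r; lia.
  + exists (eval_time s e + n1).+1; first exact: ExecIfTrue.
    by rewrite mulSn !mulnDl; lia.
  + by apply: narrow_le w1; rewrite leq_mul2r; lia.
Qed.

Definition seqs (cs : seq cmd) := foldr Seq Skip cs.

Definition assigns (I : Type) (J : seq I) (r : I -> nat) (e : I -> expr) :=
  seqs [seq Assign (r i) (e i) | i <- J].

Lemma step_seqs_cat cs1 cs2 s :
  step (seqs (cs1 ++ cs2)) s = step (seqs cs2) (step (seqs cs1) s).
Proof. by elim: cs1 s => //= c cs1 IH s. Qed.

Lemma loopfree_assigns (I : Type) (J : seq I) r e : loopfree (assigns J r e).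
Proof. by elim: J. Qed.

Lemma step_assigns_out (I : Type) (J : seq I) r e s a :
  a \notin map r J -> step (assigns J r e) s a = s a.
Proof.
elim: J s => //= i J IH s; rewrite inE negb_or => /andP[ai aJ].
by rewrite -/(assigns J r e) IH // /update (negbTE ai).
Qed.

Lemma step_assigns (I : eqType) (J : seq I) r e s i :
  uniq (map r J) -> (forall j j', j \in J -> j' \in J -> r j' \notin expr_regs (e j)) ->
  i \in J -> step (assigns J r e) s (r i) = eval s (e i).
Proof.
elim: J s => // j J IH s /= /andP[jJ uJ] hJ; rewrite -/(assigns J r e).
rewrite in_cons => /predU1P[->|iJ].
  by rewrite step_assigns_out // /update eqxx.
rewrite IH //; last by move=> a b aJ bJ; apply: hJ; rewrite in_cons ?aJ ?bJ orbT.
apply: eq_eval_regs => a ha; rewrite /update; case: eqP => // ea.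
by have := hJ i j; rewrite !in_cons iJ eqxx orbT -ea ha => /(_ isT isT).
Qed.

(** * Grids of ratio [1 + 1 / N] *)

Section Grid.
Variable N : nat.
Hypothesis N_gt0 : 0 < N.

(** The increment is the maximum of 1 and [x %/ N], written with truncated subtraction as the
    machine computes it. *)
Definition grid_next x := x + (1 + (x %/ N - 1)).

Definition grid j := iter j grid_next 0.

Lemma gridS j : grid j.+1 = grid_next (grid j).
Proof. by []. Qed.

Lemma grid_homo : {homo grid : i j / i <= j}.
Proof.
by apply: homo_leq => // [|j]; [exact: leq_trans|rewrite gridS /grid_next leq_addr].
Qed.

Lemma grid_next_le x : grid_next x <= (2 * x).+1.
Proof. by rewrite /grid_next; have := leq_div x N; lia. Qed.

Lemma grid_ge j : j <= grid j.
Proof. by elim: j => // j IH; rewrite gridS /grid_next; lia. Qed.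

(** From [grid i] on each step adds at least [d = grid i %/ N], and [grid i < N * d.+1 <= 2 * N * d]
    as [d] is positive. *)
Lemma grid_double i : N <= grid i -> 2 * grid i <= grid (i + 2 * N).
Proof.
move=> hi; set d := grid i %/ N.
have d0 : 0 < d by rewrite divn_gt0.
have step j : grid i + j * d <= grid (i + j).
  elim: j => [|j IH]; first by rewrite mul0n !addn0.
  have : d <= grid (i + j) %/ N by apply: leq_div2r; apply: grid_homo; exact: leq_addr.
  by rewrite addnS gridS /grid_next; lia.
apply: leq_trans (step (2 * N)).
by have := divn_eq (grid i) N; have := ltn_pmod (grid i) N_gt0; rewrite -/d; nia.
Qed.

(** [N] steps reach [N], and every further [2 * N] steps double the value, so the number of points
    up to [B] is linear in [N] and in the length of [B]. *)
Lemma grid_exceeds B : B < grid (N + 2 * N * bitlen B).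
Proof.
apply: leq_trans (ltn_bitlen B) _; elim: (bitlen B) => [|k IH].
  by rewrite expn0 muln0 addn0; have := grid_ge N; lia.
rewrite expnS mulnS addnCA addnC.
apply: leq_trans (grid_double _); first by rewrite leq_mul2l IH.
by apply: leq_trans (grid_ge N) _; apply: grid_homo; exact: leq_addr.
Qed.

(** The least grid point above [y] follows a point below [y]: an increment of 1 then hits [y]
    exactly, a larger one is at most an [N]-th of that point. *)
Lemma grid_round y : exists2 j, y <= grid j & N * grid j <= N.+1 * y.
Proof.
have ex : exists j, y <= grid j by exists y; exact: grid_ge.
case: (ex_minnP ex) => [[|j] yj jmin]; first by exists 0; rewrite // muln0.
exists j.+1 => //.
have {jmin} : grid j < y by rewrite ltnNge; apply/negP => /jmin; rewrite ltnn.
rewrite gridS /grid_next; have := leq_divM (grid j) N; nia.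
Qed.

End Grid.

(** * Nested loops whose counters run through the grid *)

Section Loops.
Variables (guard next : nat -> expr).

Definition loop_over body vs :=
  foldr (fun v c => Seq (Assign v (Const 0)) (While (guard v) (Seq c (Assign v (next v)))))
    body vs.

Variables (X : seq nat) (N B M T E : nat) (body : cmd).
Variables (Inv Hit : store -> Prop) (tgt : nat -> nat).
Hypothesis N_gt0 : 0 < N.
Hypothesis M_exceeds : B < grid N M.
Hypothesis Inv_guard : forall s v, v \in X -> Inv s ->
  eval s (guard v) = (s v <= B) /\ eval_time s (guard v) <= E.
Hypothesis Inv_next : forall s v, v \in X -> Inv s ->
  eval s (next v) = grid_next N (s v) /\ eval_time s (next v) <= E.
Hypothesis Inv_update : forall s v x, v \in X -> x <= (2 * B).+1 -> Inv s -> Inv (update s v x).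
Hypothesis Hit_update : forall s v x, v \in X -> Hit s -> Hit (update s v x).
Hypothesis Inv_body : forall s, Inv s -> exists n s',
  [/\ exec body s n s', n <= T, Inv s', (Hit s \/ {in X, s =1 tgt}) -> Hit s'
    & {in X, s' =1 s}].
Hypothesis tgt_grid : forall v, v \in X -> exists2 j, tgt v = grid N j & tgt v <= B.

Definition loop_time n := iter n (fun t => M.+1 * (t + 2 * E + 3)) T.

(** [Hit] is never lost, so it suffices that the body meets the target once. [[predD X & vs]] holds
    the counters of the enclosing loops: either [Hit] has been reached already, or they stand at
    their targets. *)
Lemma loop_overP vs s : uniq vs -> {subset vs <= X} -> Inv s -> exists n s',
  [/\ exec (loop_over body vs) s n s', n <= loop_time (size vs), Inv s',
      (Hit s \/ {in [predD X & vs], s =1 tgt}) -> Hit s'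
    & {in [predD X & vs], s' =1 s}].
Proof.
elim: vs s => [|v vs IH] s.
  by move=> _ _ /Inv_body [n [s' [ex nT Is' hit same]]]; exists n, s'; split => //.
rewrite [uniq _]/= => /andP[vvs uvs] sub Is.
have vX : v \in X by apply: sub; rewrite inE eqxx.
have {}IH s0 := IH s0 uvs (fun x hx => sub x (mem_behead (s := v :: vs) hx)).
have outv x : x \in [predD X & v :: vs] -> (x \in [predD X & vs]) /\ x <> v.
  by rewrite !inE negb_or => /andP[/andP[/eqP xv xvs] xX]; rewrite xvs xX.
set L := loop_time (size vs) in IH.
(* [m] bounds the rounds that are left, since [grid N M] exceeds [B]; [j <= j'] says that the
   counter has not passed its target. *)
have hwhile m j s0 : j + m = M -> Inv s0 -> s0 v = grid N j -> exists n s',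
  [/\ exec (While (guard v) (Seq (loop_over body vs) (Assign v (next v)))) s0 n s',
      n <= m * (L + 2 * E + 2) + E.+1, Inv s',
      (Hit s0 \/ (exists2 j', tgt v = grid N j' & j <= j') /\
         {in [predD X & v :: vs], s0 =1 tgt}) -> Hit s'
    & {in [predD X & v :: vs], s' =1 s0}].
  elim: m j s0 => [|m IHm] j s0 jm I0 sj; have [eg tg] := Inv_guard vX I0.
    have out : ~~ (s0 v <= B) by rewrite -ltnNge sj; move: jm; rewrite addn0 => ->.
    exists (eval_time s0 (guard v)).+1, s0; split => //.
    - by apply: ExecWhileFalse; rewrite eg (negbTE out).
    - case=> // -[[j' tj jj'] _]; have [_ _] := tgt_grid vX.
      by move: out; rewrite -ltnNge sj => /leq_trans /(_ (grid_homo N jj')); rewrite -tj ltnNge => /negbTE ->.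
  have [inB|out] := boolP (s0 v <= B); last first.
    exists (eval_time s0 (guard v)).+1, s0; split => //.
    - by apply: ExecWhileFalse; rewrite eg (negbTE out).
    - lia.
    - case=> // -[[j' tj jj'] _]; have [_ _] := tgt_grid vX.
      by move: out; rewrite -ltnNge sj => /leq_trans /(_ (grid_homo N jj')); rewrite -tj ltnNge => /negbTE ->.
  have [n1 [s1 [e1 l1 I1 hit1 same1]]] := IH _ I0.
  have vD : v \in [predD X & vs] by rewrite inE vvs.
  have [en tn] := Inv_next vX I1.
  have s1v : s1 v = grid N j by rewrite same1.
  pose s2 := update s1 v (eval s1 (next v)).
  have I2 : Inv s2.
    apply: Inv_update => //; rewrite en s1v; apply: leq_trans (grid_next_le N_gt0 _) _.
    by rewrite ltnS leq_mul2l /= -sj.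
  have s2v : s2 v = grid N j.+1 by rewrite /s2 /update eqxx en s1v.
  have [|n3 [s3 [e3 l3 I3 hit3 same3]]] := IHm j.+1 s2 _ I2 s2v; first by rewrite addSnnS.
  exists (eval_time s0 (guard v) + (n1 + (eval_time s1 (next v)).+1) + n3).+1, s3; split => //.
  - apply: (ExecWhileTrue (s2 := s2)) => //; first by rewrite eg inB.
    by apply: ExecSeq e1 _; exact: ExecAssign.
  - by rewrite mulSn; lia.
  - case=> [h0|[[j' tj jj'] h0]].
      by apply: hit3; left; apply: Hit_update => //; apply: hit1; left.
    (* At the target this round of the inner loops produces [Hit]; otherwise the target is still
       ahead. *)
    have [jj|jj] := eqVneq j j'.
      apply: hit3; left; apply: Hit_update => //; apply: hit1; right => x.
      have [->|xv] := eqVneq x v; first by rewrite sj tj jj.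
      by rewrite !inE => hx; apply: h0; rewrite !inE negb_or xv.
    apply: hit3; right; split; first by exists j' => //; rewrite ltn_neqAle jj.
    move=> x hx; have [hx' /eqP xv] := outv x hx.
    by rewrite /s2 /update (negbTE xv) same1 // h0.
  - move=> x hx; have [hx' /eqP xv] := outv x hx.
    by rewrite same3 // /s2 /update (negbTE xv) same1.
pose s0 := update s v (eval s (Const 0)).
have I0 : Inv s0 by apply: Inv_update.
have s0v : s0 v = grid N 0 by rewrite /s0 /update eqxx.
have [n1 [s1 [e1 l1 I1 hit1 same1]]] := hwhile M 0 s0 (add0n M) I0 s0v.
exists ((eval_time s (Const 0)).+1 + n1), s1; split => //.
- by apply: ExecSeq e1; exact: ExecAssign.
- rewrite /loop_time /= -/(loop_time (size vs)) -/L mulSn.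
  have : M * (L + 2 * E + 2) <= M * (L + 2 * E + 3) by rewrite leq_mul2l; lia.
  by rewrite /bitlen trunc_log0; lia.
- case=> h; apply: hit1; [left; exact: Hit_update|right; split].
    by have [j tj _] := tgt_grid vX; exists j.
  move=> x hx; have [_ /eqP xv] := outv x hx.
  by rewrite /s0 /update (negbTE xv) h.
- move=> x hx; have [hx' /eqP xv] := outv x hx.
  by rewrite same1 // /s0 /update (negbTE xv).
Qed.

End Loops.
End Machine.

(** * The program *)

Section Program.
Local Open Scope nat_scope.
Variables q h : nat.

(** Clear of the [2 + 7 * h + 4 * q] words of the input and of the [5 * (q * h)] registers of the
    output, which begin at 0 as well. *)
Definition zbase := 2 + 7 * h + 4 * q + 5 * (q * h).

(* Registers beyond the input and the output are addressed by triples
   (kind, period, class): the accuracy has kind 1, the counters of the search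
   kind 2, the best schedule found so far kinds 3 to 6, and the others are scratch
   registers.  Without the lock, unification would compute [pickle]. *)
Definition addr : nat * nat * nat -> nat := locked (fun v => zbase + pickle v).

Definition name (r : nat) : option (nat * nat * nat) :=
  if r < zbase then None else pickle_inv (r - zbase).

(** Frame conditions are stated by kinds; input and output registers have kind 0. *)
Definition kind r := if name r is Some v then v.1.1 else 0.

Lemma nameK v : name (addr v) = Some v.
Proof. by rewrite /name /addr -lock ltnNge leq_addr /= addKn pickleK_inv. Qed.

Lemma name_addr r v : name r = Some v -> r = addr v.
Proof.
rewrite /name; case: ltnP => // rz e.
by have := @pickle_invK ((nat * nat * nat)%type : countType) (r - zbase); rewrite e /= /addr -lock => ->; rewrite subnKC.
Qed.

Lemma kind_addr v : kind (addr v) = v.1.1.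
Proof. by rewrite /kind nameK. Qed.

Lemma kind_input r : r < zbase -> kind r = 0.
Proof. by rewrite /kind /name => ->. Qed.

Lemma addr_eq v v' : (addr v == addr v') = (v == v').
Proof.
apply/eqP/eqP => [e|-> //]; have := nameK v; rewrite e nameK.
by case.
Qed.

(** The layout of [encode]: offsets 0 to 5 of a class are numerator and denominator of processing
    time, requirement and weight; offsets 0 to 3 of a period are those of supply time and
    quantity. *)
Definition in_mult i := 1 + 7 * i.
Definition in_class i c := 2 + 7 * i + c.
Definition in_period_reg l c := 2 + 7 * h + 4 * l + c.

Definition accuracy := addr (1, 0, 0).
Definition counter l i := addr (2, l, i).
Definition found := addr (3, 0, 0).
Definition best := addr (4, 0, 0).
Definition best_k l i := addr (5, l, i).
Definition best_t l i := addr (6, l, i).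
Definition clock := addr (7, 0, 0).
Definition cur_cost := addr (8, 0, 0).
Definition cur_k l i := addr (9, l, i).
Definition cur_t l i := addr (10, l, i).

Definition esum (es : seq expr) := foldr (Op Add) (Const 0) es.
Definition eprod (es : seq expr) := foldr (Op Mul) (Const 1) es.

Lemma step_If e c1 c2 s :
  step (If e c1 c2) s = if eval s e != 0 then step c1 s else step c2 s.
Proof. by []. Qed.

Lemma eval_esum (I : Type) s (J : seq I) (f : I -> expr) :
  eval s (esum [seq f i | i <- J]) = \sum_(i <- J) eval s (f i).
Proof. by elim: J => [|i J IH]; rewrite ?big_nil // big_cons /= IH. Qed.

Lemma eval_eprod (I : Type) s (J : seq I) (f : I -> expr) :
  eval s (eprod [seq f i | i <- J]) = \prod_(i <- J) eval s (f i).
Proof. by elim: J => [|i J IH]; rewrite ?big_nil // big_cons /= IH. Qed.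

Lemma all_esum (p : pred nat) es :
  all p (expr_regs (esum es)) = all (fun e => all p (expr_regs e)) es.
Proof. by elim: es => //= e es IH; rewrite all_cat IH. Qed.

Lemma all_eprod (p : pred nat) es :
  all p (expr_regs (eprod es)) = all (fun e => all p (expr_regs e)) es.
Proof. by elim: es => //= e es IH; rewrite all_cat IH. Qed.

Lemma evalOp s o a b : eval s (Op o a b) = binop_sem o (eval s a) (eval s b).
Proof. by []. Qed.

Definition emax a b := Op Add a (Op Defs.Sub b a).
Definition emin a b := Op Defs.Sub a (Op Defs.Sub a b).

Lemma eval_emax s a b : eval s (emax a b) = maxn (eval s a) (eval s b).
Proof. by rewrite maxnE. Qed.

Lemma eval_emin s a b : eval s (emin a b) = minn (eval s a) (eval s b).
Proof. by rewrite minnE. Qed.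

Let cs := iota 0 h.
Let ps := iota 0 q.

Definition e_scale := Op Mul (eprod [seq Reg (in_class i 1) | i <- cs])
  (eprod [seq Reg (in_period_reg l 1) | l <- ps]).
(* The rational [n / d] as a multiple of [1 / D], for [d] dividing [D]. *)
Definition e_ratio n D d := Op Mul (Reg n) (Op Div D (Reg d)).

Definition e_ptime i := e_ratio (in_class i 0) e_scale (in_class i 1).
Definition e_stime l := e_ratio (in_period_reg l 0) e_scale (in_period_reg l 1).
Definition e_wscale := eprod [seq Reg (in_class i 5) | i <- cs].
Definition e_weight i := e_ratio (in_class i 4) e_wscale (in_class i 5).
(** All requirements are equal, so class 0 stands for every class. *)
Definition e_rscale := Op Mul (eprod [seq Reg (in_period_reg l 3) | l <- ps])
  (Reg (in_class 0 3)).
Definition e_req := e_ratio (in_class 0 2) e_rscale (in_class 0 3).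
Definition e_supply l := e_ratio (in_period_reg l 2) e_rscale (in_period_reg l 3).
Definition e_cap l := Op Div (esum [seq e_supply a | a <- iota 0 l.+1]) e_req.
Definition e_mult i := Reg (in_mult i).

(** The jobs not claimed by the counters of later periods. Truncation ends the claims when the class
    is exhausted, so every value of the counters yields releases that are monotone in [l] and reach
    the multiplicity in the last period. *)
Definition e_released l i :=
  Op Defs.Sub (e_mult i) (esum [seq Reg (counter a i) | a <- iota l.+1 (q - l.+1)]).
Definition e_pending l i :=
  Op Defs.Sub (e_released l i) (esum [seq Reg (cur_k a i) | a <- iota 0 l]).
Definition e_fitting l i :=
  emin (e_pending l i) (Op Div (Op Add (Op Defs.Sub (e_stime l.+1) (Reg clock))
    (Op Defs.Sub (e_ptime i) (Const 1))) (e_ptime i)).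

Definition place l i :=
  [:: Assign (cur_t l i) (Reg clock);
      Assign (cur_k l i) (if l.+1 < q then e_fitting l i else e_pending l i);
      Assign clock (Op Add (Reg clock) (Op Mul (Reg (cur_k l i)) (e_ptime i)))].

Definition fill l pi := flatten [seq place l i | i <- pi].

Definition run_period pi l := Assign clock (emax (e_stime l) (Reg clock)) :: fill l pi.

Definition run_dispatch pi n :=
  Assign clock (Const 0) :: flatten [seq run_period pi l | l <- iota 0 n].

Definition e_block_cost l i :=
  Op Mul (e_weight i) (Op Add
    (Op Mul (Op Mul (Const 2) (Reg (cur_k l i))) (Reg (cur_t l i)))
    (Op Mul (Op Mul (e_ptime i) (Reg (cur_k l i))) (Op Add (Const 1) (Reg (cur_k l i))))).

Definition e_cost := esum [seq esum [seq e_block_cost l i | i <- cs] | l <- ps].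

Definition evaluate pi := run_dispatch pi q ++ [:: Assign cur_cost e_cost].

Definition e_feasible :=
  eprod [seq Op Leq (esum [seq esum [seq Reg (cur_k a i) | i <- cs] | a <- iota 0 l.+1])
    (e_cap l) | l <- ps].

Definition e_better := Op Mul e_feasible
  (Op Add (Op Leq (Reg found) (Const 0)) (Op Leq (Op Add (Const 1) (Reg cur_cost)) (Reg best))).

Definition blocks := allpairs pair ps cs.

Definition keep := seqs
  [:: assigns blocks (fun b => best_k b.1 b.2) (fun b => Reg (cur_k b.1 b.2));
      assigns blocks (fun b => best_t b.1 b.2) (fun b => Reg (cur_t b.1 b.2));
      Assign best (Reg cur_cost); Assign found (Const 1)].

Definition scratch :=
  clock :: cur_cost :: [seq cur_k b.1 b.2 | b <- blocks] ++ [seq cur_t b.1 b.2 | b <- blocks].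

(** Erasing the scratch registers restores the length bound that held before the candidate. *)
Definition wipe := assigns scratch id (fun=> Const 0).

Definition try_order pi :=
  Seq (seqs (evaluate pi)) (Seq (If e_better keep Skip) wipe).

Definition try_all := seqs [seq try_order pi | pi <- permutations cs].

Definition counters := [seq counter b.1 b.2 | b <- blocks].

(** Rounding up at most doubles a number of jobs, so the search need not pass twice the number of
    all jobs. The factor 3 in [e_grid] absorbs the square in the rounding error. *)
Definition e_bound := Op Mul (Const 2) (esum [seq e_mult i | i <- cs]).
Definition e_grid := Op Mul (Const 3) (Reg accuracy).

Definition guard v := Op Leq (Reg v) e_bound.
Definition next v :=
  Op Add (Reg v) (Op Add (Const 1) (Op Defs.Sub (Op Div (Reg v) e_grid) (Const 1))).

Definition cell (x : nat * nat * nat) := 5 * (x.1.1 * h + x.1.2) + x.2.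

Definition cells := allpairs pair blocks (iota 0 5).

Definition e_cell (x : nat * nat * nat) :=
  nth (Const 0) [:: Const x.1.1; Const x.1.2; Reg (best_t x.1.1 x.1.2); Reg clock;
    Reg (best_k x.1.1 x.1.2)] x.2.

(** The output overwrites the input registers, so the common denominator is saved in [clock]
    beforehand. *)
Definition emit := Seq (Assign clock e_scale) (assigns cells cell e_cell).

Definition program := Seq (loop_over guard next try_all counters) emit.

Definition static : pred nat := fun r => kind r <= 2.
Definition inputs : pred nat := fun r => kind r == 0.

Lemma inputs_mult i : i < h -> inputs (in_mult i).
Proof. by move=> ih; rewrite /inputs kind_input // /in_mult /zbase; lia. Qed.

Lemma inputs_class i c : i < h -> c < 6 -> inputs (in_class i c).
Proof. by move=> ih c6; rewrite /inputs kind_input // /in_class /zbase; lia. Qed.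

Lemma inputs_period l c : l < q -> c < 4 -> inputs (in_period_reg l c).
Proof. by move=> lq c4; rewrite /inputs kind_input // /in_period_reg /zbase; lia. Qed.

Lemma all_op (p : pred nat) o a b :
  all p (expr_regs (Op o a b)) = all p (expr_regs a) && all p (expr_regs b).
Proof. exact: all_cat. Qed.

Lemma all_reg (p : pred nat) r : all p (expr_regs (Reg r)) = p r.
Proof. exact: andbT. Qed.

Lemma all_iota (p : pred nat) n k :
  (forall i, n <= i < n + k -> p i) -> all p (iota n k).
Proof. by move=> H; apply/allP => i; rewrite mem_iota => /H. Qed.

Lemma all_ratio (p : pred nat) n D d :
  all p (expr_regs (e_ratio n D d)) = [&& p n, all p (expr_regs D) & p d].
Proof. by rewrite /= all_cat /= andbT. Qed.

Lemma inputs_scale : all inputs (expr_regs e_scale).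
Proof.
rewrite all_op !all_eprod !all_map; apply/andP; split; apply: all_iota => i /= hi.
  by rewrite inputs_class.
by rewrite inputs_period.
Qed.

Lemma inputs_ptime i : i < h -> all inputs (expr_regs (e_ptime i)).
Proof. by move=> ih; rewrite all_ratio inputs_scale !inputs_class. Qed.

Lemma inputs_stime l : l < q -> all inputs (expr_regs (e_stime l)).
Proof. by move=> lq; rewrite all_ratio inputs_scale !inputs_period. Qed.

Lemma inputs_wscale : all inputs (expr_regs e_wscale).
Proof.
by rewrite all_eprod all_map; apply: all_iota => i /= hi; rewrite inputs_class.
Qed.

Lemma inputs_weight i : i < h -> all inputs (expr_regs (e_weight i)).
Proof. by move=> ih; rewrite all_ratio inputs_wscale !inputs_class. Qed.

Lemma inputs_cap l : 0 < h -> l < q -> all inputs (expr_regs (e_cap l)).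
Proof.
move=> h0 lq.
have hr : all inputs (expr_regs e_rscale).
  rewrite all_op all_eprod all_map all_reg inputs_class // andbT.
  by apply: all_iota => a /= hi; rewrite inputs_period.
rewrite /e_cap all_op all_ratio hr !inputs_class //.
rewrite all_esum all_map !andbT; apply: all_iota => a ha; have aq : a < q by lia.
by change (all inputs (expr_regs (e_supply a))); rewrite all_ratio hr !inputs_period.
Qed.

Lemma inputs_bound : all inputs (expr_regs e_bound).
Proof.
rewrite /e_bound all_op all_esum all_map; apply: all_iota => i /= hi.
by rewrite inputs_mult.
Qed.

Definition agree (p : pred nat) (s s' : store) := forall r, p r -> s' r = s r.

Lemma eval_agree p e s s' : all p (expr_regs e) -> agree p s s' -> eval s' e = eval s e.
Proof. by move=> /allP he hs; apply: eq_eval_regs => r /he /hs. Qed.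

Lemma inputs_static e : all inputs (expr_regs e) -> all static (expr_regs e).
Proof. by apply: sub_all => r; rewrite /inputs /static => /eqP ->. Qed.

Lemma static_released l i : i < h -> all static (expr_regs (e_released l i)).
Proof.
move=> ih; rewrite /e_released all_op all_reg all_esum all_map; apply/andP; split.
  by have := inputs_mult ih; rewrite /inputs /static => /eqP ->.
by apply: all_iota => a _; rewrite /= /static kind_addr.
Qed.

(* The scaled instance read from a store, with harmless values outside the range
   of the indices. *)
Definition val_ptime s i := if i \in cs then eval s (e_ptime i) else 1.
Definition val_weight s i := if i \in cs then eval s (e_weight i) else 0.
Definition val_stime s l := if l < q then eval s (e_stime l) else 0.
Definition val_cap s l := if l < q then eval s (e_cap l) else 0.
Definition val_mult s i := if i \in cs then s (in_mult i) else 0.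
Definition released s l i := if i \in cs then eval s (e_released l i) else 0.

(** * What the registers contain after list scheduling *)

Section Dispatch.
Variable o : store.

Let P := val_ptime o.
Let U := val_stime o.
Let A := released o.

Definition table_k (s : store) l i := s (cur_k l i).
Definition table_t (s : store) l i := s (cur_t l i).

Lemma agree_inputs s : agree static o s -> agree inputs o s.
Proof. by move=> H r; rewrite /inputs => /eqP e; apply: H; rewrite /static e. Qed.

Lemma agree_ptime s i : i \in cs -> agree static o s -> eval s (e_ptime i) = P i.
Proof.
rewrite /P /val_ptime => ic /agree_inputs H; rewrite ic; apply: eval_agree H.
by apply: inputs_ptime; move: ic; rewrite mem_iota.
Qed.

Lemma agree_stime s l : l < q -> agree static o s -> eval s (e_stime l) = U l.
Proof.
rewrite /U /val_stime => lq /agree_inputs H; rewrite lq.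
exact: eval_agree (inputs_stime lq) H.
Qed.

Lemma agree_released s l i : i \in cs -> agree static o s ->
  eval s (e_released l i) = A l i.
Proof.
move=> ic H; rewrite /A /released ic; apply: eval_agree H.
by apply: static_released; move: ic; rewrite mem_iota.
Qed.

Lemma eval_pending s l i : i \in cs -> agree static o s ->
  eval s (e_pending l i) = pending A (table_k s) l i.
Proof.
move=> ic H; rewrite /e_pending evalOp agree_released // eval_esum /pending.
by rewrite /index_iota subn0.
Qed.

Lemma agree_update s v x : 2 < v.1.1 -> agree static o s -> agree static o (update s (addr v) x).
Proof.
move=> hv H r hr; rewrite /update; case: eqP => [e|_]; last exact: H.
by move: hr; rewrite /static e kind_addr leqNgt hv.
Qed.

Lemma updateE s v x v' : update s (addr v) x (addr v') = if v' == v then x else s (addr v').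
Proof. by rewrite /update addr_eq. Qed.

Definition filled l (pi : seq nat) : pred nat := fun r =>
  if name r is Some v then (v == (7, 0, 0)) ||
    [&& (v.1.1 == 9) || (v.1.1 == 10), v.1.2 == l & v.2 \in pi] else false.

Lemma filled_addr l pi v : filled l pi (addr v) = (v == (7, 0, 0)) ||
    [&& (v.1.1 == 9) || (v.1.1 == 10), v.1.2 == l & v.2 \in pi].
Proof. by rewrite /filled nameK. Qed.

(** The classes behind [i] write only their own entries and the clock, so the entries of [i] survive
    to the end. *)
Lemma fill_spec l pi s (s' := step (seqs (fill l pi)) s) :
  uniq pi -> {subset pi <= cs} -> l < q -> agree static o s ->
  [/\ agree (predC (filled l pi)) s s',
      alloc P q U A (table_k s') (table_t s') l pi (s clock)
    & s' clock = s clock + work P pi (table_k s' l)].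
Proof.
move=> + + lq; rewrite {}/s'; elim: pi s => [|i pi IH] s.
  by move=> _ _ _; split => //=; rewrite /work big_nil addn0.
rewrite [uniq _]/= => /andP[ipi upi] sub H.
have ic : i \in cs by apply: sub; rewrite inE eqxx.
rewrite -[fill l (i :: pi)]/(place l i ++ fill l pi) step_seqs_cat.
set s1 := update s (cur_t l i) (s clock).
have H1 : agree static o s1 by exact: agree_update.
set K := eval s1 (if l.+1 < q then e_fitting l i else e_pending l i).
set s2 := update s1 (cur_k l i) K.
have H2 : agree static o s2 by exact: agree_update.
set s3 := step (seqs (place l i)) s.
have s3E : s3 = update s2 clock (s clock + K * P i).
  rewrite -[s3]/(update s2 clock (s2 clock + s2 (cur_k l i) * eval s2 (e_ptime i))).
  rewrite agree_ptime //; congr (update _ _ (_ + _ * _)).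
    by rewrite /s2 /s1 !updateE.
  by rewrite /s2 updateE eqxx.
have H3 : agree static o s3 by rewrite s3E; exact: agree_update.
have sub' : {subset pi <= cs} by move=> x xp; apply: sub; rewrite inE xp orbT.
have [F al ck] := IH s3 upi sub' H3.
set s' := step _ s3 in F al ck *.
have k'i : s' (cur_k l i) = K.
  rewrite F /=; last by rewrite filled_addr /= (negbTE ipi) andbF.
  by rewrite s3E /s2 !updateE eqxx.
have t'i : s' (cur_t l i) = s clock.
  rewrite F /=; last by rewrite filled_addr /= (negbTE ipi) andbF.
  by rewrite s3E /s2 /s1 !updateE eqxx.
have ck3 : s3 clock = s clock + K * P i by rewrite s3E updateE eqxx.
split.
- move=> r /= nr; rewrite F /=; last first.
    move: nr; rewrite /filled; case: (name r) => // v.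
    rewrite !negb_or => /andP[-> /=]; apply: contra => /and3P[-> -> h0].
    by rewrite inE h0 orbT.
  have hr v : filled l (i :: pi) (addr v) -> (r == addr v) = false.
    by move=> hv; apply/eqP => e; rewrite e hv in nr.
  rewrite s3E /s2 /s1 /update !hr // filled_addr /= ?eqxx ?mem_head //.
- split; first exact: t'i.
  + rewrite [LHS]k'i /K.
    (* [pending] depends on the entries of earlier periods only, so its value when it is computed is
       also its value in the final tables. *)
    have pe : pending A (table_k s') l i = pending A (table_k s1) l i.
      rewrite /pending; congr (_ - _); rewrite !big_nat; apply: eq_bigr => a /= al'.
      rewrite /table_k F /=; last first.
        by rewrite filled_addr /= (negbTE ipi) !andbF.
      rewrite s3E /s2 !updateE /=; case: eqP => // -[e].
      by move: al'; rewrite e ltnn.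
    case: ifP => lq1; last by rewrite eval_pending // pe.
    rewrite /e_fitting eval_emin eval_pending // pe.
    rewrite -[X in minn _ X]/((eval s1 (e_stime l.+1) - s1 clock +
      (eval s1 (e_ptime i) - 1)) %/ eval s1 (e_ptime i)).
    rewrite agree_stime // !agree_ptime // /fitting; congr (minn _ ((_ - _ + _) %/ _)).
    by rewrite /s1 updateE.
  + by rewrite [table_k _ _ _]k'i -ck3.
- by rewrite ck ck3 /work big_cons [table_k _ _ _]k'i addnA.
Qed.

Definition ran n (pi : seq nat) : pred nat := fun r =>
  if name r is Some v then (v == (7, 0, 0)) ||
    [&& (v.1.1 == 9) || (v.1.1 == 10), v.1.2 < n & v.2 \in pi] else false.

Lemma eq_alloc k k' t t' l pi s :
  {in pi, k l =1 k' l} -> {in pi, t l =1 t' l} ->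
  {in pi, pending A k l =1 pending A k' l} ->
  alloc P q U A k t l pi s -> alloc P q U A k' t' l pi s.
Proof.
elim: pi s => //= i pi IH s hk ht hp [ti ki al].
have ii : i \in i :: pi by exact: mem_head.
have sub x : x \in pi -> x \in i :: pi by rewrite inE orbC => ->.
split; [by rewrite -ht|by rewrite -hk // -hp|rewrite -hk //].
by apply: IH al => x /sub; [exact: hk|exact: ht|exact: hp].
Qed.

Lemma eq_avail k k' pi l : (forall a, a < l -> {in pi, k a =1 k' a}) ->
  avail P pi U k l = avail P pi U k' l.
Proof.
elim: l => //= l IH H; rewrite IH; last by move=> a al; apply: H; apply: ltnW.
by rewrite (eq_work _ (H l (ltnSn l))).
Qed.

Lemma agree_step p s s' : agree (predC p) s s' -> (forall r, p r -> ~~ static r) ->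
  agree static o s -> agree static o s'.
Proof.
move=> F hp H r sr; rewrite F ?H //=.
by apply/negP => /hp; rewrite sr.
Qed.

Lemma run_spec n pi s (s' := step (seqs (run_dispatch pi n)) s) :
  uniq pi -> {subset pi <= cs} -> n <= q -> agree static o s ->
  [/\ agree (predC (ran n pi)) s s',
      forall l, l < n -> alloc P q U A (table_k s') (table_t s') l pi
                               (begin P pi U (table_k s') l)
    & s' clock = avail P pi U (table_k s') n].
Proof.
move=> upi sub + H; rewrite {}/s'; elim: n => [|n IH] nq.
  split => //=; last by rewrite updateE eqxx.
  move=> r nr /=; rewrite /update; case: eqP => // e.
  by move: nr; rewrite e /= /ran nameK eqxx.
have [F al ck] := IH (ltnW nq).
have -> : run_dispatch pi n.+1 = run_dispatch pi n ++ run_period pi n.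
  by rewrite /run_dispatch -addn1 iotaD map_cat flatten_cat /= cats0.
rewrite step_seqs_cat; set s1 := step _ s in F al ck *.
have H1 : agree static o s1.
  apply: agree_step F _ H => r; rewrite /ran /static /kind; case: (name r) => // v.
  by case/orP => [/eqP-> //|/and3P[/orP[]/eqP-> _ _]].
set s2 := update s1 clock (maxn (U n) (s1 clock)).
have H2 : agree static o s2 by exact: agree_update.
have e2 : step (seqs (run_period pi n)) s1 = step (seqs (fill n pi)) s2.
  rewrite -[LHS]/(step (seqs (fill n pi))
    (update s1 clock (eval s1 (emax (e_stime n) (Reg clock))))).
  by rewrite eval_emax agree_stime.
rewrite {}e2; have [F2 al2 ck2] := fill_spec upi sub nq H2.
set s' := step _ s2 in F2 al2 ck2 *.
have keep a i : a < n -> s' (cur_k a i) = s1 (cur_k a i) /\ s' (cur_t a i) = s1 (cur_t a i).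
  by move=> an; split; rewrite F2 /=; rewrite ?filled_addr /s2 ?updateE //= (ltn_eqF an).
have pend l : l <= n -> pending A (table_k s1) l =1 pending A (table_k s') l.
  move=> ln i; rewrite /pending; congr (_ - _); rewrite !big_nat; apply: eq_bigr => a /= al'.
  by rewrite /table_k (keep a i _).1 // (leq_trans al' ln).
have av l : l <= n -> avail P pi U (table_k s1) l = avail P pi U (table_k s') l.
  move=> ln; apply: eq_avail => a al' i _.
  by rewrite /table_k (keep a i _).1 // (leq_trans al' ln).
have s2c : s2 clock = begin P pi U (table_k s') n.
  by rewrite /s2 updateE eqxx ck av.
split.
- move=> r /= nr; rewrite F2 /=; last first.
    move: nr; rewrite /ran /filled; case: (name r) => // v; apply: contra.
    by case/orP => [->//|/and3P[-> /eqP-> ->]]; rewrite ltnSn orbT.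
  rewrite /s2 /update; case: eqP => [e|_]; first by move: nr; rewrite e /ran nameK eqxx.
  rewrite F //=; move: nr; rewrite /ran; case: (name r) => // v; apply: contra.
  by case/orP => [->//|/and3P[-> h1 ->]]; rewrite ltnS (ltnW h1) orbT.
- move=> l; rewrite ltnS leq_eqVlt => /predU1P[->|ln]; first by rewrite -s2c.
  rewrite /begin -av; last exact: ltnW.
  apply: eq_alloc (al l ln) => i _; rewrite ?pend ?(ltnW ln) //.
  + by rewrite /table_k (keep l i ln).1.
  + by rewrite /table_t (keep l i ln).2.
- by rewrite ck2 /= s2c.
Qed.

Let W := val_weight o.
Let cap := val_cap o.

Hypothesis h_gt0 : 0 < h.

Lemma eval_cost s : agree static o s ->
  eval s e_cost = blocks_cost P W cs q (table_k s) (table_t s).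
Proof.
move=> H; rewrite /e_cost eval_esum /blocks_cost /index_iota subn0.
apply: eq_bigr => l _; rewrite eval_esum !big_seq; apply: eq_bigr => i ic.
rewrite -[LHS]/(eval s (e_weight i) * (2 * s (cur_k l i) * s (cur_t l i) +
  eval s (e_ptime i) * s (cur_k l i) * (1 + s (cur_k l i)))).
rewrite agree_ptime // (eval_agree _ (agree_inputs H)); last first.
  by apply: inputs_weight; move: ic; rewrite mem_iota.
by rewrite /W /val_weight ic.
Qed.

Lemma eval_feasible s : agree static o s -> reflect
  (forall l, l < q -> \sum_(0 <= a < l.+1) \sum_(i <- cs) table_k s a i <= cap l)
  (eval s e_feasible != 0).
Proof.
move=> H; rewrite /e_feasible eval_eprod -lt0n.
have E l : l \in ps -> eval s (Op Leq (esum [seq esum [seq Reg (cur_k a i) | i <- cs] |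
    a <- iota 0 l.+1]) (e_cap l)) =
    (\sum_(0 <= a < l.+1) \sum_(i <- cs) table_k s a i <= cap l).
  rewrite mem_iota add0n => /andP[_ lq].
  rewrite evalOp (eval_agree (inputs_cap h_gt0 lq) (agree_inputs H)) eval_esum.
  rewrite /cap /val_cap lq.
  rewrite /index_iota subn0 (eq_bigr (fun a => \sum_(i <- cs) table_k s a i)) //.
  by move=> a _; rewrite eval_esum.
rewrite big_seq (eq_bigr _ E) -big_seq.
apply: (iffP idP) => [|hcap].
  move=> pos l lq; move: pos; rewrite (big_rem l) /= ?mem_iota //.
  by rewrite muln_gt0 lt0b => /andP[].
rewrite big_seq; apply: prodn_cond_gt0 => l; rewrite mem_iota add0n => /andP[_ lq].
by rewrite lt0b hcap.
Qed.

End Dispatch.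

Lemma agree_vals o s : 0 < h -> agree inputs o s ->
  [/\ val_ptime s = val_ptime o, val_weight s = val_weight o,
      val_stime s = val_stime o, val_cap s = val_cap o & val_mult s = val_mult o].
Proof.
move=> h0 H; have lt i : i \in cs -> i < h by rewrite mem_iota.
split; apply: funext => x.
- rewrite /val_ptime; case: ifP => // /lt xh; exact: eval_agree (inputs_ptime xh) H.
- rewrite /val_weight; case: ifP => // /lt xh; exact: eval_agree (inputs_weight xh) H.
- rewrite /val_stime; case: ifP => // xq; exact: eval_agree (inputs_stime xq) H.
- rewrite /val_cap; case: ifP => // xq; exact: eval_agree (inputs_cap h0 xq) H.
- by rewrite /val_mult; case: ifP => // /lt xh; rewrite H // inputs_mult.
Qed.

(* The evaluation of a candidate avoids these registers: otherwise the bound on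
   their length would grow by a constant factor in each iteration. *)
Definition stored : pred nat := fun r => 3 <= kind r <= 6.
Definition unstored : pred nat := fun r => ~~ stored r.

Lemma static_unstored e : all static (expr_regs e) -> all unstored (expr_regs e).
Proof.
by apply: sub_all => r; rewrite /static /unstored /stored => hr; rewrite ltnNge hr.
Qed.

Lemma all_seqs p cmds :
  all p (cmd_regs (seqs cmds)) = all (fun c => all p (cmd_regs c)) cmds.
Proof. by elim: cmds => //= c cmds IH; rewrite all_cat IH. Qed.

Lemma all_flatten_map (T I : Type) (p : pred T) (f : I -> seq T) (J : seq I) :
  all p (flatten [seq f i | i <- J]) = all (fun i => all p (f i)) J.
Proof. by elim: J => //= i J IH; rewrite all_cat IH. Qed.

Lemma mem_cs i : (i \in cs) = (i < h). Proof. by rewrite mem_iota. Qed.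

Lemma mem_ps l : (l \in ps) = (l < q). Proof. by rewrite mem_iota. Qed.

Lemma unstored_ptime i : i \in cs -> all unstored (expr_regs (e_ptime i)).
Proof. by rewrite mem_cs => /inputs_ptime/inputs_static/static_unstored. Qed.

Lemma unstored_stime l : l < q -> all unstored (expr_regs (e_stime l)).
Proof. by move=> /inputs_stime/inputs_static/static_unstored. Qed.

Lemma unstored_addr v : unstored (addr v) = ~~ (3 <= v.1.1 <= 6).
Proof. by rewrite /unstored /stored kind_addr. Qed.

Lemma all_assign p r e :
  all p (cmd_regs (Assign r e)) = p r && all p (expr_regs e).
Proof. by []. Qed.

Lemma evaluate_regs pi :
  {subset pi <= cs} -> avoids stored (cmd_regs (seqs (evaluate pi))).
Proof.
move=> sub; apply/allP; rewrite -[all _ _]/(all unstored _).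
rewrite all_seqs /evaluate all_cat all_seq1 all_assign unstored_addr /=.
apply/andP; split; last first.
  rewrite /e_cost all_esum all_map; apply/allP => l _.
  change (all unstored (expr_regs (esum [seq e_block_cost l i | i <- cs]))).
  rewrite all_esum all_map; apply/allP => i ic.
  change (all unstored (expr_regs (e_block_cost l i))).
  rewrite /e_block_cost 5!all_op 2!all_op !all_reg !unstored_addr unstored_ptime //.
  apply/andP; split => //.
  by move: ic; rewrite mem_cs => /inputs_weight/inputs_static/static_unstored.
rewrite /run_dispatch /= unstored_addr /= all_flatten_map.
apply/allP => l; rewrite mem_iota add0n => /andP[_ lq].
rewrite /run_period /= -/(expr_regs _) unstored_addr /=.
apply/andP; split.
  change (all unstored (expr_regs (emax (e_stime l) (Reg clock)))).
  by rewrite /emax !(all_op _ _ (e_stime l)) (all_op _ _ (Reg _)) !all_reg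
    unstored_stime ?unstored_addr.
rewrite /fill all_flatten_map; apply/allP => i ip; have ic := sub i ip.
have hp : all unstored (expr_regs (e_pending l i)).
  rewrite /e_pending all_op static_unstored /=; last first.
    by apply: static_released; rewrite -mem_cs.
  rewrite all_esum all_map; apply/allP => a _.
  by change (unstored (cur_k a i) && true); rewrite unstored_addr.
rewrite /place /= -/(expr_regs _) !unstored_addr /= andbT.
apply/andP; split; last exact: unstored_ptime.
case: ifP => // lq1.
rewrite /e_fitting /emin.
set d := Op Div _ _.
have hd : all unstored (expr_regs d).
  rewrite /d !(all_op _ Div) (all_op _ Add) (all_op _ Defs.Sub (e_stime _)).
  rewrite (all_op _ Defs.Sub (e_ptime _)) all_reg unstored_stime //.
  by rewrite unstored_addr unstored_ptime.
by rewrite (all_op _ _ (e_pending l i)) (all_op _ _ (e_pending l i)) hp hd.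
Qed.

Lemma uniq_blocks : uniq blocks.
Proof. by apply: allpairs_uniq; rewrite ?iota_uniq // => -[a b] [c d] _ _ [-> ->]. Qed.

Lemma mem_blocks l i : ((l, i) \in blocks) = (l < q) && (i < h).
Proof.
rewrite -mem_ps -mem_cs; apply/allpairsP/andP => [[[a b] /= [al bi [-> ->]]]|[lp ic]] //.
by exists (l, i).
Qed.

Lemma step_wipe s r : step wipe s r = if r \in scratch then 0 else s r.
Proof.
rewrite /wipe; elim: scratch s => //= a J IH s; rewrite -/(assigns J id _) IH inE.
by rewrite /update; case: eqP; case: (r \in J).
Qed.

Lemma step_copy c d s (f := fun k (b : nat * nat) => addr (k, b.1, b.2)) : c != d ->
  let s' := step (assigns blocks (f c) (fun b => Reg (f d b))) s in
  (forall b, b \in blocks -> s' (f c b) = s (f d b)) /\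
  (forall r, kind r != c -> s' r = s r).
Proof.
move=> cd /=; split=> [b bb|r rc].
  rewrite (@step_assigns _ blocks (f c) (fun b => Reg (f d b))) //.
    rewrite map_inj_uniq ?uniq_blocks // => -[a1 a2] [b1 b2] /eqP.
    by rewrite addr_eq => /eqP[-> ->].
  move=> j j' _ _; rewrite inE addr_eq; apply: contra cd => /eqP[-> //].
rewrite step_assigns_out //; apply: contra rc => /mapP[b _ ->].
by rewrite kind_addr.
Qed.

Lemma step_assigns_copy_le (I : Type) (J : seq I) r r' s x :
  (forall a, s a < x) -> forall a, step (assigns J r (fun i => Reg (r' i))) s a < x.
Proof.
elim: J s => //= j J IH s hs a; apply: IH => b.
by rewrite /update; case: eqP.
Qed.

Lemma step_keep s (s' := step keep s) :
  [/\ s' found = 1, s' best = s cur_cost,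
      forall l i, l < q -> i < h -> table_k s l i = s' (best_k l i),
      forall l i, l < q -> i < h -> table_t s l i = s' (best_t l i)
    & agree unstored s s'].
Proof.
rewrite /s' /keep /= {s'}.
set s1 := step _ s; set s2 := step _ s1.
have [k1 f1] := step_copy s (isT : 5 != 9).
have [t2 f2] := step_copy s1 (isT : 6 != 10).
rewrite -/s1 in k1 f1; rewrite -/s2 in t2 f2.
split.
- by rewrite updateE.
- by rewrite !updateE /= f2 ?kind_addr // f1 ?kind_addr.
- move=> l i lq ih; rewrite !updateE /= f2 ?kind_addr //.
  by have := k1 (l, i); rewrite mem_blocks lq ih /= => ->.
- move=> l i lq ih; rewrite !updateE /=.
  by have := t2 (l, i); rewrite mem_blocks lq ih /= => ->; rewrite // f1 // kind_addr.
- move=> r hr; have hk k : 3 <= k <= 6 -> kind r != k.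
    by move=> hk; apply: contraNneq hr => e; rewrite /stored e.
  have hn v : 3 <= v.1.1 <= 6 -> (r == addr v) = false.
    by move=> /hk; apply: contraNF => /eqP ->; rewrite kind_addr.
  have nf : (r == found) = false := hn (3, 0, 0) isT.
  have nb : (r == best) = false := hn (4, 0, 0) isT.
  by rewrite /update nf nb f2 ?hk // f1 ?hk.
Qed.

Lemma step_keep_lt s b : 0 < b -> (forall r, s r < 2 ^ b) -> forall r, step keep s r < 2 ^ b.
Proof.
move=> b0 hs r; rewrite /keep /=.
set s1 := step _ s; have h1 : forall a, s1 a < 2 ^ b by exact: step_assigns_copy_le.
set s2 := step _ s1; have h2 : forall a, s2 a < 2 ^ b by exact: step_assigns_copy_le.
rewrite {1}/update; case: eqP => _; first by rewrite (@leq_exp2l 2 1).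
by rewrite /update; case: eqP.
Qed.

Lemma ran_scratch pi r : {subset pi <= cs} -> ran q pi r -> r \in scratch.
Proof.
move=> sub; rewrite /ran; case e : (name r) => [v|] //; rewrite (name_addr e).
case/orP => [/eqP->|]; first by rewrite inE eqxx.
case/and3P; case: v e => -[k l] i e /= hk lq /sub; rewrite mem_cs => ih.
have hb : (l, i) \in blocks by rewrite mem_blocks lq.
rewrite !inE mem_cat; case/orP: hk => /eqP->.
  by rewrite (map_f (fun b => cur_k b.1 b.2) hb) !orbT.
by rewrite (map_f (fun b => cur_t b.1 b.2) hb) !orbT.
Qed.

Lemma scratch_kind r : r \in scratch -> 6 < kind r.
Proof.
rewrite !inE mem_cat => /or4P[/eqP->|/eqP->|/mapP[b _ ->]|/mapP[b _ ->]];
  by rewrite kind_addr.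
Qed.

Lemma releasedS s l i : l.+1 < q -> released s l i <= released s l.+1 i.
Proof.
move=> lq; rewrite /released; case: ifP => // _; rewrite /e_released !evalOp !eval_esum.
have -> : q - l.+1 = (q - l.+2).+1 by lia.
by rewrite [iota _ _.+1]/= big_cons leq_sub2l // leq_addl.
Qed.

Lemma released_last s i : 0 < q -> i \in cs -> released s q.-1 i = val_mult s i.
Proof.
move=> q0 ic; rewrite /released ic /e_released evalOp eval_esum prednK // subnn big_nil.
by rewrite [LHS]subn0 /val_mult ic.
Qed.

(** * One candidate of the search: correctness and register lengths *)

Section Search.
Variables (o : store) (b0 b1 : nat).
Hypotheses (q_gt0 : 0 < q) (h_gt0 : 0 < h) (b1_gt0 : 0 < b1) (b01 : b0 <= b1).
Hypothesis P_gt0 : forall i, 0 < val_ptime o i.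

Definition solution k t := good_blocks (val_ptime o) cs q (val_stime o) (val_mult o)
  (val_cap o) k t.
Definition sol_cost k t := blocks_cost (val_ptime o) (val_weight o) cs q k t.

(** Two length bounds: the stored schedule results from an evaluation and obeys only the larger
    [b1], while everything an evaluation can read obeys [b0]. Both bounds therefore survive any
    number of candidates. *)
Record invariant (s : store) : Prop := Invariant {
  inv_inputs : agree (fun r => kind r <= 1) o s;
  inv_unstored : narrow stored b0 s;
  inv_narrow : narrow pred0 b1 s;
  inv_found : s found = 0 \/ [/\ s found = 1,
     solution (fun l i => s (best_k l i)) (fun l i => s (best_t l i)) &
     sol_cost (fun l i => s (best_k l i)) (fun l i => s (best_t l i)) = s best] }.

Definition hit z (s : store) := s found = 1 /\ s best <= z.

Variable pi : seq nat.
Hypothesis pi_perm : perm_eq pi cs.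
Hypothesis evaluate_narrow : forall s, narrow stored b0 s ->
  narrow stored b1 (step (seqs (evaluate pi)) s).

Lemma try_order_spec s (s' := step (try_order pi) s) : invariant s ->
  [/\ invariant s', agree (fun r => kind r == 2) s s',
      forall z, hit z s -> hit z s'
    & exists k t, dispatch (val_ptime o) q (val_stime o) (released s) k t pi /\
        ((forall l, l < q ->
            \sum_(0 <= a < l.+1) \sum_(i <- cs) k a i <= val_cap o l) ->
         hit (sol_cost k t) s')].
Proof.
move=> [inp uns nar fnd].
have upi : uniq pi by rewrite (perm_uniq pi_perm) iota_uniq.
have sub : {subset pi <= cs} by move=> x; rewrite (perm_mem pi_perm).
have agr : agree static s s by [].
have inp' : agree inputs o s by move=> r; rewrite /inputs => /eqP e; apply: inp; rewrite e.
have [vP vW vU vC vM] := agree_vals h_gt0 inp'.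
have [F al _] := run_spec upi sub (leqnn q) agr.
set s0 := step _ s in F al.
set s1 := step (seqs (evaluate pi)) s.
have s1E : s1 = update s0 cur_cost (eval s0 e_cost).
  by rewrite /s1 /evaluate step_seqs_cat.
have agr0 : agree static s s0.
  apply: agree_step F _ agr => r /(ran_scratch sub)/scratch_kind.
  by rewrite /static -ltnNge => /ltnW/ltnW/ltnW/ltnW.
have agr1 : agree static s s1 by rewrite s1E; exact: agree_update.
have fr1 : agree (fun r => r \notin scratch) s s1.
  move=> r hr; rewrite s1E /update; case: eqP hr => [->|_ hr].
    by rewrite !inE eqxx orbT.
  by rewrite F //=; apply: contra hr; exact: ran_scratch.
pose k := table_k s1; pose t := table_t s1.
have kE : k = table_k s0.
  by apply: funext => l; apply: funext => i; rewrite /k /table_k s1E updateE.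
have tE : t = table_t s0.
  by apply: funext => l; apply: funext => i; rewrite /t /table_t s1E updateE.
have disp : dispatch (val_ptime o) q (val_stime o) (released s) k t pi.
  by move=> l lq; rewrite kE tE -vP -vU; exact: al.
have cost1 : s1 cur_cost = sol_cost k t.
  by rewrite s1E updateE eqxx (eval_cost agr0) /sol_cost -vP -vW kE tE.
have feasP := eval_feasible h_gt0 agr1.
have good1 : eval s1 e_feasible != 0 -> solution k t.
  move=> /feasP hcap; rewrite /solution.
  apply: (@eq_good_blocks (val_ptime o) pi cs q _ _ _ k k t t) => //.
  apply: (dispatch_good P_gt0 upi disp q_gt0).
  - by move=> l i lq _; exact: releasedS.
  - by move=> i /sub ic; rewrite released_last // vM.
  - move=> l lq; rewrite -vC; apply: leq_trans (hcap l lq); apply: eq_leq.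
    by apply: eq_bigr => a _; exact: perm_big.
(* The evaluation reads only registers bounded by [b0]; the stored ones are untouched and keep the
   bound [b1]. *)
have nar1 : narrow pred0 b1 s1.
  move=> r _; have [hr|hr] := boolP (stored r); last exact: evaluate_narrow.
  rewrite fr1 ?nar //; apply/negP => /scratch_kind.
  by move: hr => /andP[_ h1] h2; move: h1; rewrite leqNgt h2.
set s2 := step (If e_better keep Skip) s1.
have s'E : s' = step wipe s2 by [].
have fr2 : agree unstored s1 s2.
  rewrite /s2 /=; case: ifP => // _.
  by have [] := step_keep s1.
have nar2 : narrow pred0 b1 s2.
  rewrite /s2 /=; case: ifP => // _ r _.
  by apply: step_keep_lt => // a; exact: nar1.
have st' v : v.1.1 <= 6 -> s' (addr v) = s2 (addr v).
  move=> hv; rewrite s'E step_wipe; case: ifP => // /scratch_kind.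
  by rewrite kind_addr ltnNge hv.
have fr' r : unstored r -> r \notin scratch -> s' r = s r.
  by move=> ur nr; rewrite s'E step_wipe (negbTE nr) fr2 // fr1.
have best_s v : 3 <= v.1.1 <= 6 -> s1 (addr v) = s (addr v).
  move=> /andP[_ hv]; rewrite fr1 //; apply/negP => /scratch_kind.
  by rewrite kind_addr ltnNge hv.
have better : eval s1 e_better =
    eval s1 e_feasible * ((s found <= 0) + (1 + s1 cur_cost <= s best)).
  rewrite -[LHS]/(eval s1 e_feasible * ((s1 found <= 0) + (1 + s1 cur_cost <= s1 best))).
  by rewrite (best_s (3, 0, 0) isT) (best_s (4, 0, 0) isT).
have noscr r : kind r <= 2 -> unstored r && (r \notin scratch).
  move=> hr; rewrite /unstored /stored ltnNge hr /=; apply/negP => /scratch_kind.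
  by rewrite ltnNge (leq_trans hr).
have fr_in : agree (fun r => kind r <= 2) s s'.
  by move=> r /noscr /andP[ur nr]; rewrite fr'.
have uns' : narrow stored b0 s'.
  move=> r ur; rewrite s'E step_wipe; case: ifP => [_|/negbT nr]; first by rewrite expn_gt0.
  by rewrite fr2 // fr1 //; exact: uns.
have nar' : narrow pred0 b1 s'.
  by move=> r _; rewrite s'E step_wipe; case: ifP => _; [rewrite expn_gt0|exact: nar2].
have inp1 : agree (fun r => kind r <= 1) o s'.
  by move=> r hr; rewrite fr_in ?inp // ltnW.
have cnt : agree (fun r => kind r == 2) s s'.
  by move=> r /eqP hr; rewrite fr_in // hr.
have [nb|bt] := eqVneq (eval s1 e_better) 0.
  have s21 : s2 = s1 by rewrite /s2 step_If nb eqxx.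
  have sv v : 3 <= v.1.1 <= 6 -> s' (addr v) = s (addr v).
    by move=> hv; rewrite st' ?s21 ?best_s //; case/andP: hv.
  split => //.
  - split => //; rewrite !sv //.
    have -> : (fun l i => s' (best_k l i)) = (fun l i => s (best_k l i)).
      by apply: funext => l; apply: funext => i; rewrite sv.
    have -> // : (fun l i => s' (best_t l i)) = (fun l i => s (best_t l i)).
    by apply: funext => l; apply: funext => i; rewrite sv.
  - by move=> z; rewrite /hit !sv.
  exists k, t; split => // hcap.
  have /feasP : forall l, l < q ->
      \sum_(0 <= a < l.+1) \sum_(i <- cs) table_k s1 a i <= val_cap s l.
    by move=> l lq; rewrite vC hcap.
  (* A feasible candidate that is no improvement: a schedule has been found before, at no greater
     cost. *)
  move=> fz; move: nb; rewrite better => /eqP; rewrite muln_eq0 (negbTE fz) /=.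
  rewrite addn_eq0 !eqb0 -!ltnNge ltnS -cost1 => /andP[f0 bc].
  rewrite /hit !sv //; split; last exact: bc.
  by case: fnd => [e|[]] //; rewrite e in f0.
have s2k : s2 = step keep s1 by rewrite /s2 step_If bt.
have [f2 c2 k2 t2 _] := step_keep s1; rewrite -s2k in f2 c2 k2 t2.
have s'f : s' found = 1 by rewrite st'.
have s'b : s' best = sol_cost k t by rewrite st' // c2.
have k' l : l < q -> {in cs, k l =1 fun i => s' (best_k l i)}.
  by move=> lq i; rewrite mem_cs => ih; rewrite st' // -k2.
have t' l : l < q -> {in cs, t l =1 fun i => s' (best_t l i)}.
  by move=> lq i; rewrite mem_cs => ih; rewrite st' // -t2.
move: bt; rewrite better muln_eq0 negb_or => /andP[fz better1].
split => //.
- split => //; right; split => //.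
    apply: (@eq_good_blocks (val_ptime o) cs cs q _ _ _ _ _ _ _ _ k' t' (good1 fz)) => //.
  by rewrite s'b; apply/esym/(eq_blocks_cost _ _ _ k' t').
- move=> z [h1 h2]; split => //; rewrite s'b -cost1; apply: leq_trans h2.
  by move: better1; rewrite h1 /= add0n; case: ltnP => // /ltnW.
- by exists k, t; split => // _; rewrite /hit s'f s'b.
Qed.

End Search.

Lemma agree_released_fun o s : agree static o s -> released s = released o.
Proof.
move=> H; apply: funext => l; apply: funext => i; rewrite /released.
by case: ifP => // ic; apply: eval_agree H; apply: static_released; rewrite -mem_cs.
Qed.

Lemma try_list_spec o b0 b1 L s (s' := step (seqs [seq try_order pi | pi <- L]) s) :
  0 < q -> 0 < h -> 0 < b1 -> (forall i, 0 < val_ptime o i) ->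
  (forall pi, pi \in L -> perm_eq pi cs /\ forall s, narrow stored b0 s ->
     narrow stored b1 (step (seqs (evaluate pi)) s)) ->
  invariant o b0 b1 s ->
  [/\ invariant o b0 b1 s', agree (fun r => kind r == 2) s s',
      forall z, hit z s -> hit z s'
    & forall pi, pi \in L -> exists k t,
        dispatch (val_ptime o) q (val_stime o) (released s) k t pi /\
        ((forall l, l < q ->
            \sum_(0 <= a < l.+1) \sum_(i <- cs) k a i <= val_cap o l) ->
         hit (sol_cost o k t) s')].
Proof.
move=> q0 h0 b10 P0; rewrite {}/s'; elim: L s => [|pi L IH] s hL Is.
  by split.
have [pp pn] := hL pi (mem_head _ _).
have [I1 c1 h1 [k [t [dk hk]]]] := try_order_spec q0 h0 b10 P0 pp pn Is.
set s1 := step (try_order pi) s in I1 c1 h1 hk.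
rewrite -[step _ s]/(step (seqs [seq try_order pi' | pi' <- L]) s1).
have hL' : forall pi', pi' \in L -> _ := fun pi' hpi =>
  hL pi' (mem_behead (s := pi :: L) hpi).
have [I2 c2 h2 ex2] := IH _ hL' I1.
split => //.
- by move=> r hr; rewrite c2 // c1.
- by move=> z /h1 /h2.
(* Trying an order changes neither input nor counters, so all orders see the same releases. *)
have rel : released s1 = released s.
  apply: agree_released_fun => r; rewrite /static leq_eqVlt => /orP[e|r1]; first exact: c1.
  by rewrite (inv_inputs I1) // (inv_inputs Is).
move=> pi'; rewrite in_cons => /predU1P[->|hpi].
  by exists k, t; split => // /hk /h2.
by have [k' [t' [d' H']]] := ex2 _ hpi; exists k', t'; rewrite -rel.
Qed.

Lemma uniform_const (I : eqType) (J : seq I) (Q : I -> nat -> Prop) :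
  (forall i, i \in J -> exists C, Q i C) ->
  (forall i C C', C <= C' -> Q i C -> Q i C') -> exists C, forall i, i \in J -> Q i C.
Proof.
move=> + mono; elim: J => [|i J IH] H; first by exists 0.
have [C HC] := H i (mem_head _ _).
have [|C' HC'] := IH; first by move=> j jJ; apply: H; rewrite inE jJ orbT.
exists (C + C') => j; rewrite inE => /predU1P[->|/HC']; first exact: mono (leq_addr _ _) HC.
exact/mono/leq_addl.
Qed.

Lemma loopfree_seqs cmds : loopfree (seqs cmds) = all loopfree cmds.
Proof. by elim: cmds => //= c cmds ->. Qed.

Lemma loopfree_evaluate pi : loopfree (seqs (evaluate pi)).
Proof.
rewrite loopfree_seqs /evaluate all_cat /= !andbT all_flatten_map.
apply/allP => l _ /=; rewrite /fill all_flatten_map.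
by apply/allP => i _ /=.
Qed.

Lemma loopfree_try_all : loopfree try_all.
Proof.
rewrite loopfree_seqs all_map; apply/allP => pi _.
change (loopfree (seqs (evaluate pi)) && ((loopfree keep && true) && loopfree wipe)).
by rewrite loopfree_evaluate loopfree_assigns /= !loopfree_assigns.
Qed.

Lemma loopfree_emit : loopfree emit.
Proof. by rewrite /= loopfree_assigns. Qed.

Lemma uniq_counters : uniq counters.
Proof.
rewrite map_inj_uniq ?uniq_blocks // => -[a1 a2] [b1 b2] /eqP.
by rewrite /counter addr_eq => /eqP[-> ->].
Qed.

Lemma kind_counters v : v \in counters -> kind v = 2.
Proof. by case/mapP => b _ ->; rewrite kind_addr. Qed.

Lemma in_cells x : x \in cells -> [/\ x.1.1 < q, x.1.2 < h & x.2 < 5].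
Proof.
case/allpairsP => -[[l i] c] [hb hc ->]; have {hb} : (l, i) \in blocks := hb.
have {hc} : c \in iota 0 5 := hc.
by rewrite mem_iota mem_blocks => c5 /andP[].
Qed.

Lemma cell_eq x y : x \in cells -> y \in cells -> cell x = cell y -> x = y.
Proof.
case: x y => [[l i] c] [[l' i'] c'] /in_cells[/= _ ih c5] /in_cells[/= _ ih' c5'].
rewrite /cell /= => e.
have e5 : l * h + i = l' * h + i'.
  by have := congr1 (divn^~ 5) e; rewrite /= !(mulnC 5) !divnMDl // !divn_small // !addn0.
have h0 : 0 < h by apply: leq_ltn_trans ih.
have el : l = l'.
  by have := congr1 (divn^~ h) e5; rewrite /= !divnMDl // !divn_small // !addn0.
by move: e e5; rewrite el => e /addnI ei; rewrite ei in e *; rewrite (_ : c = c') //; lia.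
Qed.

Lemma uniq_cells : uniq cells.
Proof.
apply: allpairs_uniq; rewrite ?uniq_blocks ?iota_uniq //.
by move=> [a b] [a' b'] _ _ [-> ->].
Qed.

Lemma mem_cells l i c : l < q -> i < h -> c < 5 -> (l, i, c) \in cells.
Proof.
move=> lq ih c5; apply/allpairsP; exists ((l, i), c); split => //.
  by rewrite mem_blocks lq.
by rewrite [_.2]/= mem_iota.
Qed.

Lemma cell_small x : x \in cells -> cell x < zbase.
Proof.
case: x => [[l i] c] /in_cells[/= lq ih c5]; rewrite /cell /zbase /=.
have : l * h + i < q * h by apply: leq_trans (leq_mul lq (leqnn h)); rewrite mulSn; lia.
by lia.
Qed.

Lemma addr_big v : zbase <= addr v.
Proof. by rewrite /addr -lock leq_addr. Qed.

Lemma emit_spec s l i (s' := step emit s) (r := cell (l, i, 0)) : l < q -> i < h ->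
  [/\ s' r = l, s' r.+1 = i, s' r.+2 = s (best_t l i), s' r.+3 = eval s e_scale
    & s' r.+4 = s (best_k l i)].
Proof.
move=> lq ih; rewrite /s' {s'}.
set s1 := update s clock (eval s e_scale).
have -> : step emit s = step (assigns cells cell e_cell) s1 by [].
have H c : c < 5 -> step (assigns cells cell e_cell) s1 (r + c) = eval s1 (e_cell (l, i, c)).
  move=> c5; have -> : r + c = cell (l, i, c) by rewrite /r /cell /= addn0.
  apply: step_assigns; last exact: mem_cells.
    by rewrite map_inj_in_uniq ?uniq_cells //; exact: cell_eq.
  move=> [[a b'] e] y /in_cells[/= _ _]; move: (cell y) (@cell_small y) => cy yc.
  move=> + /yc {}yc; rewrite /e_cell /=.
  have nin v : cy != addr v by rewrite neq_ltn (leq_trans yc (addr_big v)).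
  by case: e => [|[|[|[|[|e]]]]] // _; rewrite inE nin.
have := H 0 isT; have := H 1 isT; have := H 2 isT; have := H 3 isT; have := H 4 isT.
rewrite !addnS addn0 => -> -> -> -> ->; split => //=.
- by rewrite /s1 updateE.
- by rewrite /s1 updateE eqxx.
- by rewrite /s1 updateE.
Qed.

Section Bounds.
Variables (X : Type) (size_of : X -> nat).
Hypothesis size_gt1 : forall x, 1 < size_of x.

(** A pure power suffices: as the size is at least 2, constants go into the exponent. *)
Definition polynomial (f : X -> nat) := exists d, forall x, f x <= size_of x ^ d.

Lemma polynomial_const c : polynomial (fun=> c).
Proof. by exists c => x; apply/ltnW/ltn_expl. Qed.

Lemma polynomialD f g : polynomial f -> polynomial g -> polynomial (fun x => f x + g x).
Proof.
move=> [d1 h1] [d2 h2]; exists (d1 + d2).+1 => x; rewrite expnS.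
apply: leq_trans (_ : 2 * size_of x ^ (d1 + d2) <= _); last by rewrite leq_mul2r size_gt1 orbT.
have p1 : size_of x ^ d1 <= size_of x ^ (d1 + d2) by rewrite leq_exp2l // leq_addr.
have p2 : size_of x ^ d2 <= size_of x ^ (d1 + d2) by rewrite leq_exp2l // leq_addl.
by rewrite mul2n -addnn leq_add // ?(leq_trans (h1 x)) ?(leq_trans (h2 x)).
Qed.

Lemma polynomialM f g : polynomial f -> polynomial g -> polynomial (fun x => f x * g x).
Proof.
by move=> [d1 h1] [d2 h2]; exists (d1 + d2) => x; rewrite expnD leq_mul.
Qed.

Lemma polynomial_loop_time M T E n : polynomial M -> polynomial T -> polynomial E ->
  polynomial (fun x => loop_time (M x) (T x) (E x) n).
Proof.
move=> hM hT hE; elim: n => [|n IH]; first exact: hT.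
apply: (polynomialM (f := fun x => (M x).+1)).
  by have [d hd] := polynomialD (polynomial_const 1) hM; exists d.
apply: polynomialD (polynomial_const 3); apply: polynomialD => //.
exact: polynomialM (polynomial_const 2) hE.
Qed.

End Bounds.

(** The exponent [d] depends on [q] and [h] only. The program does at least as well as any target
    [tgt] on the grid combined with any order [pi]; the target is chosen only in the analysis. *)
Lemma program_spec : 0 < q -> 0 < h -> exists d, forall o b K,
  0 < b -> 0 < K -> o accuracy = K -> narrow pred0 b o ->
  (forall r, 2 <= kind r -> o r = 0) -> (forall i, 0 < val_ptime o i) ->
  forall z (tgt : nat -> nat) pi, pi \in permutations cs ->
  (forall v, v \in counters ->
     exists2 j, tgt v = grid (3 * K) j & tgt v <= eval o e_bound) ->
  (forall s k t, agree (fun r => kind r <= 1) o s -> {in counters, s =1 tgt} ->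
     dispatch (val_ptime o) q (val_stime o) (released s) k t pi ->
     (forall l, l < q -> \sum_(0 <= a < l.+1) \sum_(i <- cs) k a i <= val_cap o l) /\
     sol_cost o k t <= z) ->
  exists n s' k t, [/\ exec program o n s', n <= (b + K + 2) ^ d, solution o k t,
    sol_cost o k t <= z &
    forall l i, l < q -> i < h -> let r := cell (l, i, 0) in
      [/\ s' r = l, s' r.+1 = i, s' r.+2 = t l i, s' r.+3 = eval o e_scale
        & s' r.+4 = k l i]].
Proof.
move=> q0 h0.
have [CE HE] : exists C, forall pi, pi \in permutations cs ->
    (forall b s, 0 < b -> narrow stored b s ->
      narrow stored (C * b) (step (seqs (evaluate pi)) s)).
  apply: uniform_const => [pi|pi C C' CC' H b s b0 /(H _ _ b0)]; last first.
    by apply: narrow_le; rewrite leq_mul2r CC' orbT.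
  rewrite mem_permutations => pp.
  have [C C0 HC] := step_bound (loopfree_evaluate pi); exists C => b s b0 hs.
  apply: (HC stored s b b0 _ hs).2; apply: evaluate_regs => i.
  by rewrite (perm_mem pp).
have [CG HG] : exists C, forall v, v \in counters -> forall b s, 0 < b -> narrow pred0 b s ->
    eval_time s (guard v) <= C * b ^ 2 /\ eval_time s (next v) <= C * b ^ 2.
  apply: uniform_const => [v _|v C C' CC' H b s b0 /(H _ _ b0)[h1 h2]]; last first.
    by split; [apply: leq_trans h1 _|apply: leq_trans h2 _]; rewrite leq_mul2r CC' orbT.
  have [C1 _ H1] := eval_bound (guard v); have [C2 _ H2] := eval_bound (next v).
  exists (C1 + C2) => b s b0 hs; rewrite mulnDl.
  have [_ t1] := H1 pred0 s b b0 (fun _ _ => isT) hs.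
  have [_ t2] := H2 pred0 s b b0 (fun _ _ => isT) hs.
  by split; [apply: leq_trans t1 _; rewrite leq_addr|apply: leq_trans t2 _; rewrite leq_addl].
have [CT _ HT] := step_bound loopfree_try_all.
have [CM _ HM] := step_bound loopfree_emit.
(* The counters reach at most [2 * B + 1], where [B] is twice the number of jobs and hence at most
   [2 * h * 2 ^ b]; [h + 3] additional bits are enough. *)
pose B0 (x : nat * nat) := x.1 + (h + 3).
pose B1 x := CE.+1 * B0 x.
pose N (x : nat * nat) := 3 * x.2.
(* The number of grid points from [grid_exceeds]. *)
pose M x := N x + 2 * N x * B0 x.
pose sz (x : nat * nat) := x.1 + x.2 + 2.
have sz1 x : 1 < sz x by rewrite /sz addn2.
have p1 : polynomial sz (fun x => x.1) by exists 1 => x; rewrite /sz; lia.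
have p2 : polynomial sz (fun x => x.2) by exists 1 => x; rewrite /sz; lia.
have pB0 : polynomial sz B0 := polynomialD sz1 p1 (polynomial_const sz1 (h + 3)).
have pB1 : polynomial sz B1 := polynomialM (polynomial_const sz1 CE.+1) pB0.
have pN : polynomial sz N := polynomialM (polynomial_const sz1 3) p2.
have pM : polynomial sz M :=
  polynomialD sz1 pN (polynomialM (polynomialM (polynomial_const sz1 2) pN) pB0).
have pS C : polynomial sz (fun x => C * B1 x ^ 2) :=
  polynomialM (polynomial_const sz1 C) (polynomialM pB1 pB1).
have [d Hd] := polynomialD sz1
  (polynomial_loop_time sz1 (size counters) pM (pS CT) (pS CG)) (pS CM).
exists d => o b K b_gt0 K_gt0 oK onar o0 P0 z tgt pi pip htgt hz.
pose x := (b, K); have b00 : 0 < B0 x by rewrite /B0 addn_gt0 b_gt0.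
have b10 : 0 < B1 x by rewrite muln_gt0.
have b01 : B0 x <= B1 x by rewrite leq_pmull.
set B := eval o e_bound in htgt.
have HB : (2 * B).+1 < 2 ^ B0 x.
  rewrite /B /e_bound evalOp eval_esum [binop_sem _ _ _]/=.
  have : \sum_(i <- cs) eval o (e_mult i) <= h * 2 ^ b.
    rewrite -[h in h * _](size_iota 0) -sum1_size big_distrl /=.
    by apply: leq_sum => i _; rewrite mul1n; apply/ltnW/onar.
  rewrite /B0 /= !expnD; have := ltn_expl h (isT : 1 < 2).
  have : 0 < 2 ^ b by rewrite expn_gt0.
  set S := \sum_(i <- cs) _; set p := 2 ^ b; set w := 2 ^ h; rewrite -[2 ^ 3]/8.
  move=> pp hw hS; have : h * p + p <= p * w by rewrite -mulSnr mulnC leq_mul2l hw orbT.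
  by lia.
have bB : bitlen B <= B0 x by apply: bitlen_leq => //; lia.
have N0 : 0 < N x by rewrite /N muln_gt0.
have hM : B < grid (N x) (M x).
  apply: leq_trans (grid_exceeds N0 B) _.
  by apply: grid_homo; rewrite leq_add2l leq_mul2l bB orbT.
have evB s : invariant o (B0 x) (B1 x) s -> eval s e_bound = B.
  move=> Is; apply: eval_agree inputs_bound _ => r /eqP e.
  by apply: (inv_inputs Is); rewrite e.
have I0 : invariant o (B0 x) (B1 x) o.
  have nb : narrow pred0 (B0 x) o by apply: narrow_le onar; rewrite leq_addr.
  split => //; first by move=> r _; exact: nb.
    exact: narrow_le b01 nb.
  by left; rewrite o0 // kind_addr.
have := @loop_overP guard next counters (N x) B (M x) (CT * B1 x ^ 2) (CG * B1 x ^ 2)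
  try_all (invariant o (B0 x) (B1 x)) (hit z) tgt _ hM.
move=> /(_ N0).
have Hg s v : v \in counters -> invariant o (B0 x) (B1 x) s ->
    eval s (guard v) = (s v <= B) /\ eval_time s (guard v) <= CG * B1 x ^ 2.
  move=> vc Is; split; last by case: (HG v vc _ s b10 (inv_narrow Is)).
  by rewrite evalOp (evB s Is).
move=> /(_ Hg).
have Hn s v : v \in counters -> invariant o (B0 x) (B1 x) s ->
    eval s (next v) = grid_next (N x) (s v) /\ eval_time s (next v) <= CG * B1 x ^ 2.
  move=> vc Is; split; last by case: (HG v vc _ s b10 (inv_narrow Is)).
  have aK : s accuracy = K by rewrite (inv_inputs Is) // kind_addr.
  by rewrite /grid_next /N /= -aK.
move=> /(_ Hn).
have Hu s v y : v \in counters -> y <= (2 * B).+1 -> invariant o (B0 x) (B1 x) s ->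
    invariant o (B0 x) (B1 x) (update s v y).
  move=> /kind_counters kv yB [h1 h2 h3 h4].
  have y0 : y < 2 ^ B0 x by exact: leq_ltn_trans HB.
  have av k l i : k != 2 -> update s v y (addr (k, l, i)) = s (addr (k, l, i)).
    move=> k2; rewrite /update; case: eqP => // e.
    by move: kv; rewrite -e kind_addr => /eqP; rewrite (negbTE k2).
  split.
  - by move=> r hr; rewrite /update; case: eqP => [e|_]; [move: hr; rewrite e kv|exact: h1].
  - by move=> r hr; rewrite /update; case: eqP => // _; exact: h2.
  - move=> r hr; rewrite /update; case: eqP => _; last exact: h3.
    by apply: leq_trans y0 _; rewrite leq_exp2l.
  - rewrite !av //.
    have -> : (fun l i => update s v y (best_k l i)) = (fun l i => s (best_k l i)).
      by apply: funext => l; apply: funext => i; rewrite av.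
    have -> // : (fun l i => update s v y (best_t l i)) = (fun l i => s (best_t l i)).
    by apply: funext => l; apply: funext => i; rewrite av.
move=> /(_ Hu).
have Hh s v y : v \in counters -> hit z s -> hit z (update s v y).
  move=> /kind_counters kv; rewrite /hit /update.
  by do 2![case: eqP => [e|_]; first by move: kv; rewrite -e kind_addr].
move=> /(_ Hh).
have Hb s : invariant o (B0 x) (B1 x) s -> exists n s',
    [/\ exec try_all s n s', n <= CT * B1 x ^ 2, invariant o (B0 x) (B1 x) s',
      hit z s \/ {in counters, s =1 tgt} -> hit z s' & {in counters, s' =1 s}].
  move=> Is; have [[n en ln] _] := HT pred0 s _ b10 (fun _ _ => isT) (inv_narrow Is).
  have hL pi' : pi' \in permutations cs -> perm_eq pi' cs /\
      forall s, narrow stored (B0 x) s -> narrow stored (B1 x) (step (seqs (evaluate pi')) s).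
    move=> hp; split; first by rewrite -mem_permutations.
    move=> s1 /(HE _ hp _ _ b00); apply: narrow_le.
    by rewrite leq_mul2r leqnSn orbT.
  have [I1 c1 h1 ex1] := try_list_spec q0 h0 b10 P0 hL Is.
  exists n, (step try_all s); split => //.
  - case=> [/h1 //|ht]; have [k [t [dk Hk]]] := ex1 _ pip.
    have [hc hs] := hz s k t (inv_inputs Is) ht dk.
    by have [f1 f2] := Hk hc; split => //; exact: leq_trans hs.
  - by move=> v /kind_counters kv; rewrite c1 // kv.
move=> /(_ Hb htgt counters o uniq_counters (fun _ h => h) I0).
move=> [n1 [s1 [e1 l1 I1 H1 _]]].
(* No counter lies outside all loops, so the condition on enclosing counters is vacuous. *)
have [f1 bz] : hit z s1 by apply: H1; right => v; rewrite !inE andNb.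
have [[n2 e2 l2] _] := HM pred0 s1 _ b10 (fun _ _ => isT) (inv_narrow I1).
have [] := inv_found I1; first by rewrite f1.
move=> [_ sol solc].
exists (n1 + n2), (step emit s1), (fun l i => s1 (best_k l i)), (fun l i => s1 (best_t l i)).
split => //.
- exact: ExecSeq e1 e2.
- by apply: leq_trans (Hd x); rewrite leq_add.
- by rewrite solc.
move=> l i lq ih; have := emit_spec s1 lq ih.
rewrite (@eval_agree inputs _ o s1 inputs_scale) // => r /eqP e.
by apply: (inv_inputs I1); rewrite e.
Qed.

End Program.

(** * Correctness of the approximation *)

Section Encoding.
Local Open Scope nat_scope.

Lemma size_flatten_const (T : Type) (f : T -> seq nat) n s :
  (forall x, size (f x) = n) -> size (flatten [seq f x | x <- s]) = n * size s.
Proof. by move=> fn; elim: s => [|x s IH] /=; rewrite ?muln0 // size_cat IH fn mulnS. Qed.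

Lemma nth_flatten_const (T : Type) x0 (f : T -> seq nat) n s i c :
  (forall x, size (f x) = n) -> i < size s -> c < n ->
  nth 0 (flatten [seq f x | x <- s]) (n * i + c) = nth 0 (f (nth x0 s i)) c.
Proof.
move=> fn + cn; elim: s i => //= x s IH [|i] is_; rewrite nth_cat fn.
  by rewrite muln0 add0n cn.
by rewrite mulnS -addnA ltnNge leq_addr /= addKn IH.
Qed.

Variables (q h : nat) (I : instance q h).

Lemma size_encode : size (encode I) = 2 + 7 * h + 4 * q.
Proof.
rewrite /encode /= size_cat /= (@size_flatten_const _ _ 7) //.
rewrite (@size_flatten_const _ _ 4) // -!cardE !card_ord; lia.
Qed.

Lemma load_mult (i : 'I_h) : load (encode I) (in_mult i) = mult I i.
Proof.
rewrite /load /encode /in_mult add1n /= nth_cat (@size_flatten_const _ _ 7) //.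
rewrite -cardE card_ord ltn_pmul2l // ltn_ord.
have := @nth_flatten_const _ i (fun i => mult I i :: encode_rat (ptime I i) ++
  encode_rat (req I i) ++ encode_rat (weight I i)) 7 (enum 'I_h) i 0.
by rewrite addn0 => -> //; [rewrite nth_ord_enum|rewrite -cardE card_ord].
Qed.

Lemma load_class (i : 'I_h) c : c < 6 -> load (encode I) (in_class i c) =
  nth 0 (encode_rat (ptime I i) ++ encode_rat (req I i) ++ encode_rat (weight I i)) c.
Proof.
move=> c6; rewrite /load /encode /in_class add2n /= addSn /= nth_cat.
rewrite (@size_flatten_const _ _ 7) // -cardE card_ord.
have -> : (7 * i + c).+1 < 7 * h by have := ltn_ord i; lia.
have := @nth_flatten_const _ i (fun i => mult I i :: encode_rat (ptime I i) ++
  encode_rat (req I i) ++ encode_rat (weight I i)) 7 (enum 'I_h) i c.+1.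
by rewrite addnS => -> //; [rewrite nth_ord_enum|rewrite -cardE card_ord].
Qed.

Lemma load_period (l : 'I_q) c : c < 4 -> load (encode I) (in_period_reg h l c) =
  nth 0 (encode_rat (stime I l) ++ encode_rat (supply I l)) c.
Proof.
move=> c4; rewrite /load /encode /in_period_reg.
have -> : 2 + 7 * h + 4 * l + c = (7 * h + (4 * l + c).+1).+1 by lia.
rewrite [nth _ _ _]/= nth_cat (@size_flatten_const _ _ 7) // -cardE card_ord.
rewrite ltnNge leq_addr /= addKn /=.
have := @nth_flatten_const _ l (fun l => encode_rat (stime I l) ++
  encode_rat (supply I l)) 4 (enum 'I_q) l c.
by move=> -> //; [rewrite nth_ord_enum|rewrite -cardE card_ord].
Qed.

Lemma load_out r : zbase q h <= r -> load (encode I) r = 0.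
Proof. by move=> zr; rewrite /load nth_default // size_encode; move: zr; rewrite /zbase; lia. Qed.

Lemma load_lt r : load (encode I) r < 2 ^ input_size I.
Proof.
have [rs|rs] := ltnP r (size (encode I)); last by rewrite /load nth_default // expn_gt0.
apply: leq_trans (ltn_bitlen _) _; rewrite leq_exp2l // /input_size /load.
by rewrite (big_rem _ (mem_nth 0 rs)) /= leq_addr.
Qed.

End Encoding.

Section Rationals.
Local Open Scope ring_scope.

Lemma encode_ratE (x : rat) : 0 <= x -> x = (`|numq x|%N)%:R / (`|denq x|%N)%:R.
Proof.
move=> x0; rewrite -[LHS]divq_num_den; congr (_ / _); rewrite pmulrn gez0_abs //.
by rewrite numq_ge0.
Qed.

Lemma ratio_scale (n d D : nat) : (0 < D)%N -> (0 < d)%N -> (d %| D)%N ->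
  n%:R / d%:R = (n * (D %/ d))%:R / D%:R :> rat.
Proof.
move=> D0 d0 dD; apply/eqP; rewrite eqr_div ?pnatr_eq0 -?lt0n //.
by rewrite -!natrM eqr_nat -{1}(divnK dD) mulnA.
Qed.

End Rationals.

(** * The encoded input as a scaled instance *)

Section Bridge.
Local Open Scope nat_scope.
Variables (q h : nat) (I : instance q h) (K : nat).
Hypotheses (q_gt0 : 0 < q) (h_gt0 : 0 < h) (vI : valid I).

Definition origin : store := update (load (encode I)) (accuracy q h) K.

Let o := origin.
Let cs := iota 0 h.
Let ps := iota 0 q.
Let D := eval o (e_scale q h).
Let E := eval o (e_wscale h).

Lemma origin_input r : inputs q h r -> o r = load (encode I) r.
Proof.
move=> hr; rewrite /o /origin /update; case: eqP => // e.
by move: hr; rewrite e /inputs kind_addr.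
Qed.

Lemma origin_accuracy : o (accuracy q h) = K.
Proof. by rewrite /o /origin /update eqxx. Qed.

Lemma origin_out r : 1 < kind q h r -> o r = 0.
Proof.
move=> hr; rewrite /o /origin /update; case: eqP hr => [->|_ hr]; first by rewrite kind_addr.
by apply: load_out; rewrite leqNgt; apply/negP => /kind_input e; rewrite e in hr.
Qed.

Lemma origin_narrow : narrow pred0 (input_size I + K) o.
Proof.
move=> r _; rewrite /o /origin /update; case: eqP => _.
  by apply: leq_trans (ltn_expl K (isT : 1 < 2)) _; rewrite leq_exp2l // leq_addl.
by apply: leq_trans (load_lt I r) _; rewrite leq_exp2l // leq_addr.
Qed.

Lemma origin_mult (i : 'I_h) : o (in_mult i) = mult I i.
Proof. by rewrite origin_input ?load_mult ?inputs_mult. Qed.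

Lemma origin_class (i : 'I_h) c : c < 6 -> o (in_class i c) =
  nth 0 (encode_rat (ptime I i) ++ encode_rat (req I i) ++ encode_rat (weight I i)) c.
Proof. by move=> c6; rewrite origin_input ?load_class ?inputs_class. Qed.

Lemma origin_period (l : 'I_q) c : c < 4 -> o (in_period_reg h l c) =
  nth 0 (encode_rat (stime I l) ++ encode_rat (supply I l)) c.
Proof. by move=> c4; rewrite origin_input ?load_period ?inputs_period. Qed.

Lemma denq_nat_gt0 x : 0 < `|denq x|.
Proof. by rewrite absz_gt0 denq_neq0. Qed.

Lemma dvdn_prod (J : seq nat) (F : nat -> nat) j : j \in J -> F j %| \prod_(i <- J) F i.
Proof. by move=> jJ; rewrite (big_rem j) //= dvdn_mulr. Qed.

Lemma eval_ratio n D' d : eval o (e_ratio n D' d) = o n * (eval o D' %/ o d).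
Proof. by []. Qed.

Lemma class_den_gt0 i c : i \in cs -> c \in [:: 1; 3; 5] -> 0 < o (in_class i c).
Proof.
rewrite mem_iota add0n => /andP[_ ih].
by rewrite !inE => /or3P[] /eqP ->; rewrite -[i]/(val (Ordinal ih)) origin_class //= denq_nat_gt0.
Qed.

Lemma period_den_gt0 l c : l \in ps -> c \in [:: 1; 3] -> 0 < o (in_period_reg h l c).
Proof.
rewrite mem_iota add0n => /andP[_ lq].
by rewrite !inE => /orP[] /eqP ->; rewrite -[l]/(val (Ordinal lq)) origin_period //= denq_nat_gt0.
Qed.

Lemma scaleE : D = (\prod_(i <- cs) o (in_class i 1)) * \prod_(l <- ps) o (in_period_reg h l 1).
Proof. by rewrite /D /e_scale evalOp !eval_eprod. Qed.

Lemma prod_seq_gt0 (J : seq nat) (F : nat -> nat) :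
  (forall j, j \in J -> 0 < F j) -> 0 < \prod_(j <- J) F j.
Proof. by move=> H; rewrite big_seq; apply: prodn_cond_gt0. Qed.

Lemma scale_pos : 0 < D.
Proof.
rewrite scaleE muln_gt0 !prod_seq_gt0 // => j hj; first exact: period_den_gt0.
exact: class_den_gt0.
Qed.

Lemma wscaleE : E = \prod_(i <- cs) o (in_class i 5).
Proof. by rewrite /E /e_wscale eval_eprod. Qed.

Lemma wscale_pos : 0 < E.
Proof. by rewrite wscaleE prod_seq_gt0 // => j hj; exact: class_den_gt0. Qed.

Let F := eval o (e_rscale q h).

Lemma rscaleE : F = (\prod_(l <- ps) o (in_period_reg h l 3)) * o (in_class 0 3).
Proof. by rewrite /F /e_rscale evalOp eval_eprod. Qed.

Lemma mem0 : 0 \in cs. Proof. by rewrite mem_iota. Qed.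

Lemma rscale_pos : 0 < F.
Proof.
rewrite rscaleE muln_gt0 class_den_gt0 ?mem0 // andbT prod_seq_gt0 // => j hj.
exact: period_den_gt0.
Qed.

Lemma mem_ord n (i : 'I_n) : val i \in iota 0 n.
Proof. by rewrite mem_iota add0n ltn_ord. Qed.

Lemma val_ptime_gt0 i : 0 < val_ptime q h o i.
Proof.
rewrite /val_ptime; case: ifP => // ic; rewrite eval_ratio -/D.
have ih : i < h by move: ic; rewrite mem_iota.
have dD : o (in_class i 1) %| D by rewrite scaleE dvdn_mulr // (dvdn_prod (fun i => o (in_class i 1)) ic).
rewrite muln_gt0 divn_gt0; last exact: class_den_gt0.
rewrite (dvdn_leq scale_pos dD) andbT.
rewrite -[i]/(val (Ordinal ih)) origin_class //= absz_gt0 numq_eq0.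
by rewrite gt_eqF // (ptime_gt0 vI).
Qed.

Lemma sum_requirements a : (forall j : job I, req I (cls j) = a) ->
  ((\sum_(i <- cs) val_mult h o i)%:R * a = \sum_(l < q) supply I l :> rat)%R.
Proof.
move=> ha; rewrite -(req_supply vI) (eq_bigr (fun=> a)) // sumr_const -[(a *+ _)%R]mulr_natl.
congr (_%:R * a)%R; rewrite -sum1_card (@sum_jobs _ _ I nat (fun i _ => 1)) big_iota_ord.
apply: eq_bigr => i _; rewrite sum1_card card_ord /val_mult mem_ord.
by rewrite origin_mult.
Qed.

Lemma scaled_origin : scaled I D E (val_mult h o) (val_ptime q h o) (val_weight h o)
  (val_stime q h o) (val_cap q h o).
Proof.
have dvC i : i \in cs -> o (in_class i 1) %| D.
  by move=> ic; rewrite scaleE dvdn_mulr // (dvdn_prod (fun i => o (in_class i 1)) ic).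
have dvP l : l \in ps -> o (in_period_reg h l 1) %| D.
  by move=> lp; rewrite scaleE dvdn_mull // (dvdn_prod (fun l => o (in_period_reg h l 1)) lp).
split.
- exact: scale_pos.
- exact: wscale_pos.
- by move=> i; rewrite /val_mult mem_ord origin_mult.
- move=> i; rewrite [LHS]encode_ratE ?(ltW (ptime_gt0 vI i)) //.
  rewrite (ratio_scale _ scale_pos) ?denq_nat_gt0 //; last first.
    by have := dvC i (mem_ord i); rewrite origin_class.
  by rewrite /val_ptime mem_ord eval_ratio !origin_class.
- move=> i; rewrite [LHS]encode_ratE ?(ltW (weight_gt0 vI i)) //.
  have dE : o (in_class i 5) %| E by rewrite wscaleE (dvdn_prod (fun i => o (in_class i 5)) (mem_ord i)).
  rewrite (ratio_scale _ wscale_pos) ?denq_nat_gt0 //; last first.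
    by move: dE; rewrite origin_class.
  by rewrite /val_weight mem_ord eval_ratio !origin_class.
- move=> l; have u0 : (0 <= stime I l)%R.
    have [l0|l0] := posnP l; first by rewrite (stime_first vI).
    by rewrite -(@stime_first _ _ _ vI (Ordinal q_gt0)) // ltW // (stime_incr vI).
  rewrite [LHS]encode_ratE // (ratio_scale _ scale_pos) ?denq_nat_gt0 //; last first.
    by have := dvP l (mem_ord l); rewrite origin_period.
  by rewrite /val_stime ltn_ord eval_ratio !origin_period.
- move=> l n a ha; set i0 := Ordinal h_gt0.
  pose j0 : job I := existT _ i0 (Ordinal (mult_gt0 vI i0)).
  have aE : a = req I i0 by rewrite -(ha j0).
  (* The total requirement equals the total supply, which is positive; so the division in [e_cap] is
     by a positive number. *)
  have a0 : (0 < a)%R.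
    have s0 : (0 < \sum_(l < q) supply I l)%R.
      rewrite (bigD1 (Ordinal q_gt0)) //= ltr_wpDr ?(supply_gt0 vI) //.
      by apply: sumr_ge0 => l' _; rewrite ltW // (supply_gt0 vI).
    rewrite lt_neqAle eq_sym aE (req_ge0 vI) andbT -aE; apply/eqP => e.
    by move: s0; rewrite -(sum_requirements ha) e mulr0 ltxx.
  have F0 := rscale_pos.
  set A := eval o (e_req q h).
  have aA : (a = A%:R / F%:R)%R.
    rewrite aE [LHS]encode_ratE ?(req_ge0 vI) // (ratio_scale _ F0) ?denq_nat_gt0 //.
      by rewrite /A eval_ratio -/F -[0]/(val i0) !origin_class.
    have : o (in_class i0 3) %| F by rewrite rscaleE dvdn_mull.
    by rewrite origin_class.
  have A0 : 0 < A.
    by rewrite lt0n; apply/eqP => e; move: a0; rewrite aA e mul0r ltxx.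
  have sE (b : 'I_q) : (supply I b = (eval o (e_supply q h b))%:R / F%:R)%R.
    rewrite [LHS]encode_ratE ?(ltW (supply_gt0 vI b)) //.
    rewrite (ratio_scale _ F0) ?denq_nat_gt0 //; last first.
      have : o (in_period_reg h b 3) %| F.
        by rewrite rscaleE dvdn_mulr // (dvdn_prod (fun l => o (in_period_reg h l 3)) (mem_ord b)).
      by rewrite origin_period.
    by rewrite eval_ratio -/F !origin_period.
  rewrite /val_cap ltn_ord /e_cap evalOp eval_esum [binop_sem _ _ _]/= -/A leq_divRL //.
  have -> : (\sum_(l' < q | (l' <= l)%N) supply I l' =
      (\sum_(i <- iota 0 l.+1) eval o (e_supply q h i))%:R / F%:R)%R.
    rewrite big_iota_ord natr_sum mulr_suml.
    rewrite (big_ord_widen_cond q xpredT (fun b => (eval o (e_supply q h b))%:R / F%:R)%R) //.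
    apply: eq_big => [b|b _]; first by rewrite ltnS.
    exact: sE.
  rewrite aA mulrA ler_pM2r ?invr_gt0 ?ltr0n // -natrM ler_nat.
  by [].
Qed.

End Bridge.

(** * Assignments, their schedules and their rounding *)

Section Optimum.
Local Open Scope nat_scope.
Variables (q h : nat) (o : store).
Hypotheses (q_gt0 : 0 < q) (h_gt0 : 0 < h).
Hypothesis P_gt0 : forall i, 0 < val_ptime q h o i.

Let cs := iota 0 h.
Let P := val_ptime q h o.
Let W := val_weight h o.
Let U := val_stime q h o.
Let m := val_mult h o.
Let cap := val_cap q h o.

Definition smith_order := sort (smith P W) cs.

Lemma smith_perm : perm_eq smith_order cs.
Proof. by rewrite /smith_order perm_sort. Qed.

Lemma smith_pairwise : pairwise (smith P W) smith_order.
Proof.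
rewrite -sorted_pairwise; first by apply: sort_sorted => i j; exact: leq_total.
move=> j i k; rewrite /smith => ij jk.
have := P_gt0 j; rewrite -/P => pj.
(* Transitivity of comparing ratios, by cancelling the positive [P j]. *)
rewrite -(leq_pmul2l pj); apply: leq_trans (_ : P i * (P k * W j) <= _).
  by rewrite mulnCA leq_mul2l jk orbT.
by rewrite mulnCA [leqRHS]mulnCA leq_mul2l ij orbT.
Qed.

Lemma mem_smith i : (i \in smith_order) = (i \in cs).
Proof. exact: perm_mem smith_perm i. Qed.

Lemma smith_uniq : uniq smith_order.
Proof. by rewrite (perm_uniq smith_perm) iota_uniq. Qed.

Definition feasible_assignment (g : nat -> nat -> nat) :=
  (forall i, i \in cs -> \sum_(0 <= l < q) g l i = m i) /\
  (forall l, l < q -> \sum_(0 <= a < l.+1) \sum_(i <- cs) g a i <= cap l).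

Lemma dispatch_caps A k t g : dispatch P q U A k t smith_order ->
  (forall l i, l.+1 < q -> i \in cs -> A l i <= A l.+1 i) ->
  feasible_assignment g ->
  (forall l i, l < q -> i \in cs -> A l i <= \sum_(0 <= a < l.+1) g a i) ->
  forall l, l < q -> \sum_(0 <= a < l.+1) \sum_(i <- cs) k a i <= cap l.
Proof.
move=> disp homo [_ hcap] hA l lq; apply: leq_trans (hcap l lq).
rewrite exchange_big [leqRHS]exchange_big /= !big_seq; apply: leq_sum => i ic.
apply: leq_trans (hA l i lq ic).
apply: (dispatch_le smith_uniq disp q_gt0 _ lq); last by rewrite mem_smith.
by move=> a j aq; rewrite mem_smith; exact: homo.
Qed.

Lemma dispatch_assignment A k t g : dispatch P q U A k t smith_order ->
  (forall l i, l.+1 < q -> i \in cs -> A l i <= A l.+1 i) ->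
  (forall i, i \in cs -> A q.-1 i = m i) ->
  (forall l i, l < q -> i \in cs -> \sum_(0 <= a < l.+1) g a i = A l i) ->
  sol_cost q h o k t <= total_cost P W cs q U g.
Proof.
move=> disp homo last hg.
have := dispatch_cost P_gt0 smith_uniq disp q_gt0 _ _ smith_pairwise _ (mult := m) (g := g).
rewrite /sol_cost (eq_blocks_cost P W smith_perm (fun _ _ _ _ => erefl) (fun _ _ _ _ => erefl)).
rewrite {2}/total_cost.
have -> : total_cost P W smith_order q U g = total_cost P W cs q U g.
  have hb l : avail P smith_order U g l = avail P cs U g l.
    by elim: l => //= l ->; rewrite (perm_work _ _ smith_perm).
  by apply: eq_bigr => l _; rewrite /begin hb (perm_period_cost _ _ _ _ smith_perm).
apply.
- by move=> l i lq; rewrite mem_smith; exact: homo.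
- by move=> i; rewrite mem_smith; exact: last.
- by move=> l i lq; rewrite mem_smith; exact: hg.
Qed.

Definition set_counters (g : nat -> nat -> nat) : store := fun r =>
  if name q h r is Some v then
    if v.1.1 == 2 then g v.1.2 v.2 else o r else o r.

Lemma set_counter g l i : set_counters g (counter q h l i) = g l i.
Proof. by rewrite /set_counters nameK. Qed.

Lemma set_counters_inputs g : agree (inputs q h) o (set_counters g).
Proof.
move=> r; rewrite /inputs /kind /set_counters; case: (name q h r) => // v /eqP ->.
by [].
Qed.

Lemma releasedE s l i : i \in cs -> agree (inputs q h) o s -> l < q ->
  released q h s l i = m i - \sum_(l.+1 <= a < q) s (counter q h a i).
Proof.
move=> ic H lq; rewrite /released ic /e_released evalOp eval_esum [binop_sem _ _ _]/=.
rewrite /index_iota -/cs /m /val_mult ic; congr (_ - _).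
by apply: H; apply: inputs_mult; move: ic; rewrite mem_iota.
Qed.

(** The schedule comes from running the program's own list scheduling on a store whose counters hold
    [g] itself, off the grid. *)
Lemma solution_of_assignment g : feasible_assignment g ->
  exists k t, solution q h o k t /\ sol_cost q h o k t <= total_cost P W cs q U g.
Proof.
move=> fg; have [gm gc] := fg; pose s := set_counters g.
have sub : {subset smith_order <= iota 0 h} by move=> i; rewrite mem_smith.
have inp := set_counters_inputs g; rewrite -/s in inp.
have [vP _ vU _ vM] := agree_vals h_gt0 inp.
have [_ al _] := run_spec smith_uniq sub (leqnn q) (fun r _ => erefl (s r)).
set s' := step _ s in al; pose k := table_k q h s'; pose t := table_t q h s'.
have disp : dispatch P q U (released q h s) k t smith_order.
  by move=> l lq; rewrite /P /U -vP -vU; exact: al.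
have rel l i : l < q -> i \in cs -> released q h s l i = \sum_(0 <= a < l.+1) g a i.
  move=> lq ic; rewrite releasedE // -gm // (big_cat_nat (n := l.+1)) //=.
  rewrite [X in _ - X](eq_bigr (fun a => g a i)); last by move=> a _; exact: set_counter.
  by rewrite addnK.
have homo l i : l.+1 < q -> i \in cs -> released q h s l i <= released q h s l.+1 i.
  by move=> lq _; exact: releasedS.
have lst i : i \in cs -> released q h s q.-1 i = m i.
  by move=> ic; rewrite released_last // vM.
have hcap := dispatch_caps disp homo fg (fun l i lq ic => eq_leq (rel l i lq ic)).
exists k, t; split; last first.
  by apply: (dispatch_assignment disp homo lst) => l i lq ic; rewrite rel.
apply: (@eq_good_blocks P smith_order cs q _ _ _ k k t t smith_perm) => //.
apply: (dispatch_good P_gt0 smith_uniq disp q_gt0).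
- by move=> l i lq; rewrite mem_smith; exact: homo.
- by move=> i; rewrite mem_smith; exact: lst.
- move=> l lq; apply: leq_trans (hcap l lq); apply: eq_leq; apply: eq_bigr => a _.
  exact: perm_big smith_perm.
Qed.

(* Rounding up the numbers of jobs of the later periods only moves jobs to later
   periods, and it multiplies no number by more than [1 + 1 / N]. *)
Lemma rounded_assignment N s g k t (x : nat -> nat -> nat) :
  feasible_assignment g -> agree (inputs q h) o s ->
  (forall l i, l < q -> i \in cs -> s (counter q h l i) = x l i) ->
  (forall l i, l < q -> i \in cs -> g l i <= x l i /\ N * x l i <= N.+1 * g l i) ->
  dispatch P q U (released q h s) k t smith_order ->
  (forall l, l < q -> \sum_(0 <= a < l.+1) \sum_(i <- cs) k a i <= cap l) /\
  N ^ 2 * sol_cost q h o k t <= N.+1 ^ 2 * total_cost P W cs q U g.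
Proof.
move=> fg inp sx gx disp; have [gm gc] := fg.
have [_ _ _ _ vM] := agree_vals h_gt0 inp.
have rel l i : l < q -> i \in cs ->
    released q h s l i = m i - \sum_(l.+1 <= a < q) x a i.
  move=> lq ic; rewrite releasedE //; congr (_ - _).
  by rewrite !big_nat; apply: eq_bigr => a /andP[_ aq]; exact: sx.
have homo l i : l.+1 < q -> i \in cs -> released q h s l i <= released q h s l.+1 i.
  by move=> lq _; exact: releasedS.
have lst i : i \in cs -> released q h s q.-1 i = m i.
  by move=> ic; rewrite released_last // vM.
have le_g l i : l < q -> i \in cs -> released q h s l i <= \sum_(0 <= a < l.+1) g a i.
  move=> lq ic; rewrite rel // -gm // (big_cat_nat (n := l.+1)) //= leq_subLR addnC.
  rewrite leq_add2r big_nat [leqRHS]big_nat; apply: leq_sum => a /andP[_ aq].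
  by case: (gx a i aq ic).
split; first exact: dispatch_caps disp homo fg le_g.
(* The assignment that the rounded counters amount to after truncation. *)
pose g' l i := released q h s l i - (if l is l'.+1 then released q h s l' i else 0).
have g'S l i : l < q -> i \in cs -> \sum_(0 <= a < l.+1) g' a i = released q h s l i.
  elim: l => [|l IH] lq ic; first by rewrite big_nat1 /g' subn0.
  by rewrite big_nat_recr //= IH ?(ltnW lq) // /g' subnKC // homo.
apply: leq_trans (_ : N ^ 2 * total_cost P W cs q U g' <= _).
  by rewrite leq_mul2l (dispatch_assignment disp homo lst) ?orbT.
(* The first period receives what the later ones leave, at most [g 0 i]; every other period receives
   at most its rounded number. *)
apply: total_cost_scale => -[|l] i lq ic.
  apply: leq_trans (_ : N * g 0 i <= _); last by rewrite leq_mul2r leqnSn orbT.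
  by rewrite leq_mul2l /g' subn0 (leq_trans (le_g 0 i lq ic)) ?big_nat1 ?orbT.
have [gl xl] := gx l.+1 i lq ic; apply: leq_trans xl; rewrite leq_mul2l; apply/orP; right.
rewrite /g' !rel ?(ltnW lq) // [X in _ - (_ - X)]big_ltn //; lia.
Qed.

End Optimum.

Section Optimal.
Local Open Scope nat_scope.
Variables (q h : nat) (I : instance q h) (K : nat).
Hypotheses (q_gt0 : 0 < q) (h_gt0 : 0 < h).
Hypotheses (vI : valid I) (eqI : equal_requirements I).

Let o := origin I K.

(** Total supply equals total requirement, so all jobs can wait for the last supply; hence a
    solution exists. *)
Lemma last_period_assignment : feasible_assignment q h o
  (fun l i => if l == q.-1 then val_mult h o i else 0).
Proof.
have sc := scaled_origin K q_gt0 h_gt0 vI; rewrite -/o in sc.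
have sumg n (c : nat) : \sum_(0 <= l < n) (if l == q.-1 then c else 0) =
    if q.-1 < n then c else 0.
  elim: n => [|n IH]; first by rewrite big_geq.
  rewrite big_nat_recr //= IH [in RHS]ltnS [in RHS]leq_eqVlt (eq_sym q.-1).
  by have [->|_] := eqVneq n; rewrite ?ltnn ?addn0 ?add0n.
split=> [i ic|l lq]; first by rewrite sumg // prednK // leqnn.
rewrite exchange_big /=.
under eq_bigr => i _ do rewrite sumg //.
case: ltnP => ql; last by rewrite big1.
have [a ha] := eqI.
rewrite -[val_cap q h o l]/(val_cap q h o (Ordinal lq)).
rewrite -(scaled_cap sc (Ordinal lq) _ ha) (sum_requirements K vI ha).
rewrite le_eqVlt; apply/orP; left; apply/eqP/eq_bigl => b /=.
by have := ltn_ord b; lia.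
Qed.

(** Scaled costs are natural numbers, so one of them is least. *)
Lemma least_solution : exists k t, solution q h o k t /\
  forall k' t', solution q h o k' t' -> sol_cost q h o k t <= sol_cost q h o k' t'.
Proof.
have P0 := val_ptime_gt0 K vI.
have [k0 [t0 [s0 _]]] := solution_of_assignment q_gt0 h_gt0 P0 last_period_assignment.
pose Q n := `[< exists k t, solution q h o k t /\ sol_cost q h o k t = n >].
have ex : exists n, Q n by exists (sol_cost q h o k0 t0); apply/asboolP; exists k0, t0.
case: (ex_minnP ex) => n /asboolP[k [t [sol <-]]] nmin; exists k, t; split => // k' t' s'.
by apply: nmin; apply/asboolP; exists k', t'.
Qed.

End Optimal.

(** * From the integer accuracy to the factor [1 + eps] *)

Section Accuracy.
Local Open Scope ring_scope.
Variables (R : realType) (eps : R).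
Hypothesis eps_gt0 : 0 < eps.

Let K := `|Num.ceil eps^-1|%N.

Lemma accuracyE : K%:R = (Num.ceil eps^-1)%:~R :> R.
Proof. by rewrite /K pmulrn gez0_abs // ltW // ceil_gt0 invr_gt0. Qed.

Lemma accuracy_gt0 : (0 < K)%N.
Proof. by rewrite absz_gt0 gt_eqF // ceil_gt0 invr_gt0. Qed.

Lemma accuracy_ge : eps^-1 <= K%:R.
Proof. by rewrite accuracyE ceil_ge. Qed.

Lemma accuracy_le : K%:R <= eps^-1 + 1.
Proof.
have := ceilB1_lt eps^-1; rewrite intrB -accuracyE => H.
by apply: ltW; rewrite -ltrBlDr.
Qed.

(** [(1 + 1 / (3 * K)) ^ 2 = 1 + 2 / (3 * K) + 1 / (9 * K ^ 2)], which is at most [1 + 1 / K] and so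
    at most [1 + eps]. *)
Lemma rounding_factor (x y : R) : 0 <= y ->
  (3 * K)%:R ^+ 2 * x <= (3 * K).+1%:R ^+ 2 * y -> x <= (1 + eps) * y.
Proof.
move=> y0; have K0 : 0 < K%:R :> R by rewrite ltr0n accuracy_gt0.
have h1 : 1 <= eps * K%:R.
  by rewrite -ler_pdivrMl // mulr1 accuracy_ge.
have K1 : 1 <= K%:R :> R by rewrite ler1n accuracy_gt0.
have e1 : (3 * K)%:R = 3 * K%:R :> R by rewrite natrM.
have e2 : (3 * K).+1%:R = 3 * K%:R + 1 :> R by rewrite -natr1 e1.
rewrite e1 e2 => hx.
have N0 : 0 < (3 * K%:R) ^+ 2 :> R by rewrite exprn_gt0 // mulr_gt0.
rewrite -(ler_pM2l N0); apply: le_trans hx _; rewrite mulrA ler_wpM2r //.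
move: K0 h1 K1; set k : R := K%:R; nra.
Qed.

End Accuracy.

Local Open Scope ring_scope.

Theorem theorem4 (R : realType) (q h : nat) (q_gt0 : (0 < q)%N)
    (h_gt0 : (0 < h)%N) :
  exists (A : R -> cmd) (f : {poly {poly R}}),
    uniform_family A /\
    forall (eps : R) (I : instance q h),
      0 < eps -> valid I -> equal_requirements I ->
      exists (n : nat) (s : store) (C : compact q h) (S : job I -> R) (OPT : R),
        exec (A eps) (load (encode I)) n s /\
        n%:R <= f.[(input_size I)%:R%:P].[eps^-1] /\
        outputs s C /\
        represents C S /\
        feasible S /\
        is_minimum I OPT /\
        cost S <= (1 + eps) * OPT.
Proof.
have [d Hd] := program_spec q_gt0 h_gt0.
pose X : {poly {poly R}} := 'X; pose Y : {poly {poly R}} := ('X : {poly R})%:P.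
exists (fun eps => Seq (Assign (accuracy q h) (Const `|Num.ceil eps^-1|%N)) (program q h)).
(* [X] stands for the input size and [Y] for [1 / eps]. As [K] is at most [Y + 1], storing it takes
   at most [Y + 2], and the program runs with [b] equal to the size plus [K]. *)
exists (Y + 2%:R + (X + Y + Y + 4%:R) ^+ d); split; first by exists (program q h), (accuracy q h).
move=> eps I eps0 vI eqI; set K := `|Num.ceil eps^-1|%N.
have K0 : (0 < K)%N by exact: accuracy_gt0.
pose o := origin I K; pose cs := iota 0 h.
have sc := scaled_origin K q_gt0 h_gt0 vI; rewrite -/o in sc.
have P0 := val_ptime_gt0 K vI; rewrite -/o in P0.
set D := eval o (e_scale q h) in sc; set E := eval o (e_wscale h) in sc.
have D0 : 0 < D%:R :> R by rewrite ltr0n (scale_gt0 sc).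
have E0 : 0 < E%:R :> R by rewrite ltr0n (wscale_gt0 sc).
have c0 : 0 < 2 * D%:R * E%:R :> R by rewrite !mulr_gt0.
have [k0 [t0 [sol0 min0]]] := least_solution K q_gt0 h_gt0 vI eqI; rewrite -/o in sol0 min0.
pose S0 := realize D (val_ptime q h o) R k0 t0 : job I -> R.
have fS0 : feasible S0 by exact: (realize_feasible sc vI eqI q_gt0 h_gt0 R sol0).
have costE k t : solution q h o k t ->
    2 * D%:R * E%:R * cost (realize D (val_ptime q h o) R k t : job I -> R) =
    (sol_cost q h o k t)%:R.
  by move=> sol; exact: (realize_cost sc R sol).
(* Any feasible schedule costs at least [total_cost] of its counts, and these counts are realized by
   a solution made of blocks. *)
have optS0 : is_minimum I (cost S0).
  split; first by exists S0.
  move=> S /(feasible_counts sc vI eqI q_gt0)[g [gm gc gcost]].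
  have [k [t [sol le_g]]] := solution_of_assignment q_gt0 h_gt0 P0 (conj gm gc).
  rewrite -(ler_pM2l c0) costE //; apply: le_trans gcost; rewrite ler_nat.
  by apply: leq_trans le_g; exact: min0.
have [g [gm gc gcost]] := feasible_counts sc vI eqI q_gt0 fS0.
rewrite costE // ler_nat in gcost.
pose N := (3 * K)%N.
have N0 : (0 < N)%N by rewrite muln_gt0.
have round y : exists j, (y <= grid N j)%N /\ (N * grid N j <= N.+1 * y)%N.
  by have [j h1 h2] := grid_round N0 y; exists j.
have [x hx] := choice round.
pose tgt r := if name q h r is Some v then grid N (x (g v.1.2 v.2)) else 0%N.
have b0 : (0 < input_size I + K)%N by rewrite addn_gt0 K0 orbT.
(* The rounded optimum; taking the integer part is harmless because scaled costs are integers. *)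
pose z := ((N.+1 ^ 2 * sol_cost q h o k0 t0) %/ N ^ 2)%N.
have pip : smith_order q h o \in permutations cs.
  by rewrite mem_permutations smith_perm.
have htgt v : v \in counters q h ->
    exists2 j, tgt v = grid N j & (tgt v <= eval o (e_bound h))%N.
  case/mapP => -[l i]; rewrite mem_blocks => /andP[lq ih] ->; rewrite /tgt nameK.
  exists (x (g l i)) => //; have [_ h2] := hx (g l i).
  have ic : i \in cs by rewrite mem_iota.
  have gi : (g l i <= val_mult h o i)%N.
    by rewrite -(gm i ic) (bigD1_seq l) ?mem_index_iota ?iota_uniq //= leq_addr.
  have mi : (val_mult h o i <= \sum_(a <- cs) eval o (e_mult a))%N.
    by rewrite (big_rem i ic) /= /val_mult ic leq_addr.
  have -> : eval o (e_bound h) = (2 * \sum_(a <- cs) eval o (e_mult a))%N.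
    by rewrite /e_bound evalOp eval_esum.
  rewrite -(leq_pmul2l N0); apply: leq_trans h2 _.
  rewrite mulnCA mulnA; apply: leq_mul; last exact: leq_trans gi mi.
  by rewrite mul2n -addnn -addn1 leq_add2l.
have hz s k t : agree (fun r => kind q h r <= 1)%N o s -> {in counters q h, s =1 tgt} ->
    dispatch (val_ptime q h o) q (val_stime q h o) (released q h s) k t (smith_order q h o) ->
    (forall l, (l < q)%N ->
       (\sum_(0 <= a < l.+1) \sum_(i <- cs) k a i <= val_cap q h o l)%N) /\
    (sol_cost q h o k t <= z)%N.
  move=> inp ht disp.
  have inp' : agree (inputs q h) o s by move=> r /eqP e; apply: inp; rewrite e.
  have sx l i : (l < q)%N -> i \in cs -> s (counter q h l i) = grid N (x (g l i)).
    move=> lq ic; rewrite ht; first by rewrite /tgt nameK.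
    apply/mapP; exists (l, i) => //; rewrite mem_blocks lq.
    by move: ic; rewrite mem_iota.
  have [hc hle] := rounded_assignment q_gt0 h_gt0 P0 (conj gm gc) inp' sx
    (fun l i _ _ => hx (g l i)) disp.
  split => //; rewrite /z leq_divRL ?expn_gt0 ?N0 // mulnC.
  by apply: leq_trans hle _; rewrite leq_mul2l gcost orbT.
have [n [s [k [t [ex ln sol cz out]]]]] := Hd o _ K b0 K0 (origin_accuracy I K)
  (origin_narrow I K) (@origin_out _ _ I K) P0 z tgt _ pip htgt hz.
pose C := Compact (fun (l : 'I_q) (i : 'I_h) => (t l i)%:R / D%:R)
  (fun (l : 'I_q) (i : 'I_h) => k l i).
exists ((eval_time (load (encode I)) (Const K)).+1 + n)%N, s, C,
  (realize D (val_ptime q h o) R k t), (cost S0).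
split; first by apply: ExecSeq ex; exact: ExecAssign.
split.
  rewrite !(hornerD, horner_exp, hornerC, hornerX, hornerMn).
  have Ky := accuracy_le eps0; rewrite -/K in Ky.
  have bK : (bitlen K <= K)%N by apply: bitlen_leq => //; exact: ltn_expl.
  apply: (@le_trans _ _ (K.+1 + (input_size I + K + K + 2) ^ d)%:R).
    by rewrite ler_nat leq_add.
  rewrite natrD natrX lerD //.
    by rewrite -natr1; lra.
  have s0 : 0 <= (input_size I)%:R :> R by exact: ler0n.
  have y0 : 0 <= K%:R :> R by exact: ler0n.
  rewrite lerXn2r // ?nnegrE ?ler0n //; first by lra.
  by rewrite !natrD; lra.
split.
  move=> l i; have := out l i (ltn_ord l) (ltn_ord i).
  rewrite /cell /= addn0 => -[-> -> -> -> ->]; split => //.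
  exact: (scale_gt0 sc).
split; first by apply: (realize_represents sc vI q_gt0 h_gt0 R sol).
split; first exact: (realize_feasible sc vI eqI q_gt0 h_gt0 R sol).
split; first exact: optS0.
apply: (rounding_factor eps0); rewrite -/K -/N.
  by rewrite -(pmulr_rge0 _ c0) costE.
rewrite -(ler_pM2l c0) mulrCA costE // [leRHS]mulrCA costE // -!natrX -!natrM ler_nat.
apply: leq_trans (leq_mul (leqnn _) cz) _.
by rewrite /z mulnC leq_divM.
Qed.
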